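(* Let $g_0$ be a fixed density supported on a known compact interval $[a,b]$ for which there are constants $\alpha\in(0,1]$, $L_0<\infty$, $0<m_0\le M_0<\infty$ with $m_0\le g_0(x)\le M_0$ and $|g_0(x)-g_0(y)|\le L_0|x-y|^\alpha$ for all $x,y\in[a,b]$. Let $\beta_{01},\dots,\beta_{0n}$ be i.i.d. with density $g_0$, let $X\in\mathbb R^{m\times n}$ ($m\ge n$) be a random design matrix independent of $\boldsymbol\beta_0$, and let $\boldsymbol Y\mid X,\boldsymbol\beta_0\sim\mathcal N(X\boldsymbol\beta_0,\sigma^2I_m)$, with $\sigma^2>0$ known (possibly depending on $(m,n)$). The P\'olya tree posterior is computed conditional on the realized design $X$, treating $X$ as fixed. Suppose the rows $x_1,\dots,x_m\in\mathbb R^n$ of $X$ are i.i.d. Gaussian vectors with $$x_i\sim\mathcal N(\boldsymbol\mu_n,\Sigma_n),\qquad \Omega_n:=\Sigma_n+\boldsymbol\mu_n\boldsymbol\mu_n^\top,\qquad \lambda_{\min}(\Omega_n)\ge\kappa$$ for some constant $\kappa>0$ independent of $m,n$. Suppose further that $m\ge\Gamma n$ for all sufficiently large $m,n$, where $\Gamma$ is the universal constant specified in the context, and that $$\frac{m}{\sigma^2n^{3/2}}\longrightarrow\infty.$$ Let $c_{\mathrm{Cast}}>0$ and $c_{\mathrm{noise}}>0$ be sufficiently small constants (the required smallness depending only on $a,b,\alpha,L_0,m_0,M_0$), and set $$L_{\mathrm{Cast}}:=\Big\lfloor\log_2\Big(c_{\mathrm{Cast}}\Big(\frac{n}{\log n}\Big)^{\frac1{2\alpha+1}}\Big)\Big\rfloor,\qquad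 L_{\mathrm{noise}}(X):=\max\Big\{\ell\in\mathbb N:\ \frac{2^{3\ell/2}}{\ell^{3/2}}\le c_{\mathrm{noise}}\frac{\lambda_{\min}(X^\top X)}{\sigma^2 n^{3/2}}\Big\},\qquad L(X):=\min\{L_{\mathrm{Cast}},L_{\mathrm{noise}}(X)\},$$ and, for a truncation level $L$, $\varepsilon_n(L):=(b-a)^\alpha2^{-\alpha L}+(b-a)^{-1}\sqrt{L2^L/n}$. Then, as $m,n\to\infty$, $L(X)\to\infty$ in $\mathbb P_X$-probability, $\varepsilon_n(L(X))\to0$ in $\mathbb P_X$-probability, and there exists a constant $C_0>0$ (not depending on $m,n$) such that $$\mathbb E_X\mathbb E^X_{g_0}\Big[\Pi_{L(X),X}\big(\|g-g_0\|_\infty>C_0\,\varepsilon_n(L(X))\,\big|\,\boldsymbol Y\big)\Big]\longrightarrow0.$$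
   Context: Limits are along any sequence of pairs $(m,n)$ with $m\ge n$ and $m,n\to\infty$. $\mathbb P_X,\mathbb E_X$ refer to the law of the random design; $\mathbb E^X_{g_0}$ is expectation over $(\boldsymbol\beta_0,\boldsymbol Y)$ conditional on the realized design $X$; $\lambda_{\min}$ is the smallest eigenvalue; $\|\cdot\|_\infty$ is the sup-norm on $[a,b]$; $\mathbb N=\{1,2,\dots\}$. Convention: $L_{\mathrm{noise}}(X):=0$ if the set defining it is empty. The universal constant $\Gamma$: $\Gamma>0$ is a universal constant such that, for some universal $\xi>0$, the following holds: for every $\kappa>0$ and every random matrix $X\in\mathbb R^{m\times n}$ with independent rows $x_i\sim\mathcal N(\boldsymbol\mu_n,\Sigma_n)$ such that $\lambda_{\min}(\Sigma_n+\boldsymbol\mu_n\boldsymbol\mu_n^\top)\ge\kappa$, whenever $m\ge\Gamma n$ one has $\mathbb P_X(\operatorname{rank}(X)=n\text{ and }\lambda_{\min}(X^\top X)\ge\kappa m/4)\ge1-2\exp(-\xi m)$. (Such universal constants exist.) Dyadic partition: for $l\ge0$, $[a,b]$ is partitioned into $I^l_k=[a+(b-a)k2^{-l},\,a+(b-a)(k+1)2^{-l})$ for $0\le k\le 2^l-2$ and $I^l_{2^l-1}=[b-(b-a)2^{-l},\,b]$. Truncated P\'olya tree prior $\Pi_L$ of depth $L$: let $V_{l,k}\sim\mathrm{Beta}(1,1)$ be independent for $0\le l\le L-1$, $0\le k<2^l$. Set $G(I^0_0)=1$, and recursively $G(I^{l+1}_{2k})=V_{l,k}G(I^l_k)$,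 $G(I^{l+1}_{2k+1})=(1-V_{l,k})G(I^l_k)$. $\Pi_L$ is the law of the random density $g(x)=\sum_{k=0}^{2^L-1}\frac{2^L}{b-a}G(I^L_k)\mathbf 1\{x\in I^L_k\}$, $x\in[a,b]$. Working model for a fixed matrix $X$: $g\sim\Pi_L$; $\beta_1,\dots,\beta_n\mid g$ i.i.d. with density $g$; $\boldsymbol Y\mid\boldsymbol\beta\sim\mathcal N(X\boldsymbol\beta,\sigma^2I_m)$. $\Pi_{L,X}(\cdot\mid\boldsymbol Y)$ denotes the posterior distribution of $g$ given $\boldsymbol Y$ under this working model (given by Bayes' formula); $\Pi_{L(X),X}(\cdot\mid\boldsymbol Y)$ is this posterior with truncation level $L=L(X)$ and the realized design $X$. *)

(* Defs.v *)
From HB Require Import structures.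
From mathcomp Require Import all_boot all_order all_algebra.
From mathcomp Require Import all_classical all_reals all_analysis.

Set Implicit Arguments.
Unset Strict Implicit.
Unset Printing Implicit Defensive.

Import Order.TTheory GRing.Theory Num.Theory.
Import numFieldNormedType.Exports.

Local Open Scope classical_set_scope.
Local Open Scope ring_scope.

Definition tcons {T : Type} {n : nat} (p : T * n.-tuple T) : n.+1.-tuple T :=
  [tuple of p.1 :: p.2].

Section tcons_measure.
Local Open Scope ereal_scope.
Context {d : measure_display} {T : measurableType d} {R : realType} {n : nat}.
Variables (mu : {sigma_finite_measure set T -> \bar R})
          (nu : {sigma_finite_measure set (n.-tuple T) -> \bar R}).

Definition tcons_measure : set (n.+1.-tuple T) -> \bar R :=
  pushforward (mu \x nu) tcons.

Let measurable_tcons : measurable_fun [set: T * n.-tuple T] (@tcons T n).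
Proof. exact: (measurable_cons measurable_fst measurable_snd). Qed.

Let push : {measure set (n.+1.-tuple T) -> \bar R} :=
  measure_function_pushforward__canonical__measure_function_Measure
    (mu \x nu) measurable_tcons.

Let tcons_measure0 : tcons_measure set0 = 0.
Proof. exact: (measure0 push). Qed.

Let tcons_measure_ge0 A : 0 <= tcons_measure A.
Proof. exact: (measure_ge0 push). Qed.

Let tcons_measure_sigma_additive : semi_sigma_additive tcons_measure.
Proof. exact: (@measure_semi_sigma_additive _ _ _ push). Qed.

HB.instance Definition _ := isMeasure.Build _ _ _ tcons_measure
  tcons_measure0 tcons_measure_ge0 tcons_measure_sigma_additive.

Let tcons_measure_sigma_finite : sigma_finite setT tcons_measure.
Proof.
have [F TF Foo] : sigma_finite setT (mu \x nu) :=
  isSigmaFinite.sigma_finiteT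
    (lebesgue_integral_fubini.measure_function_Measure_isSigmaFinite__to__measure_function_isSigmaFinite
       mu nu).
pose h (t : n.+1.-tuple T) := (thead t, [tuple of behead t]).
have Kh p : h (tcons p) = p.
  by case: p => x s; rewrite /h theadE; congr pair; exact/val_inj.
have mh : measurable_fun setT h.
  apply/measurable_fun_pairP; split => /=.
    exact: (@measurable_tnth _ T _ ord0).
  exact: measurable_behead.
exists (fun k => h @^-1` F k).
  by rewrite -preimage_bigcup -TF preimage_setT.
move=> k; have [mF Fk] := Foo k; split.
  by rewrite -[X in measurable X]setTI; exact: mh.
rewrite /tcons_measure /pushforward -comp_preimage.
by rewrite (_ : h \o _ = id) //; apply/funext => p; exact: Kh.
Qed.

HB.instance Definition _ := Measure_isSigmaFinite.Build _ _ _ tcons_measure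
  tcons_measure_sigma_finite.

End tcons_measure.

(* The n-fold product measure, on tuples with their coordinate sigma-algebra. *)
Fixpoint mpow {d : measure_display} {T : measurableType d} {R : realType}
    (mu : {sigma_finite_measure set T -> \bar R}) (n : nat) :
    {sigma_finite_measure set (n.-tuple T) -> \bar R} :=
  match n with
  | 0 => \d_([tuple] : 0.-tuple T)
  | n'.+1 => tcons_measure mu (mpow mu n')
  end.

Definition lambda_min {R : realType} {n : nat} (A : 'M[R]_n) : R :=
  inf [set x | eigenvalue A x].

(* [normal_prob m s] has standard deviation [s] and is not the point mass at
   [m] when [s = 0]; a degenerate [normal_law m 0] is needed because the
   covariance matrix of a Gaussian vector may be singular. *)
Definition normal_law {R : realType} (m v : R) (B : set R) : \bar R :=
  if v == 0 then \d_m B else normal_prob m (Num.sqrt v) B.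

Definition gaussian_vector {R : realType} {d : measure_display}
    {T : measurableType d} (P : probability T R) {n : nat}
    (Z : T -> 'cV[R]_n) (mu : 'cV[R]_n) (Sigma : 'M[R]_n) : Prop :=
  [/\ Sigma^T = Sigma,
      forall u : 'cV[R]_n, 0 <= (u^T *m Sigma *m u) 0 0,
      forall j, measurable_fun [set: T] (fun w => Z w j 0) &
      forall (u : 'cV[R]_n) (B : set R), measurable B ->
        P [set w | B ((u^T *m Z w) 0 0)] =
        normal_law ((u^T *m mu) 0 0) ((u^T *m Sigma *m u) 0 0) B].

(* Taking some [B i] to be the full set gives the product rule for every
   subfamily of rows. *)
Definition independent_rows {R : realType} {d : measure_display}
    {T : measurableType d} (P : probability T R) {m n : nat}
    (X : T -> 'M[R]_(m, n)) : Prop :=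
  forall B : 'I_m -> set (n.-tuple R), (forall i, measurable (B i)) ->
    P [set w | forall i, B i [tuple X w i j | j < n]] =
    (\prod_(i < m) P [set w | B i [tuple X w i j | j < n]])%E.

Definition gaussian_design {R : realType} {d : measure_display}
    {T : measurableType d} (P : probability T R) {m n : nat}
    (X : T -> 'M[R]_(m, n)) (mu : 'cV[R]_n) (Sigma : 'M[R]_n) : Prop :=
  independent_rows P X /\
  forall i, gaussian_vector P (fun w => (row i (X w))^T) mu Sigma.

Definition second_moment {R : realType} {n : nat}
    (mu : 'cV[R]_n) (Sigma : 'M[R]_n) : 'M[R]_n := Sigma + mu *m mu^T.

Definition universal_Gamma {R : realType} (Gamma : R) : Prop :=
  0 < Gamma /\
  exists2 xi : R, 0 < xi &
    forall (kappa : R), 0 < kappa ->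
    forall (d : measure_display) (T : measurableType d) (P : probability T R)
      (m n : nat) (X : T -> 'M[R]_(m, n)) (mu : 'cV[R]_n) (Sigma : 'M[R]_n),
      gaussian_design P X mu Sigma ->
      kappa <= lambda_min (second_moment mu Sigma) ->
      Gamma * n%:R <= m%:R ->
      ((1 - 2 * expR (- xi * m%:R))%:E <=
       P [set w | \rank (X w) = n /\
                  (kappa * m%:R / 4 <= lambda_min ((X w)^T *m X w))%R])%E.

Definition density_on {R : realType} (a b : R) (g : R -> R) : Prop :=
  [/\ measurable_fun [set: R] g,
      forall x, 0 <= g x,
      forall x, x \notin `[a, b] -> g x = 0 &
      (\int[lebesgue_measure]_x (g x)%:E = 1)%E].

Definition holder_bounded {R : realType} (a b alpha L0 m0 M0 : R)
    (g : R -> R) : Prop :=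
  (forall x, x \in `[a, b] -> m0 <= g x <= M0) /\
  (forall x y, x \in `[a, b] -> y \in `[a, b] ->
     `|g x - g y| <= L0 * `|x - y| `^ alpha).

Definition sup_norm {R : realType} (a b : R) (f : R -> R) : \bar R :=
  ereal_sup [set `|f x|%:E | x in `[a, b]].

Definition dyadic {R : realType} (a b : R) (l k : nat) : set R :=
  if k == (2 ^ l).-1 then `[b - (b - a) / 2 ^+ l, b]%classic
  else `[a + (b - a) * k%:R / 2 ^+ l, a + (b - a) * k.+1%:R / 2 ^+ l[%classic.

Fixpoint polya_mass {R : realType} (V : nat -> nat -> R) (l k : nat) : R :=
  match l with
  | 0 => 1
  | l'.+1 => (if odd k then 1 - V l' k./2 else V l' k./2)
             * polya_mass V l' k./2
  end.

Definition polya_density {R : realType} (a b : R) (L : nat)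
    (V : nat -> nat -> R) (x : R) : R :=
  \sum_(k < 2 ^ L) 2 ^+ L / (b - a) * polya_mass V L k * \1_(dyadic a b L k) x.

(* The splitting variables [V l k], [l < L], [k < 2 ^ l], are stored level by
   level in a tuple of length [2 ^ L - 1]. *)
Definition splits {R : realType} {N : nat} (v : N.-tuple R) (l k : nat) : R :=
  nth 0 v ((2 ^ l).-1 + k).

(* Joint law of the splitting variables; [Pi_L] is its image under
   [polya_density a b L \o splits]. *)
Definition splits_law (R : realType) (L : nat) :
    {sigma_finite_measure set ((2 ^ L).-1.-tuple (measurableTypeR R)) -> \bar R} :=
  mpow (beta_prob 1 1) (2 ^ L).-1.

Definition iid_pdf {R : realType} {n : nat} (g : R -> R) (t : n.-tuple R) : R :=
  \prod_(j < n) g (tnth t j).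

Definition lin_pred {R : realType} {m n : nat} (X : 'M[R]_(m, n))
    (t : n.-tuple R) (i : 'I_m) : R := \sum_(j < n) X i j * tnth t j.

Definition response_pdf {R : realType} {m n : nat} (sigma : R)
    (X : 'M[R]_(m, n)) (t : n.-tuple R) (y : m.-tuple R) : R :=
  \prod_(i < m) normal_pdf (lin_pred X t i) sigma (tnth y i).

Definition lebesgue_pow (R : realType) (n : nat) :
    {sigma_finite_measure set (n.-tuple (measurableTypeR R)) -> \bar R} :=
  mpow lebesgue_measure n.

Definition marginal_likelihood {R : realType} {m n : nat} (sigma : R)
    (X : 'M[R]_(m, n)) (y : m.-tuple R) (g : R -> R) : \bar R :=
  (\int[lebesgue_pow R n]_t (iid_pdf g t * response_pdf sigma X t y)%:E)%E.

(* Bayes' formula for the posterior probability that [g] lies in [A]. *)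
Definition posterior {R : realType} {m n : nat} (a b sigma : R) (L : nat)
    (X : 'M[R]_(m, n)) (y : m.-tuple R) (A : set (R -> R)) : R :=
  let g v := polya_density a b L (splits v) in
  fine (\int[splits_law R L]_(v in [set v | A (g v)])
          marginal_likelihood sigma X y (g v)) /
  fine (\int[splits_law R L]_v marginal_likelihood sigma X y (g v)).

(* Expectation of [F Y] for a fixed design [X], where [beta_0] has i.i.d.
   coordinates of density [g0] and [Y | beta_0] is N(X beta_0, sigma^2 I). *)
Definition data_expectation {R : realType} {m n : nat} (g0 : R -> R) (sigma : R)
    (X : 'M[R]_(m, n)) (F : m.-tuple R -> R) : \bar R :=
  (\int[lebesgue_pow R n]_t ((iid_pdf g0 t)%:E *
     \int[lebesgue_pow R m]_y (response_pdf sigma X t y * F y)%:E))%E.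

Definition log2 {R : realType} (x : R) : R := ln x / ln 2.

(* [Num.truncn] is the floor on nonnegative reals and 0 on negative ones; the
   logarithm is negative for finitely many [n] only. *)
Definition L_Cast {R : realType} (cCast alpha : R) (n : nat) : nat :=
  Num.truncn (log2 (cCast * (n%:R / ln n%:R) `^ (2 * alpha + 1)^-1)).

(* The maximum of the admissible levels, and 0 if there is none. *)
Definition L_noise {R : realType} {m n : nat} (cnoise sigma : R)
    (X : 'M[R]_(m, n)) : nat :=
  let admissible := [set l : nat | (0 < l)%N /\
    2 `^ (3 * l%:R / 2) / l%:R `^ (3 / 2) <=
    cnoise * (lambda_min (X^T *m X) / (sigma ^+ 2 * n%:R `^ (3 / 2)))] in
  xget 0%N [set l | admissible l /\ forall l', admissible l' -> (l' <= l)%N].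

Definition L_trunc {R : realType} {m n : nat} (cCast cnoise alpha sigma : R)
    (X : 'M[R]_(m, n)) : nat :=
  minn (L_Cast cCast alpha n) (L_noise cnoise sigma X).

Definition rate {R : realType} (a b alpha : R) (n L : nat) : R :=
  (b - a) `^ alpha * 2 `^ (- alpha * L%:R) +
  (b - a)^-1 * Num.sqrt (L%:R * 2 ^+ L / n%:R).

(* Main.v *)
Require Import Defs.
From mathcomp Require Import all_boot all_order all_algebra.
From mathcomp Require Import all_classical all_reals all_analysis.
From mathcomp Require Import measurable_realfun ring lra zify.

Set Implicit Arguments.
Unset Strict Implicit.
Unset Printing Implicit Defensive.

Import Order.TTheory GRing.Theory Num.Theory.
Import numFieldNormedType.Exports.

Local Open Scope classical_set_scope.
Local Open Scope ring_scope.

(** Why the theorem holds.  Write [t] for the vector of coefficients, [y] for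
the responses, [delta = 2 ^ (- alpha L)], [u = 2 ^ (- L)] and [r = u delta].
The rate is at least [(b - a) ^ alpha delta], so errors of order [delta] on the
density, that is of order [r] on the masses of the bins, are allowed.  The two
bounds on the level provide the room for them: [L <= L_Cast] gives
[ln n <= n u delta^2], the bias dominates the sampling fluctuation
([bias_dominates]), and [L <= L_noise] gives
[sigma^2 <= 3 r^3 lambda_min (X^T X)] ([noise_dominated]).

For a fixed design, the posterior of the density is seen through the posterior
of the latent coefficients: averaging the splits of the tree out first, it is
the posterior average over [t] of the conditional law of the splits given [t]
([posterior_le]).  Two facts are then needed.

First, a posterior draw [t] is close to the true coefficients [t0].  Under the
prior predictive law, draw and truth are exchangeable given [y], so the
residual [y - X t] of a draw, projected onto the columns of [X], is distributed
like the projected noise, whose squared length has an exponential moment of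
order [2 ^ (n / 2)] ([gram_schmidt], [integral_projected_noise]).  The truth
costs only a factor exponential in [n] with respect to the prior
([prior_pred_ge]), so the prior bound transfers to the truth
([data_expectation_posterior_le]).  Hence [|X (t - t0)|^2] is of order
[sigma^2 n] and, dividing by the smallest eigenvalue, [|t - t0|^2] is of order
[n r^3].  By Chebyshev's inequality at most order [n r] coefficients move by
more than [r], and Chernoff's bound for the bins enlarged or shrunk by [r]
shows that the bin counts of [t] are [n] times the true masses up to order
[n r] ([node_count_perturbation], [chernoff]).

Second, given [t], the splits are independent Beta variables which concentrate
at the empirical frequencies of [t] with Gaussian tails
([bernoulli_lik_le], [prior_joint_split_tail]).  The tolerances are chosen to
decrease geometrically away from the leaves, so that the relative errors along
a branch add up to order [delta] ([polya_mass_rel_error],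
[restricted_pred_le]).  The result is a bound [6 / n] on the expected posterior
probability ([contraction_fixed_design]).

For a random design, the Gram matrix has smallest eigenvalue at least
[kappa m / 4] with probability tending to 1, and then every given level is
eventually admissible ([L_trunc_diverges]); elsewhere the posterior probability
is at most 1.  The Rayleigh characterization of the smallest eigenvalue
([lambda_min_gram]) links it to the squared norms above and makes the events on
the level measurable. *)

(** * Integration *)

(** The posterior probability of an event on densities is a quotient of
integrals over a set that is not known to be measurable, so it has to be
bounded by measurable functions without assuming anything on it.  This is
possible because the integral of a nonnegative function is defined as a
supremum over simple functions below it. *)
Section nonmeasurable_integrands.
Local Open Scope ereal_scope.
Context {d : measure_display} {T : measurableType d} {R : realType}.
Variable mu : {measure set T -> \bar R}.
Import HBNNSimple.

(** A simple function below [f] is multiplied by the indicator of the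
complement of [N]: this leaves its integral unchanged and brings it below
[g]. *)
Lemma ge0_le_integral_off_null (N : set T) (f g : T -> \bar R) :
  measurable N -> mu N = 0 ->
  (forall x, 0 <= f x) -> (forall x, 0 <= g x) ->
  (forall x, ~ N x -> f x <= g x) ->
  \int[mu]_x f x <= \int[mu]_x g x.
Proof.
move=> mN N0 f0 g0 fg.
rewrite ge0_integralTE// [leRHS]ge0_integralTE//.
apply: ge_ereal_sup => _ /= [h hf <-].
have mNC : measurable (~` N) by exact: measurableC.
have -> : sintegral mu h = \int[mu]_x (h x)%:E.
  by rewrite integral_nnsfun// patch_setT.
have ih : (\int[mu]_(x in N) (h x)%:E)%E = 0.
  apply/eqP; rewrite eq_le integral_ge0 ?andbT; last first.
    by move=> x _; rewrite lee_fin.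
  rewrite (@null_set_integral _ _ _ mu N (EFin \o h)) ?lexx//.
  apply/measurable_EFinP; exact: measurable_funTS.
rewrite -(setvU N) ge0_integral_setU//=; last 3 first.
- rewrite setvU; apply/measurable_EFinP; exact: measurable_funTS.
- by move=> x _; rewrite lee_fin.
- by rewrite disj_set2E setICl.
rewrite ih adde0 integral_nnsfun//.
apply: ereal_sup_ubound => /=.
exists (proj_nnsfun h mNC).
  move=> x /=; rewrite mindicE; case: (boolP (x \in ~` N)) => xN.
    rewrite mulr1; apply: le_trans (hf x) (fg x _).
    by move: xN; rewrite inE.
  by rewrite mulr0.
by congr (sintegral mu _); apply/funext => x; rewrite mrestrict.
Qed.

(** The suffix stands for nonmeasurable. *)
Lemma ge0_le_integral_nm (f g : T -> \bar R) :
  (forall x, 0 <= f x) -> (forall x, f x <= g x) ->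
  \int[mu]_x f x <= \int[mu]_x g x.
Proof.
move=> f0 fg; apply: (@ge0_le_integral_off_null set0) => //.
by move=> x; exact: le_trans (f0 x) (fg x).
Qed.

Lemma eq_integral_off_null (N : set T) (f g : T -> \bar R) :
  measurable N -> mu N = 0 -> (forall x, ~ N x -> f x = g x) ->
  \int[mu]_x f x = \int[mu]_x g x.
Proof.
move=> mN N0 fg; rewrite integralE [RHS]integralE.
by congr (_ - _); apply/eqP; rewrite eq_le; apply/andP; split;
  apply: (@ge0_le_integral_off_null N) => //= x Nx;
  by rewrite ?funeposE ?funenegE fg.
Qed.

End nonmeasurable_integrands.

Section product_measures.
Local Open Scope ereal_scope.
Context {d : measure_display} {T : measurableType d} {R : realType}.
Variable mu : {sigma_finite_measure set T -> \bar R}.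

Lemma measurable_tcons n :
  measurable_fun [set: T * n.-tuple T] (@tcons T n).
Proof. exact: (measurable_cons measurable_fst measurable_snd). Qed.

Lemma ge0_integral_mpowS n (f : n.+1.-tuple T -> \bar R) :
  measurable_fun setT f -> (forall t, 0 <= f t) ->
  \int[mpow mu n.+1]_t f t = \int[mu]_x \int[mpow mu n]_t f (tcons (x, t)).
Proof.
move=> mf f0.
have := @ge0_integral_pushforward _ _ _ _ R _ (@measurable_tcons n)
  (mu \x mpow mu n) setT f measurableT mf (fun y _ => f0 y).
rewrite preimage_setT => /= ->.
rewrite (@fubini_tonelli1 _ _ _ _ _ mu (mpow mu n) (f \o @tcons T n))//.
- by apply: measurableT_comp => //; exact: measurable_tcons.
- by move=> x; exact: f0.
Qed.

Lemma integral_mpow_prod n (f : 'I_n -> T -> R) :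
  (forall i, measurable_fun setT (f i)) -> (forall i x, (0 <= f i x)%R) ->
  \int[mpow mu n]_t (\prod_(i < n) f i (tnth t i))%:E =
  \prod_(i < n) \int[mu]_x (f i x)%:E.
Proof.
elim: n f => [|n IH] f mf f0.
  rewrite big_ord0 (eq_integral (cst 1)); last by move=> t _; rewrite big_ord0.
  by rewrite integral_dirac// diracT mul1e.
rewrite ge0_integral_mpowS; last 2 first.
- apply/measurable_EFinP; apply: measurable_prod => i _.
  by apply: measurableT_comp => //; exact: measurable_tnth.
- by move=> t; rewrite lee_fin prodr_ge0.
rewrite big_ord_recl -(IH (fun i => f (lift ord0 i)))//.
rewrite -ge0_integralZr//; last 3 first.
- by apply/measurable_EFinP.
- by move=> x _; rewrite lee_fin.
- by apply: integral_ge0 => t _; rewrite lee_fin prodr_ge0.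
apply: eq_integral => x _.
rewrite -ge0_integralZl//; last 3 first.
- apply/measurable_EFinP; apply: measurable_prod => i _.
  by apply: measurableT_comp => //; exact: measurable_tnth.
- by move=> t _; rewrite lee_fin prodr_ge0.
- by rewrite lee_fin.
apply: eq_integral => t _; rewrite -EFinM big_ord_recl; congr (_ * _)%:E.
by apply: eq_bigr => i _; rewrite /tcons tnthS.
Qed.

End product_measures.

(** * Gaussian noise *)

Section gaussian_integrals.
Context {R : realType}.
Implicit Types (m s c x : R).

Lemma normal_pdf_shift m s x : s != 0 ->
  normal_pdf m s x = normal_pdf 0 s (x - m).
Proof. by move=> s0; rewrite !normal_pdfE//= normal_fun_center. Qed.

Lemma normal_pdf_exp_tilt m s c x : s != 0 ->
  normal_pdf m s x * expR (c * (x - m)) =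
  expR (s ^+ 2 * c ^+ 2 / 2) * normal_pdf (m + s ^+ 2 * c) s x.
Proof.
move=> s0; rewrite !normal_pdfE//= /normal_fun.
rewrite -[LHS]mulrA [RHS]mulrCA -[in LHS]expRD -[in RHS]expRD; congr (_ * expR _).
by field.
Qed.

Lemma integral_normal_exp_tilt m s c : s != 0 ->
  (\int[lebesgue_measure]_x (normal_pdf m s x * expR (c * (x - m)))%:E =
   (expR (s ^+ 2 * c ^+ 2 / 2))%:E)%E.
Proof.
move=> s0.
under eq_integral do rewrite normal_pdf_exp_tilt// EFinM.
rewrite ge0_integralZl//.
- by rewrite integral_normal_pdf// mule1.
- by apply/measurable_EFinP; exact: measurable_normal_pdf.
- by move=> x _; rewrite lee_fin normal_pdf_ge0.
Qed.

(** The integrand is [sqrt 2] times the normal density of variance 2. *)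
Lemma integral_normal_exp_sq :
  (\int[lebesgue_measure]_x (normal_pdf 0 1 x * expR (x ^+ 2 / 4))%:E =
   (Num.sqrt 2 : R)%:E)%E.
Proof.
have s20 : Num.sqrt 2 != 0 :> R by rewrite sqrtr_eq0 -ltNge.
have E x : normal_pdf 0 1 x * expR (x ^+ 2 / 4) =
    Num.sqrt 2 * normal_pdf 0 (Num.sqrt 2) x.
  rewrite !normal_pdfE ?oner_eq0//= /normal_fun /normal_peak.
  rewrite -[LHS]mulrA -[in LHS]expRD [RHS]mulrA sqr_sqrtr// subr0 expr1n; congr (_ * expR _).
    by rewrite mul1r -mulrnAr sqrtrM// invfM mulrA divff// mul1r.
  by field.
under eq_integral do rewrite E EFinM.
rewrite ge0_integralZl//.
- by rewrite integral_normal_pdf// mule1.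
- by apply/measurable_EFinP; exact: measurable_normal_pdf.
- by move=> x _; rewrite lee_fin normal_pdf_ge0.
Qed.

End gaussian_integrals.

Section gaussian_noise.
Context {R : realType} {m : nat}.
Variables (mu : 'I_m -> R) (sigma : R).
Hypothesis sigma0 : 0 < sigma.
Let sigman0 : sigma != 0. Proof. by rewrite gt_eqF. Qed.

Let phi (y : m.-tuple (measurableTypeR R)) :=
  \prod_(i < m) normal_pdf (mu i) sigma (tnth y i).

Lemma measurable_noise_pdf : measurable_fun setT phi.
Proof.
apply: measurable_prod => i _.
apply: (@measurableT_comp _ _ _ _ _ _ (normal_pdf (mu i) sigma)).
  exact: measurable_normal_pdf.
exact: measurable_tnth.
Qed.

Lemma noise_pdf_ge0 y : 0 <= phi y.
Proof. by rewrite prodr_ge0// => i _; exact: normal_pdf_ge0. Qed.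

Lemma integral_noise_exp_tilt (c : 'I_m -> R) :
  (\int[lebesgue_pow R m]_y
     (phi y * expR (\sum_(i < m) c i * (tnth y i - mu i)))%:E =
   (expR (sigma ^+ 2 / 2 * \sum_(i < m) c i ^+ 2))%:E)%E.
Proof.
transitivity (\prod_(i < m) \int[lebesgue_measure]_x
    (normal_pdf (mu i) sigma x * expR (c i * (x - mu i)))%:E)%E.
  rewrite -integral_mpow_prod; last 2 first.
  - move=> i; apply: measurable_funM; first exact: measurable_normal_pdf.
    apply: measurableT_comp => //; apply: measurable_funM => //.
    exact: measurable_funB.
  - by move=> i x; rewrite mulr_ge0 ?normal_pdf_ge0 ?expR_ge0.
  apply: eq_integral => y _; rewrite /phi expR_sum -big_split.
  by [].
rewrite mulr_sumr expR_sum -prodEFin; apply: eq_bigr => i _.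
by rewrite integral_normal_exp_tilt// mulrAC.
Qed.

Lemma integral_noise_pdf : (\int[lebesgue_pow R m]_y (phi y)%:E = 1)%E.
Proof.
have := integral_noise_exp_tilt (fun=> 0).
rewrite [X in _ = (expR (_ * X))%:E]big1 ?mulr0 ?expR0; last first.
  by move=> i _; rewrite expr0n.
move=> <-; apply: eq_integral => y _.
by rewrite big1 ?expR0 ?mulr1// => i _; rewrite mul0r.
Qed.

(** An exponential moment of the squared length of a projection of the noise,
seen through a Gaussian mixture: [exp (w^2 / 4)] is the average of
[exp (z w / sqrt 2)] over a standard normal [z], so that averaging over the
noise before averaging over [z] only needs one-dimensional integrals. *)
Lemma integral_projected_noise (p : nat) (U : 'M[R]_(m, p))
    (hU : forall z : 'I_p -> R,
      \sum_(i < m) (\sum_(j < p) U i j * z j) ^+ 2 <= \sum_(j < p) z j ^+ 2) :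
  (\int[lebesgue_pow R m]_y
     (phi y * expR (\sum_(j < p) (\sum_(i < m) U i j * (tnth y i - mu i)) ^+ 2
                    / (4 * sigma ^+ 2)))%:E <= (Num.sqrt 2 ^+ p : R)%:E)%E.
Proof.
pose r : R := Num.sqrt 2.
have r2 : r ^+ 2 = 2 by rewrite sqr_sqrtr.
have r0 : r != 0 by rewrite sqrtr_eq0 -ltNge.
pose w (y : m.-tuple (measurableTypeR R)) j :=
  \sum_(i < m) U i j * (tnth y i - mu i).
have mw j : measurable_fun setT (w ^~ j).
  apply: measurable_sum => i; apply: measurable_funM => //.
  apply: measurable_funB => //; exact: measurable_tnth.
pose f (y : m.-tuple (measurableTypeR R)) (j : 'I_p) (z : R) :=
  normal_pdf 0 1 z * expR (w y j / (r * sigma) * z).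
have f0 y j z : 0 <= f y j z by rewrite mulr_ge0 ?normal_pdf_ge0 ?expR_ge0.
pose F (yz : m.-tuple (measurableTypeR R) * p.-tuple (measurableTypeR R)) :=
  phi yz.1 * \prod_(j < p) f yz.1 j (tnth yz.2 j).
have F0 yz : 0 <= F yz by rewrite mulr_ge0 ?noise_pdf_ge0 ?prodr_ge0.
have mF : measurable_fun setT F.
  apply: measurable_funM.
    exact: (measurableT_comp measurable_noise_pdf measurable_fst).
  apply: measurable_prod => j _.
  have mz : measurable_fun setT (fun yz : m.-tuple (measurableTypeR R) *
      p.-tuple (measurableTypeR R) => tnth yz.2 j).
    exact: (measurableT_comp (measurable_tnth j) measurable_snd).
  apply: measurable_funM.
    apply: (@measurableT_comp _ _ _ _ _ _ (normal_pdf 0 1)) => //.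
    exact: measurable_normal_pdf.
  apply: measurableT_comp => //; apply: measurable_funM => //.
  apply: measurable_funM => //.
  exact: (measurableT_comp (mw j) measurable_fst).
(* The mixture representation, coordinate by coordinate. *)
have step1 y : (phi y * expR (\sum_(j < p) w y j ^+ 2 / (4 * sigma ^+ 2)))%:E =
    (\int[lebesgue_pow R p]_z (F (y, z))%:E)%E.
  transitivity (\int[lebesgue_pow R p]_z ((phi y)%:E *
      (\prod_(j < p) f y j (tnth z j))%:E))%E; last exact: eq_integral.
  rewrite ge0_integralZl//; last 3 first.
  - apply/measurable_EFinP; apply: measurable_prod => j _.
    apply: (@measurableT_comp _ _ _ _ _ _ (f y j)); last exact: measurable_tnth.
    apply: measurable_funM; first exact: measurable_normal_pdf.
    by apply: measurableT_comp => //; apply: measurable_funM.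
  - by move=> z _; rewrite lee_fin prodr_ge0.
  - by rewrite lee_fin noise_pdf_ge0.
  rewrite integral_mpow_prod//; last first.
    move=> j; apply: measurable_funM; first exact: measurable_normal_pdf.
    by apply: measurableT_comp => //; apply: measurable_funM.
  rewrite EFinM; congr (_ * _)%E.
  rewrite expR_sum -prodEFin; apply: eq_bigr => j _.
  have := integral_normal_exp_tilt 0 (w y j / (r * sigma)) (oner_neq0 R).
  under eq_integral do rewrite subr0.
  move=> ->.
  congr (expR _)%:E; rewrite exprMn exprVn exprMn r2.
  by field.
under eq_integral do rewrite step1.
rewrite (@fubini_tonelli _ _ _ _ _ (lebesgue_pow R m) (lebesgue_pow R p)
  (EFin \o F))//=; last exact/measurable_EFinP.
pose h (z : R) := normal_pdf 0 1 z * expR (z ^+ 2 / 4).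
apply: (@le_trans _ _ (\int[lebesgue_pow R p]_z
    (\prod_(j < p) h (tnth z j))%:E)%E); last first.
  have -> : (\int[lebesgue_pow R p]_z (\prod_(j < p) h (tnth z j))%:E =
      \prod_(j < p) \int[lebesgue_measure]_x (h x)%:E)%E.
    apply: (@integral_mpow_prod _ (measurableTypeR R) R lebesgue_measure p
      (fun=> h)) => [_|_ x]; last first.
      by rewrite mulr_ge0 ?normal_pdf_ge0 ?expR_ge0.
    apply: measurable_funM; first exact: measurable_normal_pdf.
    by apply: measurableT_comp => //; apply: measurable_funM.
  under eq_bigr do rewrite integral_normal_exp_sq.
  by rewrite prodEFin lee_fin prodr_const card_ord.
apply: ge0_le_integral_nm => z.
  by apply: integral_ge0 => y _; rewrite lee_fin.
(* For fixed [z] the exponent is linear in the noise, with coefficients [c]. *)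
pose c (i : 'I_m) := (r * sigma)^-1 * \sum_(j < p) U i j * tnth z j.
have EF y : F (y, z) = (\prod_(j < p) normal_pdf 0 1 (tnth z j)) *
    (phi y * expR (\sum_(i < m) c i * (tnth y i - mu i))).
  rewrite /F /= /f big_split/= mulrCA; congr (_ * (_ * _)).
  rewrite -expR_sum; congr expR.
  transitivity (\sum_(j < p) \sum_(i < m)
      U i j * (tnth y i - mu i) / (r * sigma) * tnth z j).
    by apply: eq_bigr => j _; rewrite /w !mulr_suml.
  rewrite exchange_big/=; apply: eq_bigr => i _.
  rewrite /c mulr_sumr mulr_suml; apply: eq_bigr => j _.
  by rewrite /=; field; rewrite r0 sigman0.
under eq_integral do rewrite EF EFinM.
rewrite ge0_integralZl//; last 3 first.
- apply/measurable_EFinP; apply: measurable_funM.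
    exact: measurable_noise_pdf.
  apply: measurableT_comp => //; apply: measurable_sum => i.
  apply: measurable_funM => //.
  apply: measurable_funB => //; exact: measurable_tnth.
- by move=> y _; rewrite lee_fin mulr_ge0 ?noise_pdf_ge0 ?expR_ge0.
- by rewrite lee_fin prodr_ge0 => // j _; exact: normal_pdf_ge0.
rewrite integral_noise_exp_tilt -EFinM lee_fin /h big_split/=.
rewrite ler_wpM2l ?prodr_ge0//; first by move=> j _; exact: normal_pdf_ge0.
rewrite -expR_sum ler_expR -mulr_suml.
apply: le_trans (_ : 4^-1 * \sum_(i < m)
    (\sum_(j < p) U i j * tnth z j) ^+ 2 <= _); last first.
  by rewrite mulrC ler_wpM2r// hU.
rewrite /c; under eq_bigr do rewrite exprMn.
rewrite -mulr_sumr mulrA ler_wpM2r//.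
  by apply: sumr_ge0 => i _; exact: sqr_ge0.
rewrite exprVn exprMn r2 le_eqVlt; apply/orP; left; apply/eqP.
by field.
Qed.

End gaussian_noise.

(** * Orthogonal projection onto the columns of the design *)

Section euclidean_norm.
Context {R : realType}.

Definition sqnorm {n : nat} (v : 'cV[R]_n) : R := (v^T *m v) 0 0.

Lemma sqnormE n (v : 'cV[R]_n) : sqnorm v = \sum_(i < n) v i 0 ^+ 2.
Proof. by rewrite /sqnorm mxE; apply: eq_bigr => i _; rewrite mxE expr2. Qed.

Lemma sqnorm_ge0 n (v : 'cV[R]_n) : 0 <= sqnorm v.
Proof. by rewrite sqnormE; apply: sumr_ge0 => i _; exact: sqr_ge0. Qed.

Lemma sqnorm_eq0 n (v : 'cV[R]_n) : sqnorm v = 0 -> v = 0.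
Proof.
rewrite sqnormE => /eqP; rewrite psumr_eq0 => [/allP h|i _]; last exact: sqr_ge0.
apply/colP => i; rewrite mxE; apply/eqP; rewrite -(@sqrf_eq0 R).
exact: (h i (mem_index_enum i)).
Qed.

Lemma sqnorm_gt0 n (v : 'cV[R]_n) : v != 0 -> 0 < sqnorm v.
Proof.
by move=> v0; rewrite lt_neqAle sqnorm_ge0 andbT eq_sym; apply: contra_neq v0;
  exact: sqnorm_eq0.
Qed.

(** [U *m U^T] is the orthogonal projection onto the
column space of [X].  The columns of [U] are orthonormal or zero, the latter
when [X] is not of full rank, so [U] is a contraction. *)
Lemma gram_schmidt m n (X : 'M[R]_(m, n)) :
  exists U : 'M[R]_(m, n),
    (forall z : 'cV_n, sqnorm (U *m z) <= sqnorm z) /\ U *m U^T *m X = X.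
Proof.
suff [U [cU PP PX]] : exists U : 'M[R]_(m, n),
    [/\ forall z : 'cV_n, sqnorm (U *m z) <= sqnorm z,
        (U *m U^T) *m (U *m U^T) = U *m U^T & U *m U^T *m X = X].
  by exists U.
elim: n X => [|n IH] X.
  exists 0; split; last 2 first.
  - by rewrite !mul0mx.
  - by apply/matrixP => i [].
  - by move=> z; rewrite mul0mx /sqnorm trmx0 mul0mx mxE sqnorm_ge0.
rewrite -[n.+1]/(1 + n)%N in X *.
rewrite -(hsubmxK X); set x := lsubmx X; set X' := rsubmx X.
have [U [cU PP PX]] := IH X'.
have [P PE] : exists P, P = U *m U^T by exists (U *m U^T).
rewrite -PE in PP PX *; have PT : P^T = P by rewrite PE trmx_mul trmxK.
(* The new column is the residual [r] of [x], normalized unless it is zero. *)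
pose r := x - P *m x.
have Pr : P *m r = 0 by rewrite mulmxBr mulmxA PP subrr.
have Ur : U^T *m r = 0.
  apply: sqnorm_eq0; rewrite /sqnorm trmx_mul trmxK -mulmxA (mulmxA U) -PE Pr.
  by rewrite mulmx0 mxE.
have rP : r^T *m P = 0 by rewrite -{1}PT -trmx_mul Pr trmx0.
have rU : r^T *m U = 0 by rewrite -[U]trmxK -trmx_mul Ur trmx0.
pose q := (Num.sqrt (sqnorm r))^-1 *: r.
have qU : q^T *m U = 0 by rewrite /q linearZ /= -scalemxAl rU scaler0.
have qP : q^T *m P = 0 by rewrite PE mulmxA qU mul0mx.
have Pq : P *m q = 0 by rewrite /q -scalemxAr Pr scaler0.
have Uq : U^T *m q = 0 by rewrite /q -scalemxAr Ur scaler0.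
have qq : q^T *m q = (r != 0)%:R%:M.
  rewrite [LHS]mx11_scalar; congr (_%:M).
  rewrite /q [(_ *: r)^T]linearZ /= -scalemxAl -scalemxAr scalerA mxE -/(sqnorm r).
  have [->|r0] := eqVneq r 0; first by rewrite /sqnorm mulmx0 !mxE mulr0.
  by rewrite -invfM -expr2 sqr_sqrtr ?sqnorm_ge0// mulVf ?gt_eqF ?sqnorm_gt0.
have qqq : q *m (q^T *m q) = q.
  rewrite qq mul_mx_scalar /q; have [->|r0] := eqVneq r 0; rewrite ?scaler0//.
  by rewrite scale1r.
have qqx : q *m (q^T *m x) = r.
  have -> : x = r + P *m x by rewrite subrK.
  rewrite mulmxDr (mulmxA q^T) qP mul0mx addr0.
  have [r0|r0] := eqVneq r 0; first by rewrite r0 !mulmx0.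
  have -> : r = Num.sqrt (sqnorm r) *: q.
    by rewrite /q scalerA divff ?scale1r// gt_eqF// sqrtr_gt0 sqnorm_gt0.
  by rewrite -2!scalemxAr qqq.
exists (row_mx q U); rewrite tr_row_mx mul_row_col -PE; split.
- move=> z; rewrite -(vsubmxK z) mul_row_col /sqnorm tr_col_mx mul_row_col.
  set z1 := usubmx z; set z2 := dsubmx z.
  have -> : (q *m z1 + U *m z2)^T *m (q *m z1 + U *m z2) =
      z1^T *m (q^T *m q) *m z1 + (U *m z2)^T *m (U *m z2).
    rewrite [(_ + _)^T]linearD /= mulmxDl !mulmxDr !trmx_mul !mulmxA.
    rewrite -(mulmxA _ q^T U) qU -(mulmxA _ U^T q) Uq !mulmx0 !mul0mx.
    by rewrite addr0 add0r.
  rewrite mxE [leRHS]mxE lerD//; last exact: cU.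
  rewrite qq mul_mx_scalar -scalemxAl mxE.
  by case: (r != 0); rewrite ?mul1r// mul0r sqnorm_ge0.
- rewrite mulmxDl !mulmxDr PP -!mulmxA qP mulmx0 addr0 (mulmxA P) Pq mul0mx.
  by rewrite add0r (mulmxA q^T) mulmxA qqq.
- rewrite mul_mx_row mulmxDl -mulmxA qqx subrK mulmxDl PX.
  by rewrite -[X' in q *m _ *m X']PX mulmxA -(mulmxA q) qP mulmx0 mul0mx add0r.
Qed.

End euclidean_norm.

(** * The smallest eigenvalue of a Gram matrix *)

Section smallest_eigenvalue.
Context {R : realType}.

Lemma bilinear_le n (B : 'M[R]_n) : exists2 C : R, 0 < C &
  forall y : 'cV_n, (y^T *m B *m y) 0 0 <= C * sqnorm y.
Proof.
exists (1 + \sum_i \sum_j `|B i j|).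
  by rewrite ltr_pwDl// sumr_ge0// => i _; rewrite sumr_ge0.
move=> y; rewrite mulrDl mul1r mulr_suml.
rewrite -mulmxA mxE -[leLHS]add0r lerD ?sqnorm_ge0//.
apply: ler_sum => i _; rewrite !mxE mulr_sumr mulr_suml; apply: ler_sum => j _.
have yE k : y k 0 ^+ 2 <= sqnorm y.
  rewrite sqnormE (bigD1 k)//= lerDl; apply: sumr_ge0 => l _; exact: sqr_ge0.
apply: le_trans (ler_norm _) _; rewrite !normrM mulrCA.
rewrite ler_wpM2l//.
have := lerD (yE i) (yE j); have := sqr_ge0 (`|y i 0| - `|y j 0|).
by rewrite -(real_normK (num_real (y i 0))) -(real_normK (num_real (y j 0))); nra.
Qed.

Lemma quad_scalar_mx n (c : R) (h : 'cV[R]_n) :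
  (h^T *m c%:M *m h) 0 0 = c * sqnorm h.
Proof. by rewrite mul_mx_scalar -scalemxAl mxE. Qed.

Lemma quad_gram m n (X : 'M[R]_(m, n)) (h : 'cV_n) :
  (h^T *m (X^T *m X) *m h) 0 0 = sqnorm (X *m h).
Proof. by rewrite /sqnorm trmx_mul !mulmxA. Qed.

(** Semidefiniteness at [h - t B h], for a small [t], bounds [|B h|^2] by a
multiple of the form at [h], and [B^-1] is bounded. *)
Lemma psd_unit_coercive n (B : 'M[R]_n) : B^T = B -> B \in unitmx ->
  (forall h : 'cV_n, 0 <= (h^T *m B *m h) 0 0) ->
  exists2 c : R, 0 < c & forall h : 'cV_n, c * sqnorm h <= (h^T *m B *m h) 0 0.
Proof.
move=> BT uB psd.
have [C C0 hC] := bilinear_le B.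
have [D D0 hD] := bilinear_le ((invmx B)^T *m invmx B).
exists (C^-1 * D^-1); first by rewrite mulr_gt0 ?invr_gt0.
move=> h; set y := B *m h.
have hy : sqnorm h <= D * sqnorm y.
  by rewrite -[h in leLHS](mulKmx uB) -/y -quad_gram hD.
have key : C^-1 * sqnorm y <= (h^T *m B *m h) 0 0.
  have := psd (h - C^-1 *: y).
  have -> : ((h - C^-1 *: y)^T *m B *m (h - C^-1 *: y)) 0 0 =
      (h^T *m B *m h) 0 0 - 2 * C^-1 * sqnorm y +
      C^-1 ^+ 2 * (y^T *m B *m y) 0 0.
    have e1 : (h^T *m B *m y) 0 0 = sqnorm y.
      by rewrite -{1}BT -trmx_mul.
    have e2 : (y^T *m B *m h) 0 0 = sqnorm y by rewrite -mulmxA.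
    rewrite [(_ - _)^T]linearB /= [(_ *: _)^T]linearZ /= mulmxBl mulmxBr !mulmxBl.
    rewrite -!scalemxAl -!scalemxAr.
    by move: e1 e2; rewrite !mxE => -> ->; ring.
  move=> hp; have := hC y; have : 0 < C^-1 by rewrite invr_gt0.
  move: hp; have : C * C^-1 = 1 by rewrite divff// gt_eqF.
  move: (C^-1) => E EC h1 E0 h2.
  have : E ^+ 2 * (y^T *m B *m y) 0 0 <= E * sqnorm y.
    apply: le_trans (_ : E ^+ 2 * (C * sqnorm y) <= _).
      by rewrite ler_wpM2l// sqr_ge0.
    by rewrite expr2 -!mulrA (mulrA E C) (mulrC E C) EC mul1r.
  by move: h1; lra.
apply: le_trans key; rewrite -mulrA ler_wpM2l ?invr_ge0 ?(ltW C0)//.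
by rewrite mulrC ler_pdivrMr// mulrC.
Qed.

(** The Rayleigh characterization of the smallest eigenvalue of a Gram matrix:
with [c] the best constant of the quadratic form, [X^T X - c] is semidefinite
but not coercive, so it is singular. *)
Lemma lambda_min_gram m n (X : 'M[R]_(m, n.+1)) (c : R) :
  (c <= lambda_min (X^T *m X)) <->
  (forall h : 'cV_n.+1, c * sqnorm h <= sqnorm (X *m h)).
Proof.
pose S := [set c : R | forall h : 'cV_n.+1, c * sqnorm h <= sqnorm (X *m h)].
pose e : 'cV[R]_n.+1 := delta_mx 0 0.
have e1 : 0 < sqnorm e.
  apply: sqnorm_gt0; apply/eqP => /colP /(_ 0).
  by rewrite !mxE !eqxx => /eqP; rewrite oner_eq0.
have S0 : S 0 by move=> h; rewrite mul0r sqnorm_ge0.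
have ubS : ubound S (sqnorm (X *m e) / sqnorm e).
  by move=> a /(_ e); rewrite ler_pdivlMr.
have supS : has_sup S by split; [exists 0|exists (sqnorm (X *m e) / sqnorm e)].
set s := sup S.
have Ss : S s.
  move=> h; have [->|h0] := eqVneq h 0.
    by rewrite mulmx0 /sqnorm !mulmx0 mxE mulr0.
  rewrite -ler_pdivlMr ?sqnorm_gt0//; apply: sup_le_ub; first by exists 0.
  by move=> a /(_ h); rewrite ler_pdivlMr ?sqnorm_gt0.
have lbS a : eigenvalue (X^T *m X) a -> s <= a.
  move=> /eigenvalueP [v vA v0].
  have v0' : v^T != 0 by apply: contra_neq v0 => /(congr1 trmx); rewrite trmxK trmx0.
  have := Ss v^T; rewrite -quad_gram trmxK vA -scalemxAl mxE.
  rewrite -{2}[v]trmxK -/(sqnorm v^T).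
  by rewrite ler_pM2r// sqnorm_gt0.
have eigs : eigenvalue (X^T *m X) s.
  pose B := X^T *m X - s%:M.
  have BE h : (h^T *m B *m h) 0 0 = sqnorm (X *m h) - s * sqnorm h.
    by rewrite /B mulmxBr mulmxBl -quad_gram -quad_scalar_mx mxE [X in _ + X = _]mxE.
  apply: contraT => nev; have uB : B \in unitmx.
    rewrite -row_free_unit -kermx_eq0; move: nev.
    by rewrite /eigenvalue /eigenspace /= negbK.
  have BT : B^T = B.
    by rewrite /B [(_ - _)^T]linearB /= trmx_mul trmxK tr_scalar_mx.
  have [|d d0 hd] := psd_unit_coercive BT uB.
    by move=> h; rewrite BE subr_ge0.
  have : S (s + d).
    by move=> h; have := hd h; rewrite BE mulrDl lerBrDl.
  by move=> /(sup_upper_bound supS); rewrite -/s gerDl leNgt d0.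
have -> : lambda_min (X^T *m X) = s.
  apply/eqP; rewrite eq_le; apply/andP; split.
    by apply: ge_inf => //; exists s => a /=; exact: lbS.
  by apply: lb_le_inf; [exists s|move=> a /=; exact: lbS].
split => [cs h|]; last exact: sup_upper_bound.
by apply: le_trans (Ss h); rewrite ler_wpM2r// sqnorm_ge0.
Qed.

(** Both sides of the inequality are continuous in the vector, so that rational
vectors suffice; this makes the event a countable intersection. *)
Lemma lambda_min_gram_rat m n (X : 'M[R]_(m, n.+1)) (c : R) :
  (c <= lambda_min (X^T *m X)) <->
  (forall q : 'cV[rat]_n.+1,
    c * sqnorm (map_mx (@ratr R) q) <= sqnorm (X *m map_mx ratr q)).
Proof.
rewrite lambda_min_gram; split => [h q|hq h]; first exact: h.
rewrite leNgt; apply/negP => hlt.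
pose f (h : 'cV[R]_n.+1) : R := c * sqnorm h - sqnorm (X *m h).
have cadd : continuous (fun x : R * R => x.1 + x.2) by exact: add_continuous.
have cf : continuous f.
  have csq k (g : 'cV[R]_n.+1 -> 'cV[R]_k) : (forall i, continuous (fun h => g h i 0)) ->
      continuous (fun h => sqnorm (g h)).
    move=> cg; rewrite (_ : (fun _ => _) = (fun h => \sum_i g h i 0 * g h i 0)).
      apply: continuous_big => // i _ x; exact: (cvgM (cg i x) (cg i x)).
    by apply/funext => x; rewrite sqnormE; apply: eq_bigr => i _; rewrite expr2.
  have csqn := csq _ id (fun i => @coord_continuous R n.+1 1 i 0).
  have cX : continuous (fun h : 'cV[R]_n.+1 => sqnorm (X *m h)).
    apply: csq => i.
    rewrite (_ : (fun _ => _) = (fun h : 'cV[R]_n.+1 => \sum_j X i j * h j 0)).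
      apply: continuous_big => // j _ x.
      exact: (cvgM (cvg_cst (X i j)) (@coord_continuous R n.+1 1 j 0 x)).
    by apply/funext => x; rewrite mxE.
  by move=> x; exact: (cvgB (cvgM (cvg_cst c) (csqn x)) (cX x)).
have : nbhs h [set x | 0 < f x].
  apply: (cf h [set y | 0 < y]); apply: open_nbhs_nbhs; split.
    exact: open_gt.
  by rewrite /= subr_gt0.
move=> /nbhs_ballP [e /= e0 be].
have qex i : {q : rat | `|h i 0 - ratr q| < e}.
  have le : h i 0 - e < h i 0 + e by lra.
  apply: cid; have [q] := rat_in_itvoo le.
  by rewrite in_itv /= => /andP[q1 q2]; exists q; rewrite ltr_distlC; lra.
pose q : 'cV[rat]_n.+1 := \col_i sval (qex i).
have /be /= : ball h e (map_mx ratr q).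
  split => // i j; rewrite !mxE ord1; exact: (svalP (qex i)).
by rewrite /f subr_gt0 ltNge hq.
Qed.

Lemma measurable_lambda_min_ge {d : measure_display} {T : measurableType d}
    m n (X : T -> 'M[R]_(m, n.+1)) (c : R) :
  (forall i j, measurable_fun setT (fun w => X w i j)) ->
  measurable [set w | c <= lambda_min ((X w)^T *m X w)].
Proof.
move=> mX.
rewrite (_ : [set _ | _] = \bigcap_(q in [set: 'cV[rat]_n.+1])
  [set w | c * sqnorm (map_mx (@ratr R) q) <= sqnorm (X w *m map_mx ratr q)]).
  rewrite -[X in measurable X]setCK setC_bigcap; apply: measurableC.
  rewrite bigcup_mkcond; apply: countable_bigcupT_measurable => // q.
  rewrite mem_set//; apply: measurableC.
  rewrite -[X in measurable X]setTI -preimage_true.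
  apply: measurable_fun_ler => //.
  under eq_fun do rewrite sqnormE.
  apply: measurable_sum => i; apply: measurable_funX.
  under eq_fun do rewrite mxE.
  by apply: measurable_sum => j; apply: measurable_funM.
apply/seteqP; split => w /=.
  by move=> /lambda_min_gram_rat h q _; exact: h.
by move=> h; apply/lambda_min_gram_rat => q; exact: h.
Qed.

End smallest_eigenvalue.

(** * The posterior of one split *)

Section beta_posterior.
Context {R : realType}.

Definition split_lik (p q : nat) (x : R) : R :=
  x ^+ p * (1 - x) ^+ q * \1_`[0, 1] x.

Lemma split_lik_ge0 p q x : 0 <= split_lik p q x.
Proof.
rewrite /split_lik indicE; case: (boolP (x \in _)) => [|_]; last by rewrite mulr0.
rewrite inE/= in_itv/= => /andP[x0 x1].
by rewrite mulr1 mulr_ge0// exprn_ge0// subr_ge0.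
Qed.

Lemma measurable_split_lik p q : measurable_fun setT (split_lik p q).
Proof.
apply: measurable_funM; last exact: measurable_indic.
by apply: measurable_funM; apply: measurable_funX => //; exact: measurable_funB.
Qed.

Lemma integral_split_lik p q :
  (\int[beta_prob 1 1]_x (split_lik p q x)%:E =
   ((p`! * q`!)%:R / (p + q).+1`!%:R)%:E)%E.
Proof.
rewrite beta_prob_uniform integral_uniform//; last 2 first.
- by apply/measurable_EFinP; exact: measurable_split_lik.
- by move=> x; rewrite lee_fin split_lik_ge0.
rewrite subr0 invr1 mul1e -beta_fun_fact EFin_beta_fun/=.
rewrite [LHS]integral_mkcond; apply: eq_integral => x _.
rewrite !patchE; case: ifPn => // x01.
by rewrite /split_lik indicE x01 mulr1 /XMonemX.
Qed.

(** The likelihood ratio to the maximum, attained at the empirical frequency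
[a = p / (p + q)], is at most the exponential of minus [N = p + q] times a
squared Hellinger distance between Bernoulli laws: this follows from
[ln s <= s - 1] at [s = sqrt (x / a)] and [s = sqrt ((1 - x) / (1 - a))].
The Hellinger distance in turn dominates [|x - a| / 2]. *)
Lemma bernoulli_lik_le (p q : nat) (x : R) : (0 < p)%N -> (0 < q)%N ->
  0 <= x <= 1 ->
  x ^+ p * (1 - x) ^+ q <=
  (p%:R / (p + q)%:R) ^+ p * (q%:R / (p + q)%:R) ^+ q *
  expR (- (p + q)%:R * (x - p%:R / (p + q)%:R) ^+ 2 / 4).
Proof.
move=> p0 q0 /andP[x0 x1].
have N0 : 0 < (p + q)%:R :> R by rewrite ltr0n addn_gt0 p0.
set N : R := (p + q)%:R in N0 *.
set a : R := p%:R / N; set b : R := q%:R / N.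
have ap : 0 < a by rewrite divr_gt0// ltr0n.
have bp : 0 < b by rewrite divr_gt0// ltr0n.
have ab : a + b = 1.
  by rewrite -mulrDl -natrD divff// gt_eqF.
have pE : p%:R = N * a by rewrite /a mulrC divfK// gt_eqF.
have qE : q%:R = N * b by rewrite /b mulrC divfK// gt_eqF.
have pow (y c : R) (k : nat) : 0 <= y -> 0 < c ->
    y ^+ k <= c ^+ k * expR (2 * k%:R * (Num.sqrt (y / c) - 1)).
  move=> y0 c0; rewrite [2 * _]mulrC -mulrA expRM_natl -exprMn.
  rewrite lerXn2r ?nnegrE//; first by rewrite mulr_ge0 ?expR_ge0 ?(ltW c0).
  rewrite mulrC -ler_pdivrMr//.
  have yc : 0 <= y / c by rewrite divr_ge0// ltW.
  rewrite -{1}(sqr_sqrtr yc) mulrC -[2]/(2%:R) mulrC expRM_natl.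
  rewrite lerXn2r ?nnegrE ?sqrtr_ge0 ?expR_ge0//.
  by have := expR_ge1Dx (Num.sqrt (y / c) - 1); rewrite addrC subrK.
have sx : 0 <= 1 - x by rewrite subr_ge0.
apply: le_trans (ler_pM _ _ (pow x a p x0 ap) (pow (1 - x) b q sx bp)) _;
  rewrite ?exprn_ge0//.
rewrite mulrACA -expRD ler_wpM2l ?mulr_ge0 ?exprn_ge0 ?(ltW ap) ?(ltW bp)//.
rewrite ler_expR pE qE !sqrtrM// !sqrtrV ?(ltW ap) ?(ltW bp)//.
have [sa sb] : 0 < Num.sqrt a /\ 0 < Num.sqrt b by rewrite !sqrtr_gt0.
have ea : Num.sqrt a ^+ 2 = a by rewrite sqr_sqrtr// ltW.
have eb : Num.sqrt b ^+ 2 = b by rewrite sqr_sqrtr// ltW.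
have ex : Num.sqrt x ^+ 2 = x by rewrite sqr_sqrtr.
have ey : Num.sqrt (1 - x) ^+ 2 = 1 - x by rewrite sqr_sqrtr.
have := sqrtr_ge0 x; have := sqrtr_ge0 (1 - x).
move: (Num.sqrt a) (Num.sqrt b) (Num.sqrt x) (Num.sqrt (1 - x)) sa sb ea eb ex ey.
move=> A B X Y A0 B0 ea eb ex ey Y0 X0.
have -> : 2 * (N * a) * (X / A - 1) + 2 * (N * b) * (Y / B - 1) =
    N * (2 * A * X + 2 * B * Y - 2).
  have -> : 2 * (N * a) * (X / A - 1) = N * (2 * A * X - 2 * a).
    by rewrite -ea; field; rewrite gt_eqF.
  have -> : 2 * (N * b) * (Y / B - 1) = N * (2 * B * Y - 2 * b).
    by rewrite -eb; field; rewrite gt_eqF.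
  by rewrite -mulrDr; congr (_ * _); lra.
have -> : - N * (x - a) ^+ 2 / 4 = N * - ((x - a) ^+ 2 / 4) by field.
rewrite ler_pM2l//.
have -> : 2 * A * X + 2 * B * Y - 2 = - ((X - A) ^+ 2 + (Y - B) ^+ 2).
  by nra.
rewrite lerN2.
have hxa : (x - a) ^+ 2 = (X - A) ^+ 2 * (X + A) ^+ 2 by rewrite -ex -ea; ring.
have XA : (X + A) ^+ 2 <= 4 by nra.
rewrite hxa; have := sqr_ge0 (X - A); have := sqr_ge0 (Y - B).
by move=> h1 h2; nra.
Qed.

Lemma binomial_mode_le1 (p q : nat) (a b : R) : 0 <= a -> 0 <= b -> a + b = 1 ->
  'C(p + q, p)%:R * (a ^+ p * b ^+ q) <= 1.
Proof.
move=> a0 b0 ab.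
apply: (@le_trans _ _ ((b + a) ^+ (p + q))); last first.
  by rewrite addrC ab expr1n.
have hp : (p < (p + q).+1)%N by rewrite ltnS leq_addr.
rewrite exprDn (bigD1 (Ordinal hp))//= addKn mulr_natl [b ^+ _ * _]mulrC lerDl.
by apply: sumr_ge0 => i _; rewrite mulrn_wge0// mulr_ge0 ?exprn_ge0.
Qed.

Lemma split_lik_norm (p q : nat) :
  (p`! * q`!)%:R / (p + q).+1`!%:R =
  ((p + q).+1%:R * 'C(p + q, p)%:R)^-1 :> R.
Proof.
have e : (p + q).+1`! = ((p + q).+1 * 'C(p + q, p) * (p`! * q`!))%N.
  by rewrite factS -(bin_fact (leq_addr q p)) addKn mulnA.
rewrite e [in X in _ / X]natrM; set f := (p`! * q`!)%:R.
rewrite invfM [_^-1 / f]mulrC mulrA divff ?mul1r ?natrM//.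
by rewrite pnatr_eq0 muln_eq0 negb_or -!lt0n !fact_gt0.
Qed.

(** Under the Beta posterior, a split deviates from the empirical frequency
with a Gaussian tail.  The normalization is lost only up to the factor
[p + q + 1], because the maximum of the likelihood times the binomial
coefficient is a binomial probability, hence at most 1. *)
Lemma integral_split_lik_tail (p q : nat) (eta : R) :
  (0 < p)%N -> (0 < q)%N -> 0 <= eta ->
  (\int[beta_prob 1 1]_x (split_lik p q x *
      \1_[set y | (eta < `|y - p%:R / (p + q)%:R|)%R] x)%:E <=
   ((p + q).+1%:R * expR (- (p + q)%:R * eta ^+ 2 / 4))%:E *
   \int[beta_prob 1 1]_x (split_lik p q x)%:E)%E.
Proof.
move=> p0 q0 eta0.
have N0 : 0 < (p + q)%:R :> R by rewrite ltr0n addn_gt0 p0.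
set a : R := p%:R / (p + q)%:R; set b : R := q%:R / (p + q)%:R.
have ab : a + b = 1.
  by rewrite -mulrDl -natrD divff// gt_eqF.
have a0 : 0 <= a by rewrite divr_ge0.
have b0 : 0 <= b by rewrite divr_ge0.
pose M := a ^+ p * b ^+ q * expR (- (p + q)%:R * eta ^+ 2 / 4).
apply: (@le_trans _ _ (\int[beta_prob 1 1]_x (cst M%:E x))%E).
  apply: ge0_le_integral_nm => x.
    by rewrite lee_fin mulr_ge0 ?split_lik_ge0.
  rewrite lee_fin; have M0 : 0 <= M by rewrite !mulr_ge0 ?exprn_ge0 ?expR_ge0.
  rewrite [X in _ * X]indicE; case: (boolP (x \in _)); last by rewrite mulr0.
  rewrite inE/= mulr1 => xe; rewrite /split_lik indicE.
  case: (boolP (x \in _)); last by rewrite mulr0.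
  rewrite inE/= in_itv/= mulr1 => x01.
  apply: le_trans (bernoulli_lik_le p0 q0 x01) _.
  rewrite -/a -/b ler_wpM2l ?mulr_ge0 ?exprn_ge0// ler_expR !mulNr lerN2.
  rewrite ler_pM2r// ler_pM2l// -[leRHS]real_normK ?num_real//.
  by rewrite lerXn2r ?nnegrE// ltW.
rewrite integral_cst//= probability_setT mule1 integral_split_lik -EFinM lee_fin.
have C0 : 0 < 'C(p + q, p)%:R :> R by rewrite ltr0n bin_gt0 leq_addr.
rewrite split_lik_norm invfM /M [leRHS]mulrAC [X in _ <= X * _]mulrA mulfV ?pnatr_eq0//.
rewrite mul1r ler_wpM2r ?expR_ge0//.
by rewrite -[leRHS]mul1r ler_pdivlMr// mulrC binomial_mode_le1.
Qed.

Lemma integral_split_lik_ge (p q : nat) :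
  (((p + q).+1%:R * 2 ^+ (p + q))^-1%:E <=
   \int[beta_prob 1 1]_x (split_lik p q x)%:E)%E.
Proof.
rewrite integral_split_lik split_lik_norm lee_fin.
have C0 : 0 < 'C(p + q, p)%:R :> R by rewrite ltr0n bin_gt0 leq_addr.
rewrite lef_pV2 ?posrE ?mulr_gt0 ?exprn_gt0//.
rewrite ler_wpM2l// -natrX ler_nat -[X in (X ^ _)%N]/(1 + 1)%N expnDn.
have hp : (p < (p + q).+1)%N by rewrite ltnS leq_addr.
by rewrite (bigD1 (Ordinal hp))//= !exp1n !muln1 leq_addr.
Qed.

End beta_posterior.

(** * Counts and masses along the dyadic tree *)

Section exponential_bounds.
Context {R : realType}.

Lemma expR_le_invB (s : R) : s < 1 -> expR s <= (1 - s)^-1.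
Proof.
move=> s1; have h : 0 < 1 - s by rewrite subr_gt0.
rewrite -[s in leLHS]opprK expRN lef_pV2 ?posrE ?expR_gt0//.
exact: expR_ge1Dx.
Qed.

Lemma expR_le_lin (s : R) : 0 <= s <= 2^-1 -> expR s <= 1 + 2 * s.
Proof.
move=> /andP[s0 s1]; have h : 0 < 1 - s by lra.
apply: le_trans (expR_le_invB _) _; first lra.
by rewrite -[leRHS]mulr1 -[leLHS]mul1r ler_pdivrMr// mulr1; nra.
Qed.

Lemma expR_le_quad (s : R) : s <= 2^-1 -> expR s <= 1 + s + 2 * s ^+ 2.
Proof.
move=> s1; have h : 0 < 1 - s by lra.
apply: le_trans (expR_le_invB _) _; first lra.
have s20 : 0 <= s ^+ 2 by exact: sqr_ge0.
by rewrite -[leLHS]mul1r ler_pdivrMr//; nra.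
Qed.

End exponential_bounds.

Lemma half_lt_exp2 l i : (i < 2 ^ l.+1)%N -> (i./2 < 2 ^ l)%N.
Proof. by rewrite expnS; lia. Qed.

Lemma double_lt_exp2 l i : (i < 2 ^ l)%N -> (i.*2 < 2 ^ l.+1)%N.
Proof. by rewrite expnS; lia. Qed.

Lemma doubleS_lt_exp2 l i : (i < 2 ^ l)%N -> (i.*2.+1 < 2 ^ l.+1)%N.
Proof. by rewrite expnS; lia. Qed.

Section dyadic_tree.
Context {R : realType} {n : nat}.
Variables (L : nat) (k : 'I_n -> nat).
Hypothesis kL : forall j, (k j < 2 ^ L)%N.

(** Observation [j] sits in leaf [k j]; the ancestor of a leaf at level [l] is
obtained by dropping the last [L - l] bits of its index. *)
Definition node_count (l i : nat) : nat :=
  #|[pred j : 'I_n | (k j %/ 2 ^ (L - l))%N == i]|.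

Lemma ancestor_half l (m : nat) : (l < L)%N ->
  ((m %/ 2 ^ (L - l.+1))./2 = m %/ 2 ^ (L - l))%N.
Proof.
by move=> lL; rewrite -divn2 -divnMA -expnSr -subSn.
Qed.

Lemma node_countD l i : (l < L)%N ->
  node_count l i = (node_count l.+1 i.*2 + node_count l.+1 i.*2.+1)%N.
Proof.
move=> lL; rewrite /node_count -cardUI.
rewrite [X in (_ = _ + X)%N]eq_card0 ?addn0; last first.
  by move=> j; rewrite !inE; apply/negP => /andP[/eqP -> /eqP]; lia.
apply: eq_card => j; rewrite !inE -ancestor_half//.
by apply/eqP/orP => [<-|[/eqP->|/eqP->]]; [|lia|lia];
  case: (boolP (odd (k j %/ 2 ^ (L - l.+1))%N)) => o; [right|left];
  apply/eqP; lia.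
Qed.

Lemma node_count0 : node_count 0 0 = n.
Proof.
rewrite /node_count -[RHS](card_ord n); apply: eq_card => j.
by rewrite !inE subn0 divn_small ?eqxx.
Qed.

Lemma node_count_bounds (lo hi : nat -> R) :
  (forall i, (i < 2 ^ L)%N -> lo 0%N <= (node_count L i)%:R <= hi 0%N) ->
  (forall h, lo h.+1 = 2 * lo h) -> (forall h, hi h.+1 = 2 * hi h) ->
  forall l i, (l <= L)%N -> (i < 2 ^ l)%N ->
    lo (L - l)%N <= (node_count l i)%:R <= hi (L - l)%N.
Proof.
move=> hL lo2 hi2 l i lL il.
suff H h i' : (h <= L)%N -> (i' < 2 ^ (L - h))%N ->
    lo h <= (node_count (L - h) i')%:R <= hi h.
  by have := H (L - l)%N i; rewrite subKn// leq_subr; exact.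
elim: h i' => [|h IH] {il}i hL'.
  by rewrite subn0 => iL; exact: hL.
have e : (L - h = (L - h.+1).+1)%N by lia.
move=> iL; have {}IH m := IH m (ltnW hL'); rewrite e in IH.
rewrite node_countD; last lia.
have /IH/andP[a1 a2] := double_lt_exp2 iL.
have /IH/andP[b1 b2] := doubleS_lt_exp2 iL.
by rewrite natrD lo2 hi2; lra.
Qed.

Lemma prod_ord_double (G : nat -> R) (M : nat) :
  \prod_(r < M.*2) G r = \prod_(i < M) (G i.*2 * G i.*2.+1).
Proof.
elim: M => [|M IH]; first by rewrite !big_ord0.
by rewrite doubleS !big_ord_recr /= IH mulrA.
Qed.

Lemma prod_over_leaves (F : nat -> R) (m : 'I_n -> nat) (M : nat) :
  (forall j, (m j < M)%N) ->
  \prod_(j < n) F (m j) = \prod_(r < M) F r ^+ #|[pred j | m j == r]|.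
Proof.
move=> mM; rewrite (partition_big (fun j => Ordinal (mM j)) xpredT)//=.
apply: eq_bigr => r _; rewrite -prodr_const; apply: eq_big => [j|j /eqP <-//].
by rewrite inE.
Qed.

(** The likelihood of histogram data factorizes over the nodes of the tree:
node [(h, i)] contributes a Bernoulli likelihood with the counts of its two
children. *)
Lemma prod_polya_mass (V : nat -> nat -> R) l : (l <= L)%N ->
  \prod_(j < n) polya_mass V l (k j %/ 2 ^ (L - l)) =
  \prod_(h < l) \prod_(i < 2 ^ h)
    (V h i ^+ node_count h.+1 i.*2 * (1 - V h i) ^+ node_count h.+1 i.*2.+1).
Proof.
elim: l => [|l IH] lL /=; first by rewrite big_ord0 big1.
rewrite big_ord_recr /= -IH; last exact: ltnW.
rewrite big_split /= mulrC; congr (_ * _).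
  by apply: eq_bigr => j _; rewrite ancestor_half.
pose F m := if odd m then 1 - V l m./2 else V l m./2.
rewrite (@prod_over_leaves F _ (2 ^ l.+1)); last first.
  by move=> j; rewrite ltn_divLR ?expn_gt0// -expnD subnKC.
rewrite expnS mul2n.
rewrite (@prod_ord_double (fun r => F r ^+ node_count l.+1 r)).
apply: eq_bigr => i _.
by rewrite /F /= !odd_double /= uphalf_double doubleK.
Qed.

Lemma polya_mass_half l i : polya_mass (fun _ _ => 2^-1 : R) l i = (2 ^+ l)^-1.
Proof.
elim: l i => [|l IH] i /=; first by rewrite expr0 invr1.
by rewrite IH exprS invfM; case: odd; congr (_ * _); lra.
Qed.

(** Both the mass of a node and its empirical frequency are products of splits
along the branch that leads to it, the latter product telescoping, so the
relative errors [r] of the splits accumulate multiplicatively. *)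
Lemma polya_mass_rel_error (V : nat -> nat -> R) (eta r : nat -> R) :
  (forall l, 0 <= r l) ->
  (forall l i, (l <= L)%N -> (i < 2 ^ l)%N -> (0 < node_count l i)%N) ->
  (forall l i, (l < L)%N -> (i < 2 ^ l)%N ->
    `|V l i - (node_count l.+1 i.*2)%:R / (node_count l i)%:R| <= eta l) ->
  (forall l i, (l < L)%N -> (i < 2 ^ l.+1)%N ->
    eta l * (node_count l i./2)%:R <= r l * (node_count l.+1 i)%:R) ->
  forall l i, (l <= L)%N -> (i < 2 ^ l)%N ->
  `|polya_mass V l i * n%:R / (node_count l i)%:R - 1| <=
    expR (\sum_(h < l) r h) - 1.
Proof.
move=> r0 cpos hV hr; elim => [|l IH] i lL il.
  have -> : i = 0%N by move: il; rewrite expn0; case: i.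
  have := cpos 0%N 0%N isT isT; rewrite node_count0 => n0.
  by rewrite big_ord0 expR0 /= mul1r divff ?subrr ?normr0// pnatr_eq0 -lt0n.
have il2 := half_lt_exp2 il.
have := IH i./2 (ltnW lL) il2.
have cN0 : 0 < (node_count l i./2)%:R :> R by rewrite ltr0n cpos// ltnW.
have cS0 : 0 < (node_count l.+1 i)%:R :> R by rewrite ltr0n cpos.
have hC : (node_count l i./2)%:R =
    (node_count l.+1 i./2.*2)%:R + (node_count l.+1 i./2.*2.+1)%:R :> R.
  by rewrite node_countD// natrD.
set w := if odd i then 1 - V l i./2 else V l i./2.
have hw : `|w - (node_count l.+1 i)%:R / (node_count l i./2)%:R| <= eta l.
  have := hV l i./2 lL il2; rewrite /w.
  have := odd_double_half i; case: (odd i) => /= iE; last first.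
    by rewrite add0n in iE; rewrite iE.
  rewrite add1n in iE; rewrite iE in hC.
  congr (_ <= _); rewrite -normrN; congr `|_|.
  have -> : (node_count l.+1 i)%:R = (node_count l i./2)%:R -
     (node_count l.+1 i./2.*2)%:R :> R by rewrite hC; ring.
  by field; rewrite gt_eqF.
have hx : `|w * (node_count l i./2)%:R / (node_count l.+1 i)%:R - 1| <= r l.
  have -> : w * (node_count l i./2)%:R / (node_count l.+1 i)%:R - 1 =
      (w - (node_count l.+1 i)%:R / (node_count l i./2)%:R) *
      (node_count l i./2)%:R / (node_count l.+1 i)%:R.
    by field; rewrite !gt_eqF.
  rewrite !normrM normfV (ger0_norm (ltW cN0)) (ger0_norm (ltW cS0)).
  rewrite ler_pdivrMr//; apply: le_trans (hr l i lL il).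
  by rewrite ler_pM2r.
rewrite big_ord_recr /= expRD.
set A := polya_mass V l i./2 * n%:R / (node_count l i./2)%:R.
have -> : w * polya_mass V l i./2 * n%:R / (node_count l.+1 i)%:R =
    A * (w * (node_count l i./2)%:R / (node_count l.+1 i)%:R).
  by rewrite /A; field; rewrite !gt_eqF.
move: A (w * _ / _) hx => A B hB hA.
have := expR_ge1Dx (r l); have := expR_ge0 (\sum_(h < l) r h).
move: (expR (r l)) (expR (\sum_(h < l) r h)) hA => E S hA S0 hE.
have -> : A * B - 1 = (A - 1) * (B - 1) + (A - 1) + (B - 1) by ring.
apply: le_trans (ler_normD _ _) _.
apply: le_trans (lerD (ler_normD _ _) hB) _; rewrite normrM.
have := normr_ge0 (A - 1); have := normr_ge0 (B - 1).
move: `|A - 1| `|B - 1| hA hB => x y hx hy y0 x0.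
apply: (@le_trans _ _ (x * r l + x + r l)).
  by rewrite !lerD// ler_wpM2l.
by have := r0 l; nra.
Qed.

End dyadic_tree.

Section heap.
Context {R : realType}.

(** A tuple that stores a binary tree level by level is indexed like a heap:
these are the level and the position in its level of the node at index
[j]. *)
Definition heap_level (j : nat) : nat := trunc_log 2 j.+1.
Definition heap_pos (j : nat) : nat := (j.+1 - 2 ^ heap_level j)%N.

Lemma heap_level_node l i : (i < 2 ^ l)%N -> heap_level ((2 ^ l).-1 + i) = l.
Proof.
move=> il; apply: trunc_log_eq => //.
by have := expn_gt0 2 l; rewrite expnS; lia.
Qed.

Lemma heap_pos_node l i : (i < 2 ^ l)%N -> heap_pos ((2 ^ l).-1 + i) = i.
Proof.
move=> il; rewrite /heap_pos heap_level_node//.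
by have := expn_gt0 2 l; lia.
Qed.

Lemma heap_node j : ((2 ^ heap_level j).-1 + heap_pos j = j)%N.
Proof.
have /andP[h1 h2] := @trunc_log_bounds 2 j.+1 isT isT.
by rewrite /heap_pos /heap_level; have := expn_gt0 2 (trunc_log 2 j.+1); lia.
Qed.

Lemma heap_pos_lt j : (heap_pos j < 2 ^ heap_level j)%N.
Proof.
have /andP[h1 h2] := @trunc_log_bounds 2 j.+1 isT isT.
by move: h2; rewrite /heap_pos /heap_level expnS; lia.
Qed.

Lemma heap_level_lt L j : (j < (2 ^ L).-1)%N -> (heap_level j < L)%N.
Proof.
move=> jL; rewrite -(ltn_exp2l _ _ (isT : 1 < 2)%N).
have /andP[h1 _] := @trunc_log_bounds 2 j.+1 isT isT.
by apply: leq_ltn_trans h1 _; lia.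
Qed.

Lemma heap_node_lt L l i : (l < L)%N -> (i < 2 ^ l)%N ->
  ((2 ^ l).-1 + i < (2 ^ L).-1)%N.
Proof.
move=> lL il.
have : (2 ^ l.+1 <= 2 ^ L)%N by rewrite leq_exp2l.
by rewrite expnS; have := expn_gt0 2 l; lia.
Qed.

Lemma prod_heap (F : nat -> nat -> R) L :
  \prod_(l < L) \prod_(i < 2 ^ l) F l i =
  \prod_(j < (2 ^ L).-1) F (heap_level j) (heap_pos j).
Proof.
elim: L => [|L IH]; first by rewrite !big_ord0.
have e : (2 ^ L.+1).-1 = ((2 ^ L).-1 + 2 ^ L)%N.
  by rewrite expnS; have := expn_gt0 2 L; lia.
rewrite big_ord_recr /= IH e big_split_ord /=; congr (_ * _).
by apply: eq_bigr => i _; rewrite heap_level_node// heap_pos_node.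
Qed.

End heap.

(** * Dyadic bins and histograms *)

Section dyadic_bins.
Context {R : realType}.
Variables (a b : R).
Hypothesis ab : a < b.
Let ba0 : 0 < b - a. Proof. by rewrite subr_gt0. Qed.

Definition bin_edge (L k : nat) : R := a + (b - a) * k%:R / 2 ^+ L.

Lemma bin_edge0 L : bin_edge L 0 = a.
Proof. by rewrite /bin_edge mulr0 mul0r addr0. Qed.

Lemma bin_edge_last L : bin_edge L (2 ^ L) = b.
Proof. by rewrite /bin_edge natrX mulfK ?expf_neq0// addrC subrK. Qed.

Lemma ler_bin_edge L k k' : (k <= k')%N -> bin_edge L k <= bin_edge L k'.
Proof.
move=> kk; rewrite /bin_edge lerD2l ler_pM2r ?invr_gt0 ?exprn_gt0//.
by rewrite ler_pM2l// ler_nat.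
Qed.

Lemma bin_edgeS L k : bin_edge L k.+1 = bin_edge L k + (b - a) / 2 ^+ L.
Proof. by rewrite /bin_edge -natr1; field; rewrite expf_neq0. Qed.

Lemma dyadic_lastE L : (2 ^ L).-1.+1 = (2 ^ L)%N.
Proof. by rewrite prednK// expn_gt0. Qed.

Lemma dyadicE L k : dyadic a b L k =
  if k == (2 ^ L).-1 then `[bin_edge L k, bin_edge L k.+1]%classic
  else `[bin_edge L k, bin_edge L k.+1[%classic.
Proof.
rewrite /dyadic; case: eqP => [->|_] //.
rewrite dyadic_lastE bin_edge_last; congr (`[_, _]%classic).
by rewrite -[X in X - _](bin_edge_last L) -dyadic_lastE bin_edgeS addrK.
Qed.

Lemma dyadic_le L k x : dyadic a b L k x -> bin_edge L k <= x <= bin_edge L k.+1.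
Proof.
rewrite dyadicE; case: ifP => _ /=; rewrite in_itv //=.
by move=> /andP[-> /ltW ->].
Qed.

Lemma dyadic_of_lt L k x : bin_edge L k <= x < bin_edge L k.+1 -> dyadic a b L k x.
Proof.
move=> /andP[x1 x2]; rewrite dyadicE; case: ifP => _ /=; rewrite in_itv /= x1//.
exact: ltW.
Qed.

Lemma measurable_dyadic L k : measurable (dyadic a b L k).
Proof. by rewrite dyadicE; case: ifP. Qed.

Lemma lebesgue_dyadic L k :
  lebesgue_measure (dyadic a b L k) = ((b - a) / 2 ^+ L)%:E.
Proof.
have lt : bin_edge L k < bin_edge L k.+1.
  by rewrite bin_edgeS ltrDl divr_gt0// exprn_gt0.
rewrite dyadicE; case: ifP => _; rewrite lebesgue_measure_itv/= lte_fin lt;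
  by rewrite -EFinD bin_edgeS addrAC subrr add0r.
Qed.

(** The minimum sends the right endpoint [b] to the last bin. *)
Definition leaf (L : nat) (x : R) : nat :=
  minn (2 ^ L).-1 (Num.truncn ((x - a) / (b - a) * 2 ^+ L)).

Lemma leaf_lt L x : (leaf L x < 2 ^ L)%N.
Proof. by rewrite -[X in (_ < X)%N]dyadic_lastE ltnS geq_minl. Qed.

Lemma dyadic_leaf L x : x \in `[a, b] -> dyadic a b L (leaf L x) x.
Proof.
rewrite in_itv /= => /andP[xa xb].
set u := (x - a) / (b - a) * 2 ^+ L.
have xE : x = a + (b - a) * u / 2 ^+ L.
  by rewrite /u; field; rewrite expf_neq0//= gt_eqF.
have u0 : 0 <= u by rewrite mulr_ge0 ?divr_ge0 ?exprn_ge0 ?subr_ge0// ltW.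
have edge_le k : (bin_edge L k <= x) = (k%:R <= u).
  by rewrite xE /bin_edge lerD2l ler_pM2r ?invr_gt0 ?exprn_gt0// ler_pM2l.
have edge_lt k : (x < bin_edge L k) = (u < k%:R).
  by rewrite !ltNge edge_le.
have /andP[t1 t2] := truncn_itv u0.
case: (leqP (2 ^ L).-1 (Num.truncn u)) => h.
  have e : leaf L x = (2 ^ L).-1 by rewrite /leaf -/u (minn_idPl h).
  rewrite e dyadicE eqxx /= in_itv /= edge_le dyadic_lastE bin_edge_last xb andbT.
  by apply: le_trans t1; rewrite ler_nat.
have e : leaf L x = Num.truncn u by rewrite /leaf -/u (minn_idPr (ltnW h)).
by apply: dyadic_of_lt; rewrite e edge_le edge_lt t1 t2.
Qed.

Lemma dyadic_inj L k k' x : (k < 2 ^ L)%N -> (k' < 2 ^ L)%N ->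
  dyadic a b L k x -> dyadic a b L k' x -> k = k'.
Proof.
wlog kk : k k' / (k < k')%N.
  move=> H kL k'L kx k'x; have [lt|lt|//] := ltngtP k k'; first exact: H.
  by apply/esym; exact: H.
move=> kL k'L; rewrite {1}dyadicE.
have -> : (k == (2 ^ L).-1) = false by apply/eqP; have := dyadic_lastE L; lia.
rewrite /= in_itv /= => /andP[_ x1] /dyadic_le /andP[x2 _].
have := ler_bin_edge L kk; rewrite leNgt.
by rewrite (le_lt_trans x2 x1).
Qed.

Lemma dyadic_subset L k x : (k < 2 ^ L)%N -> dyadic a b L k x -> x \in `[a, b].
Proof.
move=> kL /dyadic_le /andP[x1 x2]; rewrite in_itv /=; apply/andP; split.
  by apply: le_trans x1; rewrite -{1}(bin_edge0 L) ler_bin_edge.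
by apply: le_trans x2 _; rewrite -[leRHS](bin_edge_last L) ler_bin_edge.
Qed.

Lemma polya_densityE L (V : nat -> nat -> R) x : x \in `[a, b] ->
  polya_density a b L V x = 2 ^+ L / (b - a) * polya_mass V L (leaf L x).
Proof.
move=> xab; rewrite /polya_density (bigD1 (Ordinal (leaf_lt L x)))//= big1 ?addr0.
  by rewrite indicE mem_set ?mulr1//; exact: dyadic_leaf.
move=> i il; rewrite indicE memNset ?mulr0// => ix.
move/eqP: il; apply; apply: val_inj => /=.
exact: dyadic_inj (ltn_ord i) (leaf_lt L x) ix (dyadic_leaf L xab).
Qed.

Lemma polya_density_out L (V : nat -> nat -> R) x :
  x \notin `[a, b] -> polya_density a b L V x = 0.
Proof.
move=> xab; rewrite /polya_density big1// => i _.
rewrite indicE memNset ?mulr0// => ix.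
by move: xab; rewrite (dyadic_subset (ltn_ord i) ix).
Qed.

Lemma polya_mass_ge0 (V : nat -> nat -> R) l k :
  (forall h i, 0 <= V h i <= 1) -> 0 <= polya_mass V l k.
Proof.
move=> V01; elim: l k => [|l IH] k //=.
have /andP[v0 v1] := V01 l k./2.
by rewrite mulr_ge0//; case: ifP; rewrite ?subr_ge0.
Qed.

Lemma polya_density_ge0 L (V : nat -> nat -> R) x : (forall h i, 0 <= V h i <= 1) ->
  0 <= polya_density a b L V x.
Proof.
move=> V01; have [xab|xab] := boolP (x \in `[a, b]).
  by rewrite polya_densityE// mulr_ge0 ?polya_mass_ge0// divr_ge0 ?exprn_ge0 ?ltW.
by rewrite polya_density_out.
Qed.

Lemma sum_polya_mass (V : nat -> nat -> R) l : \sum_(k < 2 ^ l) polya_mass V l k = 1.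
Proof.
elim: l => [|l IH]; first by rewrite big_ord_recl big_ord0 addr0.
have dbl (G : nat -> R) M :
    \sum_(r < M.*2) G r = \sum_(i < M) (G i.*2 + G i.*2.+1).
  elim: M => [|M IHM]; first by rewrite !big_ord0.
  by rewrite doubleS !big_ord_recr /= IHM addrA.
rewrite expnS mul2n (dbl (polya_mass V l.+1)) -IH; apply: eq_bigr => i _ /=.
by rewrite !odd_double /= uphalf_double doubleK -mulrDl addrC subrK mul1r.
Qed.

Lemma integral_polya_density L (V : nat -> nat -> R) : (forall h i, 0 <= V h i <= 1) ->
  (\int[lebesgue_measure]_x (polya_density a b L V x)%:E = 1)%E.
Proof.
move=> V01; have c0 k : 0 <= 2 ^+ L / (b - a) * polya_mass V L k.
  by rewrite mulr_ge0 ?polya_mass_ge0// divr_ge0 ?exprn_ge0 ?ltW.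
transitivity (\int[lebesgue_measure]_x (\sum_(k < 2 ^ L)
    (2 ^+ L / (b - a) * polya_mass V L k * \1_(dyadic a b L k) x)%:E))%E.
  by apply: eq_integral => x _; rewrite sumEFin.
rewrite ge0_integral_sum//; last 2 first.
- move=> k; apply/measurable_EFinP; apply: measurable_funM => //.
  apply: measurable_indic; exact (@measurable_dyadic L k).
- by move=> k x _; rewrite lee_fin mulr_ge0.
rewrite -[in RHS](sum_polya_mass V L) -sumEFin; apply: eq_bigr => k _.
under eq_integral do rewrite EFinM.
rewrite ge0_integralZl//; last 2 first.
- by apply/measurable_EFinP; apply: measurable_indic; exact (@measurable_dyadic L k).
- by rewrite lee_fin c0.
rewrite integral_indic ?setIT//; last exact (@measurable_dyadic L k).
rewrite [X in (_ * X)%E]lebesgue_dyadic -EFinM; congr _%:E.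
by field; rewrite expf_neq0//= gt_eqF.
Qed.

End dyadic_bins.

(** * The prior predictive density of the coefficients *)

Lemma measurable_indic_comp {R : realType} {d : measure_display}
    {T : measurableType d} (A : set R) (h : T -> R) :
  measurable A -> measurable_fun setT h ->
  measurable_fun setT (fun x => \1_A (h x) : R).
Proof.
move=> mA mh; have mi : measurable_fun [set: R] (\1_A : R -> R).
  exact: measurable_indic.
exact: (measurableT_comp mi mh).
Qed.

Section prior_predictive.
Context {R : realType}.
Variables (a b : R) (L n : nat).
Hypothesis ab : a < b.
Let ba0 : 0 < b - a. Proof. by rewrite subr_gt0. Qed.

Local Notation N := (2 ^ L).-1.
Local Notation splitsT := (N.-tuple (measurableTypeR R)).
Local Notation obsT := (n.-tuple (measurableTypeR R)).
Local Notation g v := (polya_density a b L (splits v)).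

(** The joint density of the splits and the coefficients, made nonnegative
everywhere by cutting it off where a split leaves [0, 1], which has prior
probability zero. *)
Definition prior_joint (v : splitsT) (t : obsT) : R :=
  iid_pdf (g v) t * \prod_(j < N) \1_`[0, 1]%classic (tnth v j).

Definition prior_cube : set splitsT :=
  [set v | forall j, tnth v j \in `[0, 1]].

Lemma cube_indicE (v : splitsT) :
  \prod_(j < N) \1_`[0, 1]%classic (tnth v j) = \1_prior_cube v :> R.
Proof.
rewrite [RHS]indicE; case: (boolP (v \in prior_cube)) => [|].
  rewrite inE => h; rewrite big1// => j _; rewrite indicE mem_set//; exact: h.
rewrite notin_setE /prior_cube /= => /existsNP [j hj].
by rewrite (bigD1 j)//= indicE memNset ?mul0r.
Qed.

Lemma measurable_prior_cube : measurable prior_cube.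
Proof.
apply/(@measurable_indicP _ _ R).
rewrite (_ : \1_prior_cube =
    fun v : splitsT => \prod_(j < N) \1_`[0, 1]%classic (tnth v j)); last first.
  by apply/funext => v; rewrite cube_indicE.
apply: measurable_prod => j _.
by apply: measurable_indic_comp => //; exact: measurable_tnth.
Qed.

Lemma splits_cube (v : splitsT) : prior_cube v -> forall h i, 0 <= splits v h i <= 1.
Proof.
move=> hv h i; rewrite /splits; set m := ((2 ^ h).-1 + i)%N.
case: (ltnP m N) => mN; last by rewrite nth_default ?size_tuple// lexx ler01.
by have := hv (Ordinal mN); rewrite in_itv /= (tnth_nth 0).
Qed.

Lemma prior_joint_ge0 v t : 0 <= prior_joint v t.
Proof.
rewrite /prior_joint cube_indicE indicE.
case: (boolP (v \in prior_cube)) => [|_]; last by rewrite mulr0.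
rewrite inE mulr1 => hv; apply: prodr_ge0 => j _; apply: polya_density_ge0 => //.
exact: splits_cube.
Qed.

Lemma splits_law_setT : splits_law R L setT = 1%E.
Proof.
transitivity (\int[splits_law R L]_v (\prod_(j < N) (1 : R))%:E)%E.
  by rewrite big1// integral_cst//= mul1e.
rewrite (@integral_mpow_prod _ (measurableTypeR R) R (beta_prob 1 1) N
    (fun _ _ => 1))// big1// => j _.
by rewrite integral_cst// mul1e; exact: probability_setT.
Qed.

Lemma prior_cube_ae : splits_law R L (~` prior_cube) = 0%E.
Proof.
have h1 : splits_law R L prior_cube = 1%E.
  transitivity (\int[splits_law R L]_v (\1_prior_cube v)%:E)%E.
    by rewrite integral_indic ?setIT//; exact: measurable_prior_cube.
  transitivity (\prod_(j < N) \int[beta_prob 1 1]_x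
      (\1_(`[0, 1]%classic : set (measurableTypeR R)) x)%:E)%E.
    rewrite -(@integral_mpow_prod _ (measurableTypeR R) R (beta_prob 1 1) N
      (fun=> \1_(`[0, 1]%classic)))//.
    by apply: eq_integral => v _; rewrite -cube_indicE.
  rewrite big1// => j _; rewrite integral_indic// setIT.
  exact: beta_prob01.
have hT := splits_law_setT.
rewrite -setTD measureD//; last 2 first.
- exact: measurable_prior_cube.
- by rewrite [X in (X < _)%E]hT ltry.
by rewrite setTI [X in (X - _)%E]hT [X in (_ - X)%E]h1 subee.
Qed.

Lemma measurable_splits l k : measurable_fun setT (fun v : splitsT => splits v l k).
Proof.
rewrite /splits; set m := ((2 ^ l).-1 + k)%N.
case: (ltnP m N) => mN.
  rewrite (_ : (fun _ => _) = (fun v : splitsT => tnth v (Ordinal mN))).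
    exact: measurable_tnth.
  by apply/funext => v; rewrite (tnth_nth 0).
rewrite (_ : (fun _ => _) = cst 0)//.
by apply/funext => v; rewrite nth_default ?size_tuple.
Qed.

Lemma measurable_polya_mass l k :
  measurable_fun setT (fun v : splitsT => polya_mass (splits v) l k).
Proof.
elim: l k => [|l IH] k //=; apply: measurable_funM => //.
case: odd; last exact: measurable_splits.
by apply: measurable_funB => //; exact: measurable_splits.
Qed.

Lemma measurable_prior_joint :
  measurable_fun setT (fun vt : splitsT * obsT => prior_joint vt.1 vt.2).
Proof.
apply: measurable_funM; last first.
  apply: measurable_prod => j _.
  apply: measurable_indic_comp => //.
  exact: (measurableT_comp (measurable_tnth j) measurable_fst).
apply: measurable_prod => j _; apply: measurable_sum => k.
apply: measurable_funM.
  apply: measurable_funM => //.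
  exact: (measurableT_comp (@measurable_polya_mass L k) measurable_fst).
apply: measurable_indic_comp; first exact (@measurable_dyadic R a b L k).
exact: (measurableT_comp (measurable_tnth j) measurable_snd).
Qed.

Lemma prior_joint_out v t : ~ (forall j, tnth t j \in `[a, b]) ->
  prior_joint v t = 0.
Proof.
move=> /existsNP [j hj]; rewrite /prior_joint /iid_pdf (bigD1 j)//=.
by rewrite polya_density_out ?mul0r//; apply/negP.
Qed.

Definition leaves (t : obsT) (j : 'I_n) : nat := leaf a b L (tnth t j).

Lemma leaves_lt t j : (leaves t j < 2 ^ L)%N.
Proof. exact: leaf_lt. Qed.

Definition left_count t (j : nat) : nat :=
  node_count L (leaves t) (heap_level j).+1 (heap_pos j).*2.
Definition right_count t (j : nat) : nat :=
  node_count L (leaves t) (heap_level j).+1 (heap_pos j).*2.+1.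

Lemma prior_joint_prod v t : (forall j, tnth t j \in `[a, b]) ->
  prior_joint v t = (2 ^+ L / (b - a)) ^+ n *
    \prod_(j < N) split_lik (left_count t j) (right_count t j) (tnth v j).
Proof.
move=> tab; rewrite /prior_joint /iid_pdf.
under eq_bigr => j _ do rewrite (polya_densityE ab _ _ (tab j)).
rewrite big_split /= prodr_const card_ord -mulrA; congr (_ * _).
rewrite (eq_bigr (fun j => polya_mass (splits v) L
    (leaves t j %/ 2 ^ (L - L)))); last by move=> j _; rewrite subnn divn1.
rewrite (prod_polya_mass (leaves_lt t) _ (leqnn L)).
rewrite (prod_heap (fun l i => splits v l i ^+ node_count L (leaves t) l.+1 i.*2 *
   (1 - splits v l i) ^+ node_count L (leaves t) l.+1 i.*2.+1)).
rewrite -big_split /=; apply: eq_bigr => j _.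
by rewrite /split_lik /splits heap_node -(tnth_nth 0).
Qed.

Definition prior_pred (t : obsT) : \bar R :=
  (\int[splits_law R L]_v (prior_joint v t)%:E)%E.

Lemma prior_pred_ge0 t : (0 <= prior_pred t)%E.
Proof. by apply: integral_ge0 => v _; rewrite lee_fin prior_joint_ge0. Qed.

Lemma measurable_prior_pred : measurable_fun setT prior_pred.
Proof.
apply: (@measurable_fun_fubini_tonelli_G _ _ _ _ _ (splits_law R L)
  (fun vt : splitsT * obsT => (prior_joint vt.1 vt.2)%:E)).
  by apply/measurable_EFinP; exact: measurable_prior_joint.
by move=> vt; rewrite lee_fin prior_joint_ge0.
Qed.

Lemma prior_pred_out t : ~ (forall j, tnth t j \in `[a, b]) -> prior_pred t = 0%E.
Proof.
by move=> tab; rewrite /prior_pred integral0_eq// => v _; rewrite prior_joint_out.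
Qed.

Lemma prior_pred_prod t : (forall j, tnth t j \in `[a, b]) ->
  prior_pred t = (((2 ^+ L / (b - a)) ^+ n)%:E *
    \prod_(j < N) \int[beta_prob 1 1]_x
      (split_lik (left_count t j) (right_count t j) x)%:E)%E.
Proof.
move=> tab; rewrite /prior_pred.
under eq_integral do rewrite prior_joint_prod// EFinM.
rewrite ge0_integralZl//; last 3 first.
- apply/measurable_EFinP; apply: measurable_prod => j _.
  apply: (@measurableT_comp _ _ _ _ _ _ (split_lik _ _)).
    exact: measurable_split_lik.
  exact: measurable_tnth.
- by move=> v _; rewrite lee_fin prodr_ge0// => j _; exact: split_lik_ge0.
- by rewrite lee_fin exprn_ge0// divr_ge0 ?exprn_ge0// ltW.
congr (_ * _)%E.
apply: (@integral_mpow_prod _ (measurableTypeR R) R (beta_prob 1 1) N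
  (fun j => split_lik (left_count t j) (right_count t j))).
- by move=> j; exact: measurable_split_lik.
- by move=> j x; exact: split_lik_ge0.
Qed.

Definition prior_pdf (t : obsT) : R := fine (prior_pred t).

Lemma prior_predE t : prior_pred t = (prior_pdf t)%:E.
Proof.
rewrite fineK//; have [tab|tab] := pselect (forall j, tnth t j \in `[a, b]).
  rewrite prior_pred_prod//; under eq_bigr do rewrite integral_split_lik.
  by rewrite prodEFin -EFinM.
by rewrite prior_pred_out.
Qed.

Lemma prior_pdf_ge0 t : 0 <= prior_pdf t.
Proof. by rewrite fine_ge0// prior_pred_ge0. Qed.

Lemma measurable_prior_pdf : measurable_fun setT prior_pdf.
Proof. by apply: measurableT_comp => //; exact: measurable_prior_pred. Qed.

Lemma integral_prior_pdf_le1 : (\int[lebesgue_pow R n]_t (prior_pdf t)%:E <= 1)%E.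
Proof.
under eq_integral do rewrite -prior_predE.
rewrite -(@fubini_tonelli _ _ _ _ _ (splits_law R L) (lebesgue_pow R n)
  (fun vt : splitsT * obsT => (prior_joint vt.1 vt.2)%:E)); last 2 first.
- by apply/measurable_EFinP; exact: measurable_prior_joint.
- by move=> vt; rewrite lee_fin prior_joint_ge0.
apply: (@le_trans _ _ (\int[splits_law R L]_v (cst 1 v))%E); last first.
  by rewrite integral_cst// mul1e; rewrite [X in (X <= _)%E]splits_law_setT.
apply: ge0_le_integral_nm => v /=.
  by apply: integral_ge0 => t _; rewrite lee_fin prior_joint_ge0.
have [hv|hv] := pselect (prior_cube v); last first.
  rewrite integral0_eq// => t _.
  by rewrite /prior_joint cube_indicE indicE memNset// mulr0.
rewrite (eq_integral (fun t : obsT => (\prod_(j < n) g v (tnth t j))%:E)); last first.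
  by move=> t _; rewrite /prior_joint cube_indicE indicE mem_set// mulr1.
rewrite (@integral_mpow_prod _ (measurableTypeR R) R lebesgue_measure n
  (fun=> g v)).
- by rewrite big1// => j _; apply: integral_polya_density => //; exact: splits_cube.
- move=> j; apply: measurable_sum => k; apply: measurable_funM => //.
  apply: measurable_indic; exact (@measurable_dyadic R a b L k).
- by move=> j x; apply: polya_density_ge0 => //; exact: splits_cube.
Qed.

Lemma count_le t l i : (node_count L (leaves t) l i <= n)%N.
Proof. by rewrite /node_count -[leqRHS](card_ord n) max_card. Qed.

(** The prior predictive density is comparable to the uniform one: each split
costs a factor [2] per coefficient, which the heights of the bins give back,
and a polynomial factor for the normalization of its Beta integral. *)
Lemma prior_pred_ge t : (forall j, tnth t j \in `[a, b]) ->
  ((((b - a) ^+ n)^-1 / n.+1%:R ^+ (2 ^ L))%:E <= prior_pred t)%E.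
Proof.
move=> tab; rewrite prior_pred_prod//.
under eq_bigr do rewrite integral_split_lik.
rewrite prodEFin -EFinM lee_fin.
have cE j : (j < N)%N -> (left_count t j + right_count t j)%N =
    node_count L (leaves t) (heap_level j) (heap_pos j).
  by move=> jN; rewrite node_countD//; exact: heap_level_lt.
have half : \prod_(j < N) (2^-1 ^+ left_count t j * (1 - 2^-1) ^+ right_count t j) =
    ((2 ^+ L)^-1) ^+ n :> R.
  rewrite -(prod_heap (fun l i => 2^-1 ^+ node_count L (leaves t) l.+1 i.*2 *
     (1 - 2^-1 : R) ^+ node_count L (leaves t) l.+1 i.*2.+1)).
  rewrite -(prod_polya_mass (leaves_lt t) (fun _ _ => 2^-1) (leqnn L)).
  under eq_bigr do rewrite polya_mass_half.
  by rewrite prodr_const card_ord.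
apply: (@le_trans _ _ ((2 ^+ L / (b - a)) ^+ n * \prod_(j < N)
   (n.+1%:R^-1 * (2^-1 ^+ left_count t j * (1 - 2^-1) ^+ right_count t j)))).
  rewrite big_split /= half mulrCA prodr_const card_ord -exprMn.
  rewrite [2 ^+ L / _]mulrC mulfK ?expf_neq0// exprVn exprVn mulrC ler_wpM2r//.
    by rewrite invr_ge0 exprn_ge0// ltW.
  by rewrite lef_pV2 ?posrE ?exprn_gt0// ler_weXn2l ?leq_pred// ler1n.
rewrite ler_wpM2l ?exprn_ge0//; first by rewrite divr_ge0 ?exprn_ge0// ltW.
apply: ler_prod => j _; have h2 : (1 - 2^-1 : R) = 2^-1 by lra.
rewrite mulr_ge0 ?mulr_ge0 ?exprn_ge0 ?invr_ge0 ?h2//=.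
have := @integral_split_lik_ge R (left_count t j) (right_count t j).
rewrite integral_split_lik lee_fin; apply: le_trans.
rewrite invfM ?h2 -exprD exprVn ler_wpM2r ?invr_ge0 ?exprn_ge0//.
rewrite lef_pV2 ?posrE// ler_nat ltnS cE; last exact: ltn_ord.
exact: count_le.
Qed.

(** Given the coefficients, the splits are independent with the Beta laws of
their two counts, so a deviation of one of them has the tail of that law. *)
Lemma prior_joint_split_tail t (j0 : 'I_N) (eta : R) :
  (forall j, tnth t j \in `[a, b]) -> 0 <= eta ->
  (0 < left_count t j0)%N -> (0 < right_count t j0)%N ->
  forall c, c = (left_count t j0 + right_count t j0)%N ->
  (\int[splits_law R L]_v (prior_joint v t *
      \1_[set x : R | (eta < `|x - (left_count t j0)%:R / c%:R|)%R] (tnth v j0))%:E <=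
   (c.+1%:R * expR (- c%:R * eta ^+ 2 / 4))%:E * prior_pred t)%E.
Proof.
move=> tab eta0 p0 q0 c cE.
set D := [set x : R | (eta < `|x - (left_count t j0)%:R / c%:R|)%R].
have mD : measurable (D : set (measurableTypeR R)).
  rewrite /D -[X in measurable X]setTI -preimage_true.
  apply: measurable_fun_ltr => //; apply: measurableT_comp => //.
  exact: measurable_funB.
pose f (j : 'I_N) (x : measurableTypeR R) :=
  split_lik (left_count t j) (right_count t j) x *
    (if j == j0 then \1_D x else 1).
have f0 j x : 0 <= f j x by rewrite mulr_ge0 ?split_lik_ge0//; case: ifP.
have mf j : measurable_fun setT (f j).
  apply: measurable_funM; first exact: measurable_split_lik.
  by case: (j == j0); [exact: measurable_indic|exact: measurable_cst].
have cn0 : 0 <= (2 ^+ L / (b - a)) ^+ n by rewrite exprn_ge0// divr_ge0 ?exprn_ge0// ltW.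
have -> : (\int[splits_law R L]_v (prior_joint v t * \1_D (tnth v j0))%:E =
    ((2 ^+ L / (b - a)) ^+ n)%:E * \int[splits_law R L]_v
      (\prod_(j < N) f j (tnth v j))%:E)%E.
  rewrite -ge0_integralZl//; last 2 first.
  - apply/measurable_EFinP; apply: measurable_prod => j _.
    apply: (@measurableT_comp _ _ _ _ _ _ (f j)) => //; exact: measurable_tnth.
  - by move=> v _; rewrite lee_fin prodr_ge0.
  apply: eq_integral => v _; rewrite -EFinM prior_joint_prod//.
  rewrite -mulrA; congr (_ * _)%:E; rewrite [RHS]big_split /=; congr (_ * _).
  by rewrite (bigD1 j0)//= eqxx big1 ?mulr1// => j /negbTE ->.
rewrite (@integral_mpow_prod _ (measurableTypeR R) R (beta_prob 1 1) N f)//.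
rewrite prior_pred_prod// muleCA lee_wpmul2l ?lee_fin//.
rewrite (bigD1 j0)//= [in leRHS](bigD1 j0)//= muleA.
rewrite (eq_bigr (fun j : 'I_N => \int[beta_prob 1 1]_x
    (split_lik (left_count t j) (right_count t j) x)%:E)%E); last first.
  move=> j /negbTE jj; apply: eq_integral => x _.
  by rewrite /f jj mulr1.
rewrite lee_wpmul2r//.
  apply: (@big_ind _ (fun x : \bar R => (0 <= x)%E)) => // [x y x0 y0|j _].
    exact: mule_ge0.
  by apply: integral_ge0 => x _; rewrite lee_fin split_lik_ge0.
by rewrite /f eqxx /D cE; exact: integral_split_lik_tail.
Qed.

End prior_predictive.

(** * Bayes' formula *)

Section posterior_bounds.
Context {R : realType}.
Variables (a b : R) (L n m : nat) (sigma : R) (X : 'M[R]_(m, n)).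
Hypotheses (ab : a < b) (sigma0 : 0 < sigma).
Let sigman0 : sigma != 0. Proof. by rewrite gt_eqF. Qed.

Local Notation N := (2 ^ L).-1.
Local Notation splitsT := (N.-tuple (measurableTypeR R)).
Local Notation obsT := (n.-tuple (measurableTypeR R)).
Local Notation respT := (m.-tuple (measurableTypeR R)).
Local Notation g v := (polya_density a b L (splits v)).
Local Notation phi t y := (response_pdf sigma X t y).
Local Notation joint := (@prior_joint R a b L n).
Local Notation pdf := (@prior_pdf R a b L n).

Lemma measurable_lin_pred i : measurable_fun setT (fun t : obsT => lin_pred X t i).
Proof.
apply: measurable_sum => j; apply: measurable_funM => //; exact: measurable_tnth.
Qed.

Lemma response_pdf_ge0 t y : 0 <= phi t y.
Proof. exact: noise_pdf_ge0. Qed.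

Lemma measurable_response_pdf2 :
  measurable_fun setT (fun ty : obsT * respT => phi ty.1 ty.2).
Proof.
rewrite /response_pdf; under eq_fun do under eq_bigr do rewrite normal_pdf_shift//.
apply: measurable_prod => i _.
apply: (@measurableT_comp _ _ _ _ _ _ (normal_pdf 0 sigma)).
  exact: measurable_normal_pdf.
apply: measurable_funB.
  exact: (measurableT_comp (measurable_tnth i) measurable_snd).
exact: (measurableT_comp (measurable_lin_pred i) measurable_fst).
Qed.

Lemma measurable_response_pdfl (y : respT) :
  measurable_fun setT (fun t : obsT => phi t y).
Proof. exact: (measurableT_comp measurable_response_pdf2 (measurable_pair2 y)). Qed.

Lemma measurable_response_pdfr (t : obsT) :
  measurable_fun setT (fun y : respT => phi t y).
Proof. exact: (measurableT_comp measurable_response_pdf2 (measurable_pair1 t)). Qed.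

Definition restricted_pred (A : set splitsT) (t : obsT) : \bar R :=
  (\int[splits_law R L]_v (joint v t * \1_A v)%:E)%E.

(** The marginal likelihood with the splits cut off outside of [0, 1]; unlike
the original, it is nonnegative for all values of the splits. *)
Let clipped_marginal (v : splitsT) (y : respT) : \bar R :=
  (\int[lebesgue_pow R n]_t (joint v t * phi t y)%:E)%E.

Let clipped_ge0 v y : (0 <= clipped_marginal v y)%E.
Proof.
by apply: integral_ge0 => t _; rewrite lee_fin mulr_ge0 ?prior_joint_ge0 ?response_pdf_ge0.
Qed.

Let clippedE v y : prior_cube v ->
  marginal_likelihood sigma X y (g v) = clipped_marginal v y.
Proof.
move=> hv; apply: eq_integral => t _.
by rewrite /prior_joint cube_indicE indicE mem_set// mulr1.
Qed.

Let integral_marginal (D : set splitsT) y :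
  (\int[splits_law R L]_(v in D) marginal_likelihood sigma X y (g v) =
   \int[splits_law R L]_v (clipped_marginal v y * (\1_D v)%:E))%E.
Proof.
rewrite integral_mkcond.
apply: (@eq_integral_off_null _ _ _ (splits_law R L) (~` (@prior_cube R L))).
- by apply: measurableC; exact: measurable_prior_cube.
- exact: prior_cube_ae.
move=> v /contrapT hv; rewrite patchE indicE.
by case: (boolP (v \in D)) => _; rewrite ?mule1 ?mule0// clippedE.
Qed.

Let fubini_clipped (A : set splitsT) y : measurable A ->
  (\int[splits_law R L]_v (clipped_marginal v y * (\1_A v)%:E) =
   \int[lebesgue_pow R n]_t ((phi t y)%:E * restricted_pred A t))%E.
Proof.
move=> mA.
pose F (vt : splitsT * obsT) := joint vt.1 vt.2 * phi vt.2 y * \1_A vt.1.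
have F0 vt : 0 <= F vt.
  by rewrite mulr_ge0 // mulr_ge0 ?prior_joint_ge0 ?response_pdf_ge0.
have mJ : measurable_fun setT (fun vt : splitsT * obsT => joint vt.1 vt.2).
  exact: measurable_prior_joint.
have mF : measurable_fun setT F.
  apply: measurable_funM.
    apply: measurable_funM => //.
    exact: (measurableT_comp (measurable_response_pdfl y) measurable_snd).
  have mi : measurable_fun setT (\1_A : splitsT -> R) by exact: measurable_indic.
  exact: (measurableT_comp mi measurable_fst).
have := @fubini_tonelli _ _ _ _ _ (splits_law R L) (lebesgue_pow R n) (EFin \o F).
move=> /(_ (proj2 (measurable_EFinP _ _) mF) F0) => FT.
transitivity (\int[splits_law R L]_v \int[lebesgue_pow R n]_t (F (v, t))%:E)%E.
  apply: eq_integral => v _; rewrite /F /=.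
  under [RHS]eq_integral do rewrite EFinM.
  rewrite ge0_integralZr//.
  - apply/measurable_EFinP; apply: measurable_funM.
      exact: (measurableT_comp mJ (measurable_pair1 v)).
    exact: measurable_response_pdfl.
  - by move=> t _; rewrite lee_fin mulr_ge0 ?prior_joint_ge0 ?response_pdf_ge0.
rewrite FT; apply: eq_integral => t _; rewrite /restricted_pred -ge0_integralZl//.
- by apply: eq_integral => v _; rewrite /F /= -EFinM; congr _%:E; ring.
- apply/measurable_EFinP; apply: measurable_funM.
    exact: (measurableT_comp mJ (measurable_pair2 t)).
  exact: measurable_indic.
- by move=> v _; rewrite lee_fin mulr_ge0 ?prior_joint_ge0.
- by rewrite lee_fin response_pdf_ge0.
Qed.

Definition evidence (y : respT) : \bar R :=
  (\int[lebesgue_pow R n]_t (phi t y * pdf t)%:E)%E.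

Lemma evidence_ge0 y : (0 <= evidence y)%E.
Proof.
by apply: integral_ge0 => t _; rewrite lee_fin mulr_ge0 ?response_pdf_ge0 ?prior_pdf_ge0.
Qed.

Lemma integral_marginal_likelihood y :
  (\int[splits_law R L]_v marginal_likelihood sigma X y (g v) = evidence y)%E.
Proof.
rewrite integral_marginal fubini_clipped//; apply: eq_integral => t _.
rewrite [RHS]EFinM -prior_predE//; congr (_ * _)%E; apply: eq_integral => v _.
by rewrite indicT /= mulr1.
Qed.

Lemma posterior_ge0 y A : 0 <= posterior a b sigma L X y A.
Proof.
rewrite /posterior integral_marginal divr_ge0// fine_ge0//.
  by apply: integral_ge0 => v _; rewrite mule_ge0// lee_fin.
by rewrite integral_marginal_likelihood evidence_ge0.
Qed.

Lemma posterior_le1 y A : posterior a b sigma L X y A <= 1.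
Proof.
rewrite /posterior !integral_marginal; set D := [set v | _].
set num := integral _ _ _; set den := integral _ _ _.
have num0 : (0 <= num)%E.
  by apply: integral_ge0 => v _; rewrite mule_ge0// lee_fin.
have nd : (num <= den)%E.
  apply: ge0_le_integral_nm => v; first by rewrite mule_ge0// lee_fin.
  by rewrite lee_wpmul2l// lee_fin indicT /= indicE lern1; case: (v \in D).
move: den num num0 nd => [d||] [u||] //=; rewrite ?invr0 ?mulr0//.
rewrite !lee_fin => u0 ud; have [->|d0] := eqVneq d 0; first by rewrite invr0 mulr0.
by rewrite ler_pdivrMr ?mul1r// lt_neqAle eq_sym d0 (le_trans u0 ud).
Qed.

(** An inequality rather than an equality, because the evidence could be 0 or
infinite at some [y]. *)
Lemma evidence_normalized y : (evidence y * (fine (evidence y))^-1%:E <= 1)%E.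
Proof.
have := evidence_ge0 y; case: (evidence y) => [z||] //=; last first.
  by rewrite invr0 mule0.
rewrite lee_fin => z0; rewrite -EFinM lee_fin.
by have [->|h] := eqVneq z 0; rewrite ?mul0r// divff.
Qed.

(** Bayes' formula as an upper bound, with the order of integration between
the splits and the coefficients exchanged.  The event [A] on densities need
not be measurable as long as it is covered by a measurable event on splits. *)
Lemma posterior_le y (A : set (R -> R)) (A' : set splitsT) : measurable A' ->
  (forall v, prior_cube v -> A (g v) -> A' v) ->
  ((posterior a b sigma L X y A)%:E <=
   \int[lebesgue_pow R n]_t ((phi t y)%:E * restricted_pred A' t) *
   (fine (evidence y))^-1%:E)%E.
Proof.
move=> mA' AA'; rewrite /posterior integral_marginal_likelihood EFinM.
rewrite lee_wpmul2r//.
  by rewrite lee_fin invr_ge0 fine_ge0// evidence_ge0.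
rewrite -fubini_clipped// integral_marginal; set I := integral _ _ _.
have I0 : (0 <= I)%E.
  by apply: integral_ge0 => v _; rewrite mule_ge0// lee_fin.
have : (I <= \int[splits_law R L]_v (clipped_marginal v y * (\1_A' v)%:E))%E.
  apply: (@ge0_le_integral_off_null _ _ _ (splits_law R L) (~` (@prior_cube R L))).
  - by apply: measurableC; exact: measurable_prior_cube.
  - exact: prior_cube_ae.
  - by move=> v; rewrite mule_ge0// lee_fin.
  - by move=> v; rewrite mule_ge0// lee_fin.
  move=> v /contrapT hv; rewrite lee_wpmul2l// lee_fin !indicE.
  case: (boolP (v \in _)) => //; rewrite inE /= => /(AA' v hv) h.
  by rewrite mem_set.
apply: le_trans.
by move: I0; case: I => //= r; rewrite lee_fin.
Qed.

End posterior_bounds.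

(** * From the prior to the truth *)

Section change_of_measure.
Context {R : realType}.
Variables (a b : R) (L n m : nat) (sigma : R) (X : 'M[R]_(m, n)).
Hypotheses (ab : a < b) (sigma0 : 0 < sigma).

Local Notation N := (2 ^ L).-1.
Local Notation splitsT := (N.-tuple (measurableTypeR R)).
Local Notation obsT := (n.-tuple (measurableTypeR R)).
Local Notation respT := (m.-tuple (measurableTypeR R)).
Local Notation g v := (polya_density a b L (splits v)).
Local Notation phi t y := (response_pdf sigma X t y).
Local Notation pdf := (@prior_pdf R a b L n).

Variable (p : nat) (U : 'M[R]_(m, p)).
Hypothesis hU : forall z : 'I_p -> R,
  \sum_(i < m) (\sum_(j < p) U i j * z j) ^+ 2 <= \sum_(j < p) z j ^+ 2.

(** The factor [1 / 4] is below the threshold [1 / 2] for the exponential moment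
of a squared standard normal variable to be finite. *)
Definition residual_weight (t : obsT) (y : respT) : R :=
  expR (\sum_(j < p) (\sum_(i < m) U i j * (tnth y i - lin_pred X t i)) ^+ 2
        / (4 * sigma ^+ 2)).
Local Notation W := residual_weight.

Let mphi := measurable_response_pdf2 X sigma0.

Lemma measurable_residual_weight :
  measurable_fun setT (fun ty : obsT * respT => W ty.1 ty.2).
Proof.
apply: measurableT_comp => //; apply: measurable_sum => j.
apply: measurable_funM => //; apply: measurable_funX; apply: measurable_sum => i.
apply: measurable_funM => //; apply: measurable_funB.
  exact: (measurableT_comp (measurable_tnth i) measurable_snd).
exact: (measurableT_comp (measurable_lin_pred X i) measurable_fst).
Qed.

Lemma integral_residual_weight (t : obsT) :
  (\int[lebesgue_pow R m]_y (phi t y * W t y)%:E <= (Num.sqrt 2 ^+ p : R)%:E)%E.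
Proof. exact: integral_projected_noise. Qed.

Lemma W_ge0 t y : 0 <= W t y. Proof. exact: expR_ge0. Qed.

Let h (y : respT) : \bar R :=
  (\int[lebesgue_pow R n]_t (phi t y * pdf t * W t y)%:E)%E.
Let r (y : respT) : R := (fine (evidence a b L sigma X y))^-1.

Let r0 y : 0 <= r y.
Proof. by rewrite invr_ge0 fine_ge0// evidence_ge0. Qed.

Let h0 y : (0 <= h y)%E.
Proof.
apply: integral_ge0 => t _; rewrite lee_fin mulr_ge0 ?W_ge0//.
by rewrite mulr_ge0 ?response_pdf_ge0 ?prior_pdf_ge0.
Qed.

Let mpdf : measurable_fun setT pdf := @measurable_prior_pdf R a b L n ab.

Let mZ_int : measurable_fun setT (fun ty : obsT * respT => phi ty.1 ty.2 * pdf ty.1).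
Proof.
apply: measurable_funM; first exact: mphi.
exact: (measurableT_comp mpdf measurable_fst).
Qed.

Let mh_int : measurable_fun setT
  (fun ty : obsT * respT => phi ty.1 ty.2 * pdf ty.1 * W ty.1 ty.2).
Proof. by apply: measurable_funM; [exact: mZ_int|exact: measurable_residual_weight]. Qed.

Let measurable_evidence : measurable_fun setT (evidence a b L sigma X).
Proof.
apply: (@measurable_fun_fubini_tonelli_G _ _ _ _ _ (lebesgue_pow R n)
  (fun ty : obsT * respT => (phi ty.1 ty.2 * pdf ty.1)%:E)).
  by apply/measurable_EFinP.
by move=> ty; rewrite lee_fin mulr_ge0 ?response_pdf_ge0 ?prior_pdf_ge0.
Qed.

Let mh : measurable_fun setT h.
Proof.
apply: (@measurable_fun_fubini_tonelli_G _ _ _ _ _ (lebesgue_pow R n)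
  (fun ty : obsT * respT => (phi ty.1 ty.2 * pdf ty.1 * W ty.1 ty.2)%:E)).
  by apply/measurable_EFinP.
move=> ty; rewrite lee_fin mulr_ge0 ?W_ge0//.
by rewrite mulr_ge0 ?response_pdf_ge0 ?prior_pdf_ge0.
Qed.

Let mr : measurable_fun setT r.
Proof.
rewrite (_ : r = fun y => fine (evidence a b L sigma X y) `^ (-1)); last first.
  by apply/funext => y; rewrite powR_inv1// fine_ge0// evidence_ge0.
apply: (measurableT_comp (measurable_powR (-1))).
by apply: measurableT_comp => //; exact: measurable_evidence.
Qed.

(** Under the prior, the coefficients that produced [y] and a posterior draw are
exchangeable, so the posterior average of the residual weight of a draw
integrates like the residual weight of the true coefficients. *)
Let exchange :
  (\int[lebesgue_pow R n]_t ((pdf t)%:E *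
     \int[lebesgue_pow R m]_y ((phi t y)%:E * ((r y)%:E * h y))) <=
   (Num.sqrt 2 ^+ p : R)%:E)%E.
Proof.
pose F (ty : obsT * respT) : \bar R :=
  ((phi ty.1 ty.2 * pdf ty.1)%:E * ((r ty.2)%:E * h ty.2))%E.
have F0 ty : (0 <= F ty)%E.
  rewrite mule_ge0 ?lee_fin ?mulr_ge0 ?response_pdf_ge0 ?prior_pdf_ge0//.
  by rewrite mule_ge0 ?lee_fin.
have mrh : measurable_fun setT (fun y => ((r y)%:E * h y)%E).
  by apply: emeasurable_funM => //; exact/measurable_EFinP.
have mF : measurable_fun setT F.
  apply: emeasurable_funM; first exact/measurable_EFinP.
  exact: (measurableT_comp mrh measurable_snd).
have -> : (\int[lebesgue_pow R n]_t ((pdf t)%:E *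
     \int[lebesgue_pow R m]_y ((phi t y)%:E * ((r y)%:E * h y))) =
   \int[lebesgue_pow R n]_t \int[lebesgue_pow R m]_y F (t, y))%E.
  apply: eq_integral => t _; rewrite -ge0_integralZl//; last 3 first.
  - apply: emeasurable_funM => //; apply/measurable_EFinP.
    exact: measurable_response_pdfr.
  - move=> y _; rewrite mule_ge0 ?lee_fin ?response_pdf_ge0//.
    by rewrite mule_ge0 ?lee_fin.
  - by rewrite lee_fin prior_pdf_ge0.
  apply: eq_integral => y _; rewrite /F /= EFinM muleA; congr (_ * _)%E.
  by rewrite muleC.
rewrite (@fubini_tonelli _ _ _ _ _ (lebesgue_pow R n) (lebesgue_pow R m) F)//.
apply: (@le_trans _ _ (\int[lebesgue_pow R m]_y h y)%E).
  apply: ge0_le_integral_nm => y.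
    by apply: integral_ge0 => t _; exact: F0.
  rewrite /F /= ge0_integralZr//; last 3 first.
  - apply/measurable_EFinP.
    exact: (measurableT_comp mZ_int (measurable_pair2 y)).
  - by move=> t _; rewrite lee_fin mulr_ge0 ?response_pdf_ge0 ?prior_pdf_ge0.
  - by rewrite mule_ge0 ?lee_fin.
  rewrite muleA -[leRHS]mul1e lee_wpmul2r//.
  exact: evidence_normalized.
rewrite -(@fubini_tonelli _ _ _ _ _ (lebesgue_pow R n) (lebesgue_pow R m)
  (fun ty : obsT * respT => (phi ty.1 ty.2 * pdf ty.1 * W ty.1 ty.2)%:E))/=; last 2 first.
- by apply/measurable_EFinP.
- move=> ty; rewrite lee_fin mulr_ge0 ?W_ge0//.
  by rewrite mulr_ge0 ?response_pdf_ge0 ?prior_pdf_ge0.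
set s : R := Num.sqrt 2 ^+ p.
apply: (@le_trans _ _ (\int[lebesgue_pow R n]_t (s%:E * (pdf t)%:E))%E).
  apply: ge0_le_integral_nm => t.
    apply: integral_ge0 => y _; rewrite lee_fin mulr_ge0 ?W_ge0//.
    by rewrite mulr_ge0 ?response_pdf_ge0 ?prior_pdf_ge0.
  under eq_integral do rewrite mulrAC EFinM.
  rewrite ge0_integralZr//; last 3 first.
  - apply/measurable_EFinP; apply: measurable_funM.
      exact: measurable_response_pdfr.
    exact: (measurableT_comp measurable_residual_weight (measurable_pair1 t)).
  - by move=> y _; rewrite lee_fin mulr_ge0 ?response_pdf_ge0 ?W_ge0.
  - by rewrite lee_fin prior_pdf_ge0.
  rewrite lee_wpmul2r ?lee_fin ?prior_pdf_ge0//.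
  exact: integral_residual_weight.
rewrite ge0_integralZl//; last 3 first.
- by apply/measurable_EFinP.
- by move=> t _; rewrite lee_fin prior_pdf_ge0.
- by rewrite lee_fin exprn_ge0.
rewrite -[leRHS]mule1 lee_wpmul2l ?lee_fin ?exprn_ge0//.
exact: integral_prior_pdf_le1.
Qed.

(** The true density [p0] of the coefficients is absolutely continuous with
respect to the prior predictive density, at cost [Rn]. *)
Variables (p0 : obsT -> R) (Rn : R).
Hypotheses (mp0 : measurable_fun setT p0) (p0_ge0 : forall t, 0 <= p0 t)
  (ip0 : (\int[lebesgue_pow R n]_t (p0 t)%:E = 1)%E)
  (p0_out : forall t, ~ (forall j, tnth t j \in `[a, b]) -> p0 t = 0)
  (Rn0 : 0 <= Rn) (p0_le : forall t, p0 t <= Rn * pdf t).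

Variables (A : set (R -> R)) (A' : set splitsT) (eta e : R) (S : obsT -> R).
Hypotheses (mA' : measurable A')
  (AA' : forall v, prior_cube v -> A (g v) -> A' v)
  (eta0 : 0 <= eta) (e0 : 0 <= e)
  (mS : measurable_fun setT S) (S0 : forall t, 0 <= S t).
(** [S t0 >= 1] marks the atypical true coefficients [t0].  For the others, the
event [A'] has small conditional probability given coefficients [t], unless
one of [t] and [t0] has a large residual. *)
Hypothesis key : forall t0 t y, (forall j, tnth t0 j \in `[a, b]) -> S t0 < 1 ->
  (restricted_pred a b A' t <= ((eta + e * (W t y + W t0 y)) * pdf t)%:E)%E.

Let posterior_pointwise t0 y : (forall j, tnth t0 j \in `[a, b]) ->
  ((posterior a b sigma L X y A)%:E <=
   (eta + S t0 + e * W t0 y)%:E + e%:E * ((r y)%:E * h y))%E.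
Proof.
move=> t0ab.
have erh : (0 <= e%:E * ((r y)%:E * h y))%E by rewrite !mule_ge0 ?lee_fin.
case: (leP 1 (S t0)) => [S1|S1].
  apply: le_trans (leeDl _ erh); rewrite lee_fin.
  apply: (@le_trans _ _ 1); first exact: posterior_le1.
  rewrite -[leLHS]addr0 lerD ?mulr_ge0 ?W_ge0//.
  by rewrite -[leLHS]add0r lerD.
apply: (le_trans (posterior_le X ab sigma0 y mA' AA')); rewrite -/(r y).
have Z0 : (0 <= evidence a b L sigma X y)%E by exact: evidence_ge0.
have : (\int[lebesgue_pow R n]_t ((phi t y)%:E * restricted_pred a b A' t) <=
  (eta + e * W t0 y)%:E * evidence a b L sigma X y + e%:E * h y)%E.
  have -> : ((eta + e * W t0 y)%:E * evidence a b L sigma X y + e%:E * h y =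
    \int[lebesgue_pow R n]_t ((eta + e * W t0 y)%:E * (phi t y * pdf t)%:E +
       e%:E * (phi t y * pdf t * W t y)%:E))%E.
    have c0 : 0 <= eta + e * W t0 y by rewrite addr_ge0 ?mulr_ge0 ?W_ge0.
    have m1 : measurable_fun setT (fun t : obsT => phi t y * pdf t).
      exact: (measurableT_comp mZ_int (measurable_pair2 y)).
    have m2 : measurable_fun setT (fun t : obsT => phi t y * pdf t * W t y).
      exact: (measurableT_comp mh_int (measurable_pair2 y)).
    have n1 t : 0 <= phi t y * pdf t by rewrite mulr_ge0 ?response_pdf_ge0 ?prior_pdf_ge0.
    have n2 t : 0 <= phi t y * pdf t * W t y by rewrite mulr_ge0 ?W_ge0.
    rewrite ge0_integralD//.
    - rewrite ge0_integralZl//; last 2 first.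
      + exact/measurable_EFinP.
      + by move=> t _; rewrite lee_fin.
      rewrite ge0_integralZl//; last 2 first.
      + exact/measurable_EFinP.
      + by move=> t _; rewrite lee_fin.
    - by move=> t _; rewrite mule_ge0 ?lee_fin.
    - by apply: measurable_funeM; exact/measurable_EFinP.
    - by move=> t _; rewrite mule_ge0 ?lee_fin.
    - by apply: measurable_funeM; exact/measurable_EFinP.
  apply: ge0_le_integral_nm => t.
    rewrite mule_ge0 ?lee_fin ?response_pdf_ge0//.
    by apply: integral_ge0 => v _; rewrite lee_fin mulr_ge0 ?prior_joint_ge0.
  apply: le_trans (lee_wpmul2l _ (key t y t0ab S1)) _.
    by rewrite lee_fin response_pdf_ge0.
  by rewrite -!EFinM -EFinD lee_fin le_eqVlt; apply/orP; left; apply/eqP; ring.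
move=> hle; apply: le_trans (lee_wpmul2r _ hle) _; first by rewrite lee_fin.
rewrite ge0_muleDl; last 2 first.
- by rewrite mule_ge0 ?lee_fin// addr_ge0 ?mulr_ge0 ?W_ge0.
- by rewrite mule_ge0 ?lee_fin.
apply: leeD; last by rewrite -muleA (muleC (h y)).
rewrite -muleA; apply: (@le_trans _ _ ((eta + e * W t0 y)%:E * 1)%E).
  rewrite lee_wpmul2l ?lee_fin ?addr_ge0 ?mulr_ge0 ?W_ge0//.
  exact: evidence_normalized.
by rewrite mule1 lee_fin lerD2r lerDl.
Qed.

(** The residual of the true coefficients is controlled under the true law,
and that of the posterior draws under the prior, at the price [Rn] of the
change of measure. *)
Lemma data_expectation_posterior_le :
  (\int[lebesgue_pow R n]_t ((p0 t)%:E *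
     \int[lebesgue_pow R m]_y (phi t y * posterior a b sigma L X y A)%:E) <=
   (eta + e * Num.sqrt 2 ^+ p * (1 + Rn))%:E +
   \int[lebesgue_pow R n]_t (p0 t * S t)%:E)%E.
Proof.
set s : R := Num.sqrt 2 ^+ p.
have s0 : 0 <= s by rewrite exprn_ge0.
pose K t := (\int[lebesgue_pow R m]_y ((phi t y)%:E * ((r y)%:E * h y)))%E.
have mrh : measurable_fun setT (fun y => ((r y)%:E * h y)%E).
  by apply: emeasurable_funM => //; exact/measurable_EFinP.
have rh0 y : (0 <= (r y)%:E * h y)%E by rewrite mule_ge0 ?lee_fin.
have K0 t : (0 <= K t)%E.
  by apply: integral_ge0 => y _; rewrite mule_ge0 ?lee_fin ?response_pdf_ge0.
have mK : measurable_fun setT K.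
  apply: (@measurable_fun_fubini_tonelli_F _ _ _ _ _ (lebesgue_pow R m)
    (fun ty : obsT * respT => ((phi ty.1 ty.2)%:E * ((r ty.2)%:E * h ty.2))%E)).
    apply: emeasurable_funM; first by apply/measurable_EFinP; exact: mphi.
    exact: (measurableT_comp mrh measurable_snd).
  by move=> ty; rewrite mule_ge0 ?lee_fin ?response_pdf_ge0.
have inner t : (forall j, tnth t j \in `[a, b]) ->
  (\int[lebesgue_pow R m]_y (phi t y * posterior a b sigma L X y A)%:E <=
   (eta + S t + e * s)%:E + e%:E * K t)%E.
  move=> tab.
  have mp := measurable_response_pdfr X sigma0 t.
  have mW : measurable_fun setT (W t).
    exact: (measurableT_comp measurable_residual_weight (measurable_pair1 t)).
  apply: (@le_trans _ _ (\int[lebesgue_pow R m]_y (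
     ((eta + S t)%:E * (phi t y)%:E + e%:E * (phi t y * W t y)%:E) +
     e%:E * ((phi t y)%:E * ((r y)%:E * h y))))%E).
    apply: ge0_le_integral_nm => y.
      by rewrite lee_fin mulr_ge0 ?response_pdf_ge0// posterior_ge0.
    rewrite EFinM; apply: le_trans (lee_wpmul2l _ (posterior_pointwise y tab)) _.
      by rewrite lee_fin response_pdf_ge0.
    rewrite ge0_muleDr; last 2 first.
    - by rewrite lee_fin !addr_ge0 ?mulr_ge0 ?W_ge0.
    - by rewrite mule_ge0 ?lee_fin.
    rewrite muleCA leeD2r// -!EFinM -EFinD lee_fin le_eqVlt.
    by apply/orP; left; apply/eqP; ring.
  have ES0 : 0 <= eta + S t by rewrite addr_ge0.
  have q1 y : (0 <= (eta + S t)%:E * (phi t y)%:E)%E.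
    by rewrite mule_ge0 ?lee_fin ?response_pdf_ge0.
  have q2 y : (0 <= e%:E * (phi t y * W t y)%:E)%E.
    by rewrite mule_ge0 ?lee_fin ?mulr_ge0 ?response_pdf_ge0 ?W_ge0.
  have q3 y : (0 <= e%:E * ((phi t y)%:E * ((r y)%:E * h y)))%E.
    by rewrite !mule_ge0 ?lee_fin ?response_pdf_ge0.
  have n1 : measurable_fun setT (fun y : respT => ((eta + S t)%:E * (phi t y)%:E)%E).
    by apply: measurable_funeM; exact/measurable_EFinP.
  have n2 : measurable_fun setT (fun y : respT => (e%:E * (phi t y * W t y)%:E)%E).
    by apply: measurable_funeM; apply/measurable_EFinP; exact: measurable_funM.
  have n3' : measurable_fun setT (fun y : respT => ((phi t y)%:E * ((r y)%:E * h y))%E).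
    by apply: emeasurable_funM => //; exact/measurable_EFinP.
  have n3 : measurable_fun setT
      (fun y : respT => (e%:E * ((phi t y)%:E * ((r y)%:E * h y)))%E).
    exact: measurable_funeM.
  rewrite ge0_integralD//; last 2 first.
  - by move=> y _; rewrite adde_ge0.
  - exact: emeasurable_funD.
  rewrite ge0_integralD// [(_ + e * s)%:E]EFinD; apply: leeD; last first.
    rewrite ge0_integralZl// => y _.
    by rewrite mule_ge0 ?lee_fin ?response_pdf_ge0.
  apply: leeD.
    rewrite ge0_integralZl//; last 2 first.
    + exact/measurable_EFinP.
    + by move=> y _; rewrite lee_fin response_pdf_ge0.
    by rewrite [X in (_ * X)%E]integral_noise_pdf// mule1.
  rewrite ge0_integralZl//; last 2 first.
  + by apply/measurable_EFinP; exact: measurable_funM.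
  + by move=> y _; rewrite lee_fin mulr_ge0 ?response_pdf_ge0 ?W_ge0.
  rewrite EFinM lee_wpmul2l ?lee_fin//; exact: integral_residual_weight.
apply: (@le_trans _ _ (\int[lebesgue_pow R n]_t (
    ((eta + e * s)%:E * (p0 t)%:E + (p0 t * S t)%:E) +
    (e * Rn)%:E * ((pdf t)%:E * K t)))%E).
  apply: ge0_le_integral_nm => t.
    rewrite mule_ge0 ?lee_fin//; apply: integral_ge0 => y _.
    by rewrite lee_fin mulr_ge0 ?response_pdf_ge0// posterior_ge0.
  have last0 : (0 <= (e * Rn)%:E * ((pdf t)%:E * K t))%E.
    by rewrite !mule_ge0 ?lee_fin ?mulr_ge0 ?prior_pdf_ge0.
  have [tab|tab] := pselect (forall j, tnth t j \in `[a, b]); last first.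
    by rewrite p0_out// mul0e mule0 mul0r !add0e.
  apply: le_trans (lee_wpmul2l _ (inner t tab)) _; first by rewrite lee_fin.
  rewrite ge0_muleDr; last 2 first.
  - by rewrite lee_fin !addr_ge0 ?mulr_ge0.
  - by rewrite mule_ge0 ?lee_fin.
  apply: leeD.
    rewrite -!EFinM -EFinD lee_fin le_eqVlt.
    by apply/orP; left; apply/eqP; ring.
  rewrite muleCA EFinM -muleA lee_wpmul2l ?lee_fin// muleA -EFinM.
  by rewrite lee_wpmul2r// lee_fin.
have q1 t : (0 <= (eta + e * s)%:E * (p0 t)%:E)%E.
  by rewrite mule_ge0 ?lee_fin// addr_ge0 ?mulr_ge0.
have q2 t : (0 <= (p0 t * S t)%:E)%E by rewrite lee_fin mulr_ge0.
have q3 t : (0 <= (pdf t)%:E * K t)%E by rewrite mule_ge0 ?lee_fin ?prior_pdf_ge0.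
have n1 : measurable_fun setT (fun t : obsT => ((eta + e * s)%:E * (p0 t)%:E)%E).
  by apply: measurable_funeM; exact/measurable_EFinP.
have n2 : measurable_fun setT (fun t : obsT => (p0 t * S t)%:E).
  by apply/measurable_EFinP; exact: measurable_funM.
have n3 : measurable_fun setT (fun t : obsT => ((pdf t)%:E * K t)%E).
  by apply: emeasurable_funM => //; exact/measurable_EFinP.
rewrite ge0_integralD//; last 4 first.
- by move=> t _; rewrite adde_ge0.
- exact: emeasurable_funD.
- by move=> t _; rewrite mule_ge0 ?lee_fin ?mulr_ge0.
- exact: measurable_funeM.
rewrite ge0_integralD// ge0_integralZl//; last 3 first.
- exact/measurable_EFinP.
- by move=> t _; rewrite lee_fin.
- by rewrite lee_fin addr_ge0 ?mulr_ge0.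
rewrite ip0 mule1 ge0_integralZl ?lee_fin ?mulr_ge0//.
rewrite addeAC leeD2r//.
apply: (@le_trans _ _ ((eta + e * s)%:E + (e * Rn)%:E * s%:E)%E).
  by rewrite leeD2l// lee_wpmul2l ?lee_fin ?mulr_ge0//; exact: exchange.
by rewrite -EFinM -EFinD lee_fin le_eqVlt; apply/orP; left; apply/eqP; ring.
Qed.

End change_of_measure.

(** * Masses and counts under the true density *)

Lemma integral_cst_indic {R : realType} (c : R) (J : set R) :
  0 <= c -> measurable J ->
  (\int[lebesgue_measure]_x (c * \1_J x)%:E = c%:E * lebesgue_measure J)%E.
Proof.
move=> c0 mJ; under eq_integral do rewrite EFinM.
rewrite ge0_integralZl//.
- by rewrite integral_indic// setIT.
- by apply/measurable_EFinP; apply: measurable_indic.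
Qed.

Section true_density.
Context {R : realType}.
Variables (a b m0 M0 : R) (g0 : R -> R).
Hypotheses (ab : a < b) (dg0 : density_on a b g0).
Hypothesis g0b : forall x, x \in `[a, b] -> m0 <= g0 x <= M0.
Hypotheses (m0_gt0 : 0 < m0) (mM : m0 <= M0).

Let mg0 : measurable_fun [set: R] g0. Proof. by case: dg0. Qed.
Let g00 x : 0 <= g0 x. Proof. by case: dg0. Qed.
Let g0out x : x \notin `[a, b] -> g0 x = 0. Proof. by case: dg0 => _ _ h _; exact: h. Qed.
Let ig0 : (\int[lebesgue_measure]_x (g0 x)%:E = 1)%E. Proof. by case: dg0. Qed.

Lemma density_le x : g0 x <= M0.
Proof.
case: (boolP (x \in `[a, b])) => [/g0b /andP[]//|/g0out ->].
by rewrite (le_trans (ltW m0_gt0)).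
Qed.

Definition true_mass (J : set R) : R :=
  fine (\int[lebesgue_measure]_x (g0 x * \1_J x)%:E).

Let mind (J : set R) : measurable J ->
  measurable_fun [set: R] (fun x => (g0 x * \1_J x)%:E).
Proof.
move=> mJ; apply/measurable_EFinP; apply: measurable_funM => //.
Qed.

Lemma true_massE J :
  (\int[lebesgue_measure]_x (g0 x * \1_J x)%:E = (true_mass J)%:E)%E.
Proof.
rewrite fineK// ge0_fin_numE; last first.
  by apply: integral_ge0 => x _; rewrite lee_fin mulr_ge0.
apply: (@le_lt_trans _ _ 1%E); last by rewrite ltry.
rewrite -ig0; apply: ge0_le_integral_nm => x; first by rewrite lee_fin mulr_ge0.
by rewrite lee_fin indicE; case: (x \in J); rewrite ?mulr1 ?mulr0.
Qed.

Lemma true_mass_ge0 J : 0 <= true_mass J.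
Proof.
by rewrite fine_ge0//; apply: integral_ge0 => x _; rewrite lee_fin mulr_ge0.
Qed.

Lemma true_massC J : measurable J -> true_mass J + true_mass (~` J) = 1.
Proof.
move=> mJ; apply: EFin_inj; rewrite EFinD -!true_massE -ge0_integralD//.
- rewrite -ig0; apply: eq_integral => x _; rewrite -EFinD -mulrDr.
  by rewrite !indicE in_setC; case: (x \in J) => /=; rewrite ?addr0 ?add0r mulr1.
- by move=> x _; rewrite lee_fin mulr_ge0.
- exact: mind.
- by move=> x _; rewrite lee_fin mulr_ge0.
- by apply: mind; exact: measurableC.
Qed.

Lemma le_true_mass (J K : set R) : J `<=` K -> true_mass J <= true_mass K.
Proof.
move=> JK; rewrite -lee_fin -!true_massE; apply: ge0_le_integral_nm => x.
  by rewrite lee_fin mulr_ge0.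
rewrite lee_fin ler_wpM2l// !indicE; case: (boolP (x \in J)) => //.
by rewrite inE => /JK h; rewrite mem_set.
Qed.

Lemma true_massU (J K : set R) : measurable J -> measurable K ->
  true_mass (J `|` K) <= true_mass J + true_mass K.
Proof.
move=> mJ mK; rewrite -lee_fin EFinD -!true_massE -ge0_integralD//.
- apply: ge0_le_integral_nm => x; first by rewrite lee_fin mulr_ge0.
  rewrite -EFinD lee_fin -mulrDr ler_wpM2l// !indicE in_setU.
  by case: (x \in J); case: (x \in K); rewrite /= ?addr0 ?add0r// -natrD ler_nat.
- by move=> x _; rewrite lee_fin mulr_ge0.
- exact: mind.
- by move=> x _; rewrite lee_fin mulr_ge0.
- exact: mind.
Qed.

Lemma true_mass_itv (c l : R) : 0 <= l -> true_mass `[c, c + l] <= M0 * l.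
Proof.
move=> l0; rewrite -lee_fin -true_massE.
apply: (@le_trans _ _ (\int[lebesgue_measure]_x (M0 * \1_(`[c, c + l]%classic) x)%:E)%E).
  apply: ge0_le_integral_nm => x; first by rewrite lee_fin mulr_ge0.
  by rewrite lee_fin ler_wpM2r// density_le.
have M00 : 0 <= M0 by rewrite (le_trans (ltW m0_gt0)).
rewrite integral_cst_indic// EFinM lee_wpmul2l ?lee_fin//.
rewrite lebesgue_measure_itv /= lte_fin; case: ifP => _; last by rewrite lee_fin.
by rewrite -EFinD lee_fin addrAC subrr add0r.
Qed.

Section dyadic_mass.
Variables (L : nat) (k : nat).
Hypothesis kL : (k < 2 ^ L)%N.
Let c := bin_edge a b L k.

Lemma dyadic_mass_avg (x y : R) : (forall z, dyadic a b L k z -> x <= g0 z <= y) ->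
  x * ((b - a) / 2 ^+ L) <= true_mass (dyadic a b L k) <= y * ((b - a) / 2 ^+ L).
Proof.
move=> hz.
have [t It] : exists t, dyadic a b L k t.
  exists c; apply: dyadic_of_lt => //; rewrite lexx /= bin_edgeS ltrDl.
  by rewrite divr_gt0 ?exprn_gt0// subr_gt0.
have y0 : 0 <= y by have /andP[_] := hz t It; apply: le_trans.
have md : measurable (dyadic a b L k) by exact (@measurable_dyadic R a b L k).
have E (z : R) : 0 <= z ->
    (\int[lebesgue_measure]_s (z * \1_(dyadic a b L k) s)%:E =
     (z * ((b - a) / 2 ^+ L))%:E)%E.
  by move=> z0; rewrite integral_cst_indic// [X in (_ * X)%E]lebesgue_dyadic.
apply/andP; split.
  have [x0|x0] := leP 0 x; last first.
    by apply: le_trans (true_mass_ge0 _); rewrite nmulr_rle0//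
      divr_ge0 ?exprn_ge0// subr_ge0 ltW.
  rewrite -lee_fin -(E x x0) -true_massE; apply: ge0_le_integral_nm => s.
    by rewrite lee_fin mulr_ge0.
  rewrite lee_fin indicE; case: (boolP (s \in _)); last by rewrite !mulr0.
  by rewrite inE => /hz /andP[h _]; rewrite !mulr1.
rewrite -lee_fin -(E y y0) -true_massE; apply: ge0_le_integral_nm => s.
  by rewrite lee_fin mulr_ge0.
rewrite lee_fin indicE; case: (boolP (s \in _)); last by rewrite !mulr0.
by rewrite inE => /hz /andP[_ h]; rewrite !mulr1.
Qed.

Lemma dyadic_mass_bounds :
  m0 * ((b - a) / 2 ^+ L) <= true_mass (dyadic a b L k) <= M0 * ((b - a) / 2 ^+ L).
Proof.
apply: dyadic_mass_avg => z /(dyadic_subset ab kL); exact: g0b.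
Qed.

Definition outer_bin (r : R) : set R :=
  `[bin_edge a b L k - r, bin_edge a b L k.+1 + r]%classic.
Definition inner_bin (r : R) : set R :=
  `[bin_edge a b L k + r, bin_edge a b L k.+1 - r[%classic.

Lemma outer_bin_mass r : 0 <= r ->
  true_mass (outer_bin r) <= true_mass (dyadic a b L k) + 2 * M0 * r.
Proof.
move=> r0; set d := bin_edge a b L k.+1.
have md : measurable (dyadic a b L k) by exact (@measurable_dyadic R a b L k).
apply: (@le_trans _ _ (true_mass ((dyadic a b L k `|`
    `[c - r, (c - r) + r]%classic) `|` `[d, d + r]%classic))).
  apply: le_true_mass => x; rewrite /outer_bin /= in_itv /= => /andP[x1 x2].
  have [h1|h1] := leP c x; last first.
    by left; right; rewrite /= in_itv /= subrK (ltW h1) andbT.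
  have [h2|h2] := ltP x d; last by right; rewrite /= in_itv /=; apply/andP.
  by left; left; apply: dyadic_of_lt => //; apply/andP.
have h1 := true_massU (measurableU _ _ md (measurable_itv `[c - r, c - r + r]))
  (measurable_itv `[d, d + r]).
have h2 := true_massU md (measurable_itv `[c - r, c - r + r]).
apply: (le_trans h1); apply: (le_trans (lerD h2 (true_mass_itv d r0))).
have := true_mass_itv (c - r) r0; lra.
Qed.

Lemma inner_bin_mass r : 0 <= r ->
  true_mass (dyadic a b L k) - 2 * M0 * r <= true_mass (inner_bin r).
Proof.
move=> r0; set d := bin_edge a b L k.+1.
rewrite lerBlDr.
apply: (@le_trans _ _ (true_mass ((inner_bin r `|`
    `[c, c + r]%classic) `|` `[d - r, (d - r) + r]%classic))).
  apply: le_true_mass => x /dyadic_le /andP[x1 x2].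
  have [h1|h1] := leP x (c + r); first by left; right; rewrite /= in_itv /=; apply/andP.
  have [h2|h2] := ltP x (d - r); last by right; rewrite /= in_itv /= h2 subrK.
  by left; left; rewrite /inner_bin /= in_itv /=; apply/andP; rewrite (ltW h1) h2.
have mi : measurable (inner_bin r) by exact: measurable_itv.
have h1 := true_massU (measurableU _ _ mi (measurable_itv `[c, c + r]))
  (measurable_itv `[d - r, d - r + r]).
have h2 := true_massU mi (measurable_itv `[c, c + r]).
apply: (le_trans h1); apply: (le_trans (lerD h2 (true_mass_itv _ r0))).
have := true_mass_itv c r0; lra.
Qed.

End dyadic_mass.

Section chernoff.
Variable n : nat.
Local Notation obsT := (n.-tuple (measurableTypeR R)).

Definition hits (J : set R) (t : obsT) : R := \sum_(j < n) \1_J (tnth t j).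

Lemma measurable_hits J : measurable J -> measurable_fun setT (hits J).
Proof.
move=> mJ; apply: measurable_sum => j; apply: measurable_indic_comp => //.
exact: measurable_tnth.
Qed.

Lemma measurable_iid_pdf : measurable_fun setT (fun t : obsT => iid_pdf g0 t).
Proof.
apply: measurable_prod => j _; apply: (measurableT_comp mg0).
exact: measurable_tnth.
Qed.

Lemma iid_pdf_ge0 (t : obsT) : 0 <= iid_pdf g0 t.
Proof. by apply: prodr_ge0 => j _. Qed.

Lemma integral_iid_pdf : (\int[lebesgue_pow R n]_t (iid_pdf g0 t)%:E = 1)%E.
Proof.
rewrite (@integral_mpow_prod _ (measurableTypeR R) R lebesgue_measure n (fun=> g0))//.
by rewrite big1// => j _; exact: ig0.
Qed.

(** The variance term carries the mass of [J] rather than 1, which is what makes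
the bound sharp enough for the small bins at the leaves. *)
Lemma chernoff (J : set R) (s : R) : measurable J -> s <= 2^-1 ->
  (\int[lebesgue_pow R n]_t
     (iid_pdf g0 t * expR (s * (hits J t - n%:R * true_mass J)))%:E <=
   (expR (2 * s ^+ 2 * (n%:R * true_mass J)))%:E)%E.
Proof.
move=> mJ s1; set q := true_mass J.
pose f (x : measurableTypeR R) := g0 x * expR (s * (\1_J x - q)).
have mf : measurable_fun setT f.
  apply: measurable_funM => //; apply: measurableT_comp => //.
  by apply: measurable_funM => //; apply: measurable_funB.
have f0 x : 0 <= f x by rewrite mulr_ge0 ?expR_ge0.
have -> : (\int[lebesgue_pow R n]_t
     (iid_pdf g0 t * expR (s * (hits J t - n%:R * q)))%:E =
     \prod_(j < n) \int[lebesgue_measure]_x (f x)%:E)%E.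
  rewrite -(@integral_mpow_prod _ (measurableTypeR R) R lebesgue_measure n (fun=> f))//.
  apply: eq_integral => t _; rewrite /f big_split /= -expR_sum; congr (_ * expR _)%:E.
  rewrite -mulr_sumr sumrB; congr (_ * (_ - _)).
  by rewrite sumr_const card_ord mulr_natl.
have If : (\int[lebesgue_measure]_x (f x)%:E =
    (expR (- (s * q)) * (1 + (expR s - 1) * q))%:E)%E.
  transitivity (\int[lebesgue_measure]_x
     ((expR (s * (1 - q)))%:E * (g0 x * \1_J x)%:E +
      (expR (- (s * q)))%:E * (g0 x * \1_(~` J) x)%:E))%E.
    apply: eq_integral => x _; rewrite -!EFinM -EFinD /f; congr _%:E.
    rewrite !indicE in_setC; case: (x \in J) => /=.
      by rewrite !mulr0 addr0 mulr1 mulrC.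
    by rewrite sub0r mulrN !mulr0 add0r mulr1 mulrC.
  rewrite ge0_integralD//; last 4 first.
  - by move=> x _; rewrite mule_ge0 ?lee_fin ?expR_ge0 ?mulr_ge0.
  - by apply: measurable_funeM; exact: mind.
  - by move=> x _; rewrite mule_ge0 ?lee_fin ?expR_ge0 ?mulr_ge0.
  - by apply: measurable_funeM; apply: mind; exact: measurableC.
  rewrite ge0_integralZl ?lee_fin ?expR_ge0//; last 2 first.
  - exact: mind.
  - by move=> x _; rewrite lee_fin mulr_ge0.
  rewrite ge0_integralZl ?lee_fin ?expR_ge0//; last 2 first.
  - by apply: mind; exact: measurableC.
  - by move=> x _; rewrite lee_fin mulr_ge0.
  rewrite !true_massE -!EFinM -EFinD; congr _%:E.
  have -> : true_mass (~` J) = 1 - q by rewrite -(true_massC mJ) addrC addKr.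
  by rewrite mulrBr mulr1 expRD -/q; ring.
have q0 : 0 <= q by exact: true_mass_ge0.
have le1 : expR (- (s * q)) * (1 + (expR s - 1) * q) <= expR (2 * s ^+ 2 * q).
  apply: (@le_trans _ _ (expR (- (s * q)) * expR ((expR s - 1) * q))).
    by rewrite ler_wpM2l ?expR_ge0// expR_ge1Dx.
  rewrite -expRD ler_expR.
  by have := ler_wpM2r q0 (expR_le_quad s1); lra.
under eq_bigr do rewrite If.
rewrite prodEFin lee_fin prodr_const card_ord [leRHS](_ : _ =
  expR (2 * s ^+ 2 * q) ^+ n); last by rewrite -expRM_natl; congr expR; ring.
rewrite lerXn2r ?nnegrE ?expR_ge0// mulr_ge0 ?expR_ge0//.
have qle : q <= 1 by have := true_massC mJ; have := true_mass_ge0 (~` J); rewrite -/q; lra.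
by have := expR_ge0 s; nra.
Qed.

End chernoff.

End true_density.

(** * Typical counts force typical masses *)

Section counts_of_a_perturbation.
Context {R : realType}.
Variables (a b : R) (L n : nat).
Hypothesis ab : a < b.
Local Notation obsT := (n.-tuple (measurableTypeR R)).

Lemma node_count_leavesE (t : obsT) k :
  (node_count L (leaves a b L t) L k)%:R =
  \sum_(j < n) (leaf a b L (tnth t j) == k)%:R :> R.
Proof.
rewrite /node_count subnn -natr_sum -sum1_card big_mkcond /=; congr _%:R.
by apply: eq_bigr => j _; rewrite inE expn0 divn1 /leaves; case: eqP.
Qed.

(** Chebyshev's inequality for the empirical displacement. *)
Lemma displaced_count_le (t t0 : obsT) (r D : R) : 0 < r ->
  \sum_(j < n) (tnth t j - tnth t0 j) ^+ 2 <= D * n%:R * r ^+ 3 ->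
  \sum_(j < n) ((r < `|tnth t j - tnth t0 j|)%R)%:R <= D * n%:R * r.
Proof.
move=> r0 h; have r20 : 0 < r ^+ 2 by rewrite exprn_gt0.
rewrite -(ler_pM2l r20); apply: le_trans (_ : _ <= D * n%:R * r ^+ 3) _; last first.
  by rewrite le_eqVlt; apply/orP; left; apply/eqP; ring.
apply: le_trans h; rewrite mulr_sumr; apply: ler_sum => j _.
case: (ltP r) => rj /=; last by rewrite mulr0 sqr_ge0.
rewrite mulr1 -[leRHS]real_normK ?num_real// lerXn2r ?nnegrE// ltW//.
Qed.

(** Moving the coefficients by a small amount in mean square moves most of
them by at most [r], so bin counts are sandwiched between the counts of the
shrunken and the enlarged bin. *)
Lemma node_count_perturbation (t t0 : obsT) (r D : R) k : (k < 2 ^ L)%N -> 0 < r ->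
  (forall j, tnth t j \in `[a, b]) ->
  \sum_(j < n) (tnth t j - tnth t0 j) ^+ 2 <= D * n%:R * r ^+ 3 ->
  hits (inner_bin a b L k r) t0 - D * n%:R * r <=
    (node_count L (leaves a b L t) L k)%:R <=
  hits (outer_bin a b L k r) t0 + D * n%:R * r.
Proof.
move=> kL r0 tab h; have hd := displaced_count_le r0 h.
rewrite node_count_leavesE lerBlDr; apply/andP; split.
  apply: le_trans (lerD (lexx _) hd).
  rewrite -big_split /=; apply: ler_sum => j _.
  have [rj|rj] := ltP r; first by rewrite indicE -natrD ler_nat; case: (_ \in _); lia.
  rewrite indicE; case: (boolP (tnth t0 j \in _)) => /= [|_]; last by rewrite -natrD.
  rewrite inE /inner_bin /= in_itv /= => /andP[x1 x2].
  have : dyadic a b L k (tnth t j).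
    by apply: dyadic_of_lt => //; move: rj; rewrite ler_norml => /andP[? ?]; lra.
  move=> /(dyadic_inj ab kL (leaf_lt _ _ _ _)) /(_ (dyadic_leaf ab _ (tab j))) {1}->.
  by rewrite eqxx addr0.
apply: le_trans (lerD (lexx _) hd).
rewrite -big_split /=; apply: ler_sum => j _.
case: eqP => [lk|_]; last by rewrite indicE -natrD.
have [rj|rj] := ltP r; first by rewrite indicE -natrD ler_nat; lia.
have := dyadic_leaf ab L (tab j); rewrite lk => /dyadic_le /andP[x1 x2].
have hin : outer_bin a b L k r (tnth t0 j).
  by rewrite /outer_bin /= in_itv /=; move: rj; rewrite ler_norml => /andP[? ?]; lra.
by rewrite indicE mem_set//= addr0.
Qed.

End counts_of_a_perturbation.

Section well_spread_counts.
Context {R : realType}.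
Variables (a b : R) (L n : nat) (m1 M1 B delta : R).
Local Notation N := (2 ^ L).-1.
Local Notation splitsT := (N.-tuple (measurableTypeR R)).
Local Notation obsT := (n.-tuple (measurableTypeR R)).
Local Notation u := ((2 ^+ L)^-1 : R).
Hypotheses (ab : a < b) (n2 : (1 < n)%N) (m1_gt0 : 0 < m1) (mM1 : m1 <= M1) (delta0 : 0 < delta)
  (lnn : ln n%:R <= n%:R * u * delta ^+ 2).
Hypotheses (L_le_n : (2 ^ L <= n)%N) (Bdelta : B * delta <= m1 / 2).

Definition split_slack : R := 4 * (1 + 2 / m1).
(** The allowed deviations of the splits decrease geometrically away from the
leaves, so that they can be summed along a branch, but more slowly than the
posterior standard deviations, which are proportional to [2 ^ ((l - L) / 2)]:
[3 / 4] lies between [1 / sqrt 2] and 1. *)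
Definition split_tol (l : nat) : R := split_slack * delta * (3 / 4) ^+ (L - l).
Definition mass_slack : R := 24 * split_slack * M1 / m1.
Hypothesis massdelta : mass_slack * delta <= 2^-1.
Definition leaf_slack : R := 4 * M1 * mass_slack + B.

Variables (G : nat -> R) (t : obsT).
Hypothesis tab : forall j, tnth t j \in `[a, b].
Hypothesis Gb : forall k, (k < 2 ^ L)%N -> m1 * u <= G k <= M1 * u.
Hypothesis cntG : forall k, (k < 2 ^ L)%N ->
  `|(node_count L (leaves a b L t) L k)%:R - n%:R * G k| <= B * (n%:R * u * delta).

Let cnt := node_count L (leaves a b L t).
Let slack0 : 0 < split_slack.
Proof. by rewrite mulr_gt0// addr_gt0// divr_gt0. Qed.
Let n0 : 0 < n%:R :> R. Proof. by rewrite ltr0n ltnW. Qed.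
Let u0 : 0 < u. Proof. by rewrite invr_gt0 exprn_gt0. Qed.
Let M10 : 0 < M1. Proof. exact: lt_le_trans mM1. Qed.
Let mslack0 : 0 <= mass_slack.
Proof.
rewrite /mass_slack divr_ge0 ?(ltW m1_gt0)// mulr_ge0 ?(ltW M10)//.
by rewrite mulr_ge0// (ltW slack0). Qed.

Let cnt_bounds l i : (l <= L)%N -> (i < 2 ^ l)%N ->
  m1 / 2 * (n%:R * u) * 2 ^+ (L - l) <= (cnt l i)%:R <= 2 * M1 * (n%:R * u) * 2 ^+ (L - l).
Proof.
move=> lL il.
apply: (node_count_bounds (lo := fun h => m1 / 2 * (n%:R * u) * 2 ^+ h)
  (hi := fun h => 2 * M1 * (n%:R * u) * 2 ^+ h) _ _ _ lL il).
- move=> k kL; rewrite !expr0 !mulr1.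
  have /andP[g1 g2] := Gb kL; have := cntG kL; rewrite ler_norml => /andP[c1 c2].
  have nu0 : 0 < n%:R * u by rewrite mulr_gt0.
  have e1 := ler_wpM2l (ltW n0) g1; have e2 := ler_wpM2l (ltW n0) g2.
  have e3 := ler_wpM2r (ltW nu0) Bdelta; have e4 := ler_wpM2r (ltW nu0) mM1.
  move: c1 c2 e1 e2 e3 e4 nu0; rewrite -/cnt !mulrA.
  move: (cnt L k)%:R (G k) => x y; nra.
- by move=> h; rewrite exprS; ring.
- by move=> h; rewrite exprS; ring.
Qed.

Let cnt_gt0 l i : (l <= L)%N -> (i < 2 ^ l)%N -> (0 < cnt l i)%N.
Proof.
move=> lL il; rewrite -(ltr0n R); have /andP[h _] := cnt_bounds lL il.
by apply: lt_le_trans h; rewrite mulr_gt0 ?exprn_gt0// mulr_gt0 ?divr_gt0 ?mulr_gt0.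
Qed.

Let split_tol_ge0 l : 0 <= split_tol l.
Proof. by rewrite mulr_ge0 ?exprn_ge0// mulr_ge0 ?ltW. Qed.

Let split_deviation (j : 'I_N) : set R := [set x | split_tol (heap_level j) <
  `|x - (left_count a b L t j)%:R / (cnt (heap_level j) (heap_pos j))%:R| ].

Let cntD (j : 'I_N) : cnt (heap_level j) (heap_pos j) =
  (left_count a b L t j + right_count a b L t j)%N.
Proof. by rewrite /cnt node_countD//; apply: heap_level_lt; exact: ltn_ord. Qed.

Let sum_split_tol : \sum_(l < L) split_tol l <= 3 * split_slack * delta.
Proof.
have H : \sum_(l < L) (3 / 4) ^+ (L - l) <= 3 :> R.
  rewrite (reindex_inj rev_ord_inj) /=.
  rewrite (eq_bigr (fun i : 'I_L => (3 / 4) ^+ i.+1)); last first.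
    by move=> i _; rewrite subKn.
  have : \sum_(i < L) (3 / 4) ^+ i.+1 = 3 - 3 * (3 / 4) ^+ L :> R.
    elim: (L) => [|l IH]; first by rewrite big_ord0 expr0; ring.
    by rewrite big_ord_recr /= IH !exprS; field.
  move=> ->; have : 0 <= (3 / 4 : R) ^+ L by rewrite exprn_ge0.
  lra.
have sd0 : 0 <= split_slack * delta by rewrite mulr_ge0 ?ltW.
rewrite /split_tol -mulr_sumr; apply: le_trans (ler_wpM2l sd0 H) _.
by rewrite le_eqVlt; apply/orP; left; apply/eqP; ring.
Qed.

Let leaf_mass_close (v : splitsT) : (forall j, ~ split_deviation j (tnth v j)) ->
  forall k, (k < 2 ^ L)%N ->
  `|polya_mass (splits v) L k - G k| <= leaf_slack * (u * delta).
Proof.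
move=> hv k kL.
pose r l := split_tol l * (4 * M1 / (m1 / 2)).
have c0 : 0 <= 4 * M1 / (m1 / 2).
  by rewrite divr_ge0 ?mulr_ge0 ?divr_ge0// ltW.
have rel : `|polya_mass (splits v) L k * n%:R / (cnt L k)%:R - 1| <=
    expR (\sum_(h < L) r h) - 1.
  apply: (@polya_mass_rel_error R n L (leaves a b L t)
    (@leaves_lt R a b L n t)
    (splits v) split_tol r _ _ _ _ L k) => //.
  - by move=> l; rewrite mulr_ge0.
  - move=> l i lL il; have jN := heap_node_lt lL il.
    have := hv (Ordinal jN); rewrite /split_deviation /= heap_level_node// heap_pos_node//.
    move=> /negP; rewrite -leNgt (tnth_nth 0) /left_count heap_level_node//.
    by rewrite heap_pos_node.
  - move=> l i lL il.
    have il2 := half_lt_exp2 il.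
    have /andP[_ h1] := cnt_bounds (ltnW lL) il2.
    have /andP[h2 _] := cnt_bounds lL il.
    rewrite /r -mulrA ler_wpM2l//.
    apply: le_trans h1 _; apply: le_trans (ler_wpM2l c0 h2).
    rewrite -(subnSK lL) exprS le_eqVlt; apply/orP; left; apply/eqP.
    by field; rewrite expf_neq0//= gt_eqF.
have sr : \sum_(h < L) r h <= mass_slack * delta.
  rewrite /r -mulr_suml; apply: le_trans (ler_wpM2r c0 sum_split_tol) _.
  rewrite /mass_slack le_eqVlt; apply/orP; left; apply/eqP.
  by field; rewrite gt_eqF.
have sr0 : 0 <= \sum_(h < L) r h by apply: sumr_ge0 => h _; rewrite mulr_ge0.
have {}rel : `|polya_mass (splits v) L k * n%:R / (cnt L k)%:R - 1| <=
    2 * mass_slack * delta.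
  apply: le_trans rel _; rewrite lerBlDr addrC.
  apply: le_trans (expR_le_lin _) _; first by rewrite sr0 (le_trans sr).
  by rewrite lerD2l -mulrA ler_wpM2l.
have /andP[_ ck] := cnt_bounds (leqnn L) kL; rewrite subnn expr0 mulr1 in ck.
have ck0 : 0 < (cnt L k)%:R :> R by rewrite ltr0n cnt_gt0.
have -> : polya_mass (splits v) L k - G k =
    (polya_mass (splits v) L k * n%:R / (cnt L k)%:R - 1) * ((cnt L k)%:R / n%:R) +
    ((cnt L k)%:R - n%:R * G k) / n%:R.
  by field; rewrite !gt_eqF.
apply: le_trans (ler_normD _ _) _; rewrite /leaf_slack [leRHS]mulrDl; apply: lerD.
  rewrite normrM (ger0_norm (divr_ge0 (ltW ck0) (ltW n0))).
  apply: (@le_trans _ _ (2 * mass_slack * delta * (2 * M1 * u))).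
    apply: ler_pM => //.
    rewrite ler_pdivrMr//; apply: (le_trans ck).
    by rewrite le_eqVlt; apply/orP; left; apply/eqP; ring.
  by rewrite le_eqVlt; apply/orP; left; apply/eqP; ring.
rewrite normrM normfV (ger0_norm (ltW n0)) ler_pdivrMr//.
apply: le_trans (cntG kL) _.
by rewrite le_eqVlt; apply/orP; left; apply/eqP; ring.
Qed.

Definition mass_deviation : set splitsT :=
  \bigcup_(k in [set k | (k < 2 ^ L)%N])
    [set v | leaf_slack * (u * delta) < `|polya_mass (splits v) L k - G k|].

(** Given the coefficients [t], a leaf can have a wrong mass only if one of the
[2 ^ L - 1] splits deviates, and each of them does so with the tail of its
Beta law. *)
Lemma restricted_pred_le :
  (restricted_pred a b mass_deviation t <= (2 / n%:R * prior_pdf a b L t)%:E)%E.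
Proof.
pose D (j : 'I_N) (x : R) : R := \1_(split_deviation j) x.
have cover v : \1_mass_deviation v <= \sum_(j < N) D j (tnth v j).
  rewrite indicE; case: (boolP (v \in mass_deviation)) => /= [|_]; last first.
    by apply: sumr_ge0 => j _.
  rewrite inE => -[k /= kL hk].
  have [j hj] : exists j, split_deviation j (tnth v j).
    apply: contrapT => /forallNP h; have := leaf_mass_close h kL.
    by rewrite leNgt hk.
  by rewrite (bigD1 j)//= {1}/D indicE mem_set//= lerDl sumr_ge0.
have mD j : measurable (split_deviation j).
  rewrite /split_deviation -[X in measurable X]setTI -preimage_true.
  apply: measurable_fun_ltr => //; apply: measurableT_comp => //.
  exact: measurable_funB.
have mJ : measurable_fun setT (fun v : splitsT => prior_joint a b v t).
  exact: (measurableT_comp (@measurable_prior_joint R a b L n) (measurable_pair2 t)).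
apply: (@le_trans _ _ (\int[splits_law R L]_v
   (\sum_(j < N) (prior_joint a b v t * D j (tnth v j))%:E))%E).
  apply: ge0_le_integral_nm => v.
    by rewrite lee_fin mulr_ge0 ?prior_joint_ge0.
  by rewrite sumEFin lee_fin -mulr_sumr ler_wpM2l ?prior_joint_ge0.
rewrite ge0_integral_sum//; last 2 first.
- move=> j; apply/measurable_EFinP; apply: measurable_funM => //.
  by apply: measurable_indic_comp => //; exact: measurable_tnth.
- by move=> j v _; rewrite lee_fin mulr_ge0 ?prior_joint_ge0.
(* The Beta tail has a prefactor of order [n] and there are at most [n] splits,
   so an exponent [4 ln n] is more than enough. *)
pose eps : R := n.+1%:R / n%:R ^+ 4.
have eps0 : 0 <= eps by rewrite divr_ge0 ?exprn_ge0.
apply: (@le_trans _ _ (\sum_(j < N) (eps * prior_pdf a b L t)%:E)%E).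
  apply: lee_sum => j _.
  have lL := heap_level_lt (ltn_ord j); have pL := heap_pos_lt j.
  have p0 : (0 < left_count a b L t j)%N := cnt_gt0 lL (double_lt_exp2 pL).
  have q0 : (0 < right_count a b L t j)%N := cnt_gt0 lL (doubleS_lt_exp2 pL).
  have := prior_joint_split_tail ab tab (split_tol_ge0 (heap_level j)) p0 q0 (cntD j).
  move=> /le_trans; apply; rewrite prior_predE// -EFinM lee_fin.
  rewrite ler_wpM2r ?prior_pdf_ge0// /eps.
  have /andP[hc _] := cnt_bounds (ltnW lL) pL.
  apply: ler_pM => //; rewrite ?expR_ge0//.
    by rewrite ler_nat ltnS; exact: count_le.
  have -> : (n%:R ^+ 4)^-1 = expR (- (4 * ln n%:R)) :> R.
    by rewrite expRN mulrC expRM_natr lnK// posrE.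
  rewrite ler_expR !mulNr lerN2 ler_pdivlMr//.
  have -> : 4 * ln n%:R * 4 = 16 * ln n%:R :> R by ring.
  apply: (@le_trans _ _ (16 * (n%:R * u * delta ^+ 2))); first by rewrite ler_wpM2l.
  have tol0 : 0 <= split_tol (heap_level j) ^+ 2 by exact: sqr_ge0.
  apply: le_trans (ler_wpM2r tol0 hc).
  set h := (L - heap_level j)%N.
  have -> : m1 / 2 * (n%:R * u) * 2 ^+ h * split_tol (heap_level j) ^+ 2 =
     (m1 / 2 * split_slack ^+ 2) * (n%:R * u * delta ^+ 2) * (2 * (3 / 4) ^+ 2) ^+ h.
    have e : ((3 / 4 : R) ^+ 2) ^+ h = ((3 / 4) ^+ h) ^+ 2 by rewrite -!exprM mulnC.
    rewrite /split_tol -/h [(2 * _) ^+ h]exprMn e.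
    by move: ((3 / 4) ^+ h) (2 ^+ h) => x y; ring.
  have k1 : 16 <= m1 / 2 * split_slack ^+ 2.
    rewrite /split_slack; have -> : m1 / 2 * (4 * (1 + 2 / m1)) ^+ 2 =
      8 * m1 + 32 + 32 / m1 by field; rewrite gt_eqF.
    have : 0 < 32 / m1 by rewrite divr_gt0.
    by move: m1_gt0; lra.
  have k2 : 1 <= (2 * (3 / 4) ^+ 2) ^+ h :> R.
    by apply: exprn_ege1; rewrite expr2; lra.
  have nud : 0 <= n%:R * u * delta ^+ 2 by rewrite mulr_ge0 ?sqr_ge0 ?mulr_ge0// ltW.
  apply: le_trans (ler_wpM2r nud k1) _; rewrite -[leLHS]mulr1.
  by rewrite ler_wpM2l// mulr_ge0// (le_trans _ k1).
rewrite sumEFin lee_fin sumr_const card_ord -mulrnAl ler_wpM2r ?prior_pdf_ge0//.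
rewrite /eps -mulr_natl.
apply: (@le_trans _ _ (n%:R * ((2 * n%:R) / n%:R ^+ 4))).
  apply: ler_pM => //; first by rewrite ler_nat (leq_trans (leq_pred _)).
  rewrite ler_wpM2r ?invr_ge0 ?exprn_ge0// -natrM ler_nat.
  by rewrite mul2n -addnn -addn1 leq_add2l ltnW.
have -> : n%:R * (2 * n%:R / n%:R ^+ 4) = 2 / n%:R * n%:R^-1 :> R.
  by field; rewrite gt_eqF.
rewrite -[leRHS]mulr1 ler_wpM2l ?divr_ge0//.
by rewrite invf_le1// ler1n ltnW.
Qed.

Lemma measurable_mass_deviation : measurable mass_deviation.
Proof.
apply: bigcup_measurable => k _.
rewrite -[X in measurable X]setTI -preimage_true.
apply: measurable_fun_ltr => //; apply: measurableT_comp => //.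
apply: measurable_funB => //; exact: measurable_polya_mass.
Qed.

End well_spread_counts.

(** * Contraction for a fixed design *)

Section fixed_design.
Context {R : realType}.
Variables (a b alpha L0 m0 M0 : R).
Hypotheses (ab : a < b) (alpha0 : 0 < alpha) (m0_gt0 : 0 < m0) (mM : m0 <= M0).
Let w : R := b - a.
Let w0 : 0 < w. Proof. by rewrite subr_gt0. Qed.
Let M00 : 0 < M0. Proof. exact: lt_le_trans mM. Qed.

(** The change of measure from the prior to the truth and the exponential moment
of the residuals cost at most [expR ((M0 * (b - a) + 3) * n)]; the rate
exceeds this exponent by [n]. *)
Definition noise_rate : R := M0 * (b - a) + 4.
(** When two predictions are at squared distance [noise_radius * n] in units of
the noise variance, one of the two residuals has squared length at least a
quarter of this, and the weight of a residual takes another quarter. *)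
Definition noise_radius : R := 16 * noise_rate.
(** Bound of [2^L] times the mass of an enlarged bin. *)
Definition bin_mass : R := M0 * (b - a + 2).
Definition count_slack : R := 2 * M0 + (2 * bin_mass + 2) + 3 * noise_radius.
Definition contraction_const : R :=
  leaf_slack (m0 * (b - a)) (M0 * (b - a)) count_slack / ((b - a) * (b - a) `^ alpha) + L0.

Variable (g0 : R -> R).
Hypotheses (dg0 : density_on a b g0) (hg0 : holder_bounded a b alpha L0 m0 M0 g0).
Let g0b : forall x, x \in `[a, b] -> m0 <= g0 x <= M0. Proof. by case: hg0. Qed.

Variables (L n m : nat) (sigma : R) (X : 'M[R]_(m, n)) (lam : R).
Local Notation delta := (2 `^ (- alpha * L%:R) : R).
Local Notation u := ((2 ^+ L)^-1 : R).
Hypotheses (n2 : (1 < n)%N) (sigma0 : 0 < sigma).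
Hypothesis lamX : forall h : 'cV_n, lam * sqnorm h <= sqnorm (X *m h).
Hypotheses (lnn : ln n%:R <= n%:R * u * delta ^+ 2) (L_le_n : (2 ^ L <= n)%N)
  (sigma_lam : sigma ^+ 2 <= 3 * (u * delta) ^+ 3 * lam)
  (small1 : count_slack * delta <= m0 * w / 2)
  (small2 : mass_slack (m0 * w) (M0 * w) * delta <= 2^-1) (small3 : delta <= 2^-1).

Local Notation N := (2 ^ L).-1.
Local Notation splitsT := (N.-tuple (measurableTypeR R)).
Local Notation obsT := (n.-tuple (measurableTypeR R)).
Local Notation respT := (m.-tuple (measurableTypeR R)).

Let delta0 : 0 < delta. Proof. by rewrite powR_gt0. Qed.
Let u0 : 0 < u. Proof. by rewrite invr_gt0 exprn_gt0. Qed.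
Let n0 : 0 < n%:R :> R. Proof. by rewrite ltr0n ltnW. Qed.
Let r := u * delta.
Let r0 : 0 < r. Proof. by rewrite mulr_gt0. Qed.
Let G k := true_mass g0 (dyadic a b L k).

Let noise_rate0 : 0 < noise_rate.
Proof. by rewrite addr_gt0// mulr_gt0. Qed.
Let bin_mass0 : 0 < bin_mass.
Proof. by rewrite mulr_gt0// addr_gt0. Qed.
Let count_slack0 : 0 <= count_slack.
Proof.
have h : 0 <= noise_radius by rewrite mulr_ge0// ltW.
by have := ltW M00; have := ltW bin_mass0; rewrite /count_slack; lra.
Qed.

Let Gb k : (k < 2 ^ L)%N -> m0 * w * u <= G k <= M0 * w * u.
Proof.
move=> kL; have := dyadic_mass_bounds ab dg0 g0b kL.
by rewrite -!mulrA.
Qed.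

Let u_powR : u `^ alpha = delta.
Proof.
rewrite -powR_mulrn// -powRN -powRrM; congr (_ `^ _); ring.
Qed.

Let L0_ge0 : 0 <= L0.
Proof.
have [_ h] := hg0.
have := h a b; rewrite !in_itv /= !lexx (ltW ab) => /(_ isT isT).
move=> /(le_trans (normr_ge0 _)); rewrite pmulr_lge0// powR_gt0//.
by rewrite normr_gt0 subr_eq0 lt_eqF.
Qed.

(** On a bin, the height of the histogram differs from the truth by its error
on the mass of the bin and by the oscillation of the truth. *)
Let density_error (V : nat -> nat -> R) (c : R) :
  (forall k, (k < 2 ^ L)%N -> `|polya_mass V L k - G k| <= c * r) ->
  forall x, x \in `[a, b] ->
  `|polya_density a b L V x - g0 x| <= (c / (w * w `^ alpha) + L0) * (w `^ alpha * delta).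
Proof.
move=> hV x xab; rewrite polya_densityE//.
set k := leaf a b L x; have kL : (k < 2 ^ L)%N by exact: leaf_lt.
have xk : dyadic a b L k x by exact: dyadic_leaf.
set H := L0 * (w `^ alpha * delta).
have hz z : dyadic a b L k z -> g0 x - H <= g0 z <= g0 x + H.
  move=> zk; have zab := dyadic_subset ab kL zk.
  have zx : `|z - x| <= w * u.
    have := dyadic_le zk; have := dyadic_le xk; rewrite bin_edgeS -/w.
    by rewrite ler_norml => /andP[? ?] /andP[? ?]; lra.
  have : `|g0 z - g0 x| <= H.
    apply: le_trans (hg0.2 z x zab xab) _; rewrite /H ler_wpM2l//.
    rewrite -u_powR -powRM ?(ltW w0) ?(ltW u0)//.
    by apply: ge0_ler_powR; rewrite ?nnegrE ?mulr_ge0 ?(ltW w0) ?(ltW u0) ?(ltW alpha0).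
  by rewrite ler_norml => /andP[? ?]; lra.
have /andP[g1 g2] := dyadic_mass_avg ab dg0 hz.
rewrite -/(G k) -/w in g1 g2.
have wu0 : 0 < w * u by rewrite mulr_gt0.
have e1 : 2 ^+ L / (b - a) * polya_mass V L k - g0 x =
    (polya_mass V L k - G k) / (w * u) + (G k / (w * u) - g0 x).
  by rewrite /w; field; rewrite expf_neq0//= gt_eqF.
have wa0 : 0 < w `^ alpha by rewrite powR_gt0.
rewrite e1 [leRHS]mulrDl; apply: le_trans (ler_normD _ _) _; apply: lerD.
  rewrite normrM normfV (ger0_norm (ltW wu0)) ler_pdivrMr//.
  apply: le_trans (hV k kL) _; rewrite le_eqVlt; apply/orP; left; apply/eqP.
  have P0 : 0 < 2 ^+ L :> R by rewrite exprn_gt0.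
  rewrite /r; move: (w `^ alpha) wa0 (delta) (2 ^+ L) P0 => A A0 d P P0.
  by field; rewrite !gt_eqF.
have g3 : g0 x - H <= G k / (w * u) by rewrite ler_pdivlMr.
have g4 : G k / (w * u) <= g0 x + H by rewrite ler_pdivrMr.
by rewrite -/H ler_norml; apply/andP; split; lra.
Qed.

Let mass_deviation_cover (C0 : R) :
  contraction_const <= C0 ->
  forall v : splitsT, prior_cube v ->
  ((C0 * rate a b alpha n L)%:E <
    sup_norm a b (fun x => polya_density a b L (splits v) x - g0 x)%R)%E ->
  @mass_deviation R L (m0 * w) (M0 * w) count_slack delta G v.
Proof.
move=> hC v hv hlt; apply: contrapT => hno.
move: hlt; rewrite ltNge => /negP; apply.
apply: ge_ereal_sup => _ [x /= xab <-]; rewrite lee_fin.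
have hmass k : (k < 2 ^ L)%N -> `|polya_mass (splits v) L k - G k| <=
    leaf_slack (m0 * w) (M0 * w) count_slack * r.
  move=> kL; rewrite leNgt; apply/negP => hk; apply: hno.
  by exists k.
apply: le_trans (density_error hmass xab) _.
have wa0 : 0 < w `^ alpha by rewrite powR_gt0.
rewrite -/contraction_const.
have rate_ge : w `^ alpha * delta <= rate a b alpha n L.
  by rewrite /rate lerDl mulr_ge0 ?sqrtr_ge0// invr_ge0 ltW.
apply: ler_pM => //; last by rewrite mulr_ge0 ?ltW.
rewrite addr_ge0// divr_ge0 ?mulr_ge0 ?(ltW w0) ?(ltW wa0)//.
have s0 : 0 <= mass_slack (m0 * w) (M0 * w).
  have mw : 0 <= m0 * w by rewrite mulr_ge0 ?(ltW m0_gt0) ?(ltW w0).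
  have Mw : 0 <= M0 * w by rewrite mulr_ge0 ?(ltW M00) ?(ltW w0).
  rewrite /mass_slack divr_ge0// mulr_ge0// mulr_ge0//.
  by rewrite /split_slack mulr_ge0// addr_ge0// divr_ge0.
rewrite /leaf_slack addr_ge0// mulr_ge0// mulr_ge0//.
by rewrite mulr_ge0 ?(ltW M00) ?(ltW w0).
Qed.

(** At deviation [dev], the exponent [delta * dev] exceeds the variance term of
Chernoff's bound by [2 n u delta^2], which is at least [2 ln n]. *)
Let dev : R := (2 * bin_mass + 2) * (n%:R * r).

(** At least 1 when some bin of the true coefficients has an atypical count, and
small in expectation by Chernoff's bound. *)
Let atypical (t : obsT) : R := \sum_(k < 2 ^ L)
  (expR (delta * (hits (outer_bin a b L k r) t -
       n%:R * true_mass g0 (outer_bin a b L k r)) - delta * dev) +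
   expR (- delta * (hits (inner_bin a b L k r) t -
       n%:R * true_mass g0 (inner_bin a b L k r)) - delta * dev)).

Let outer_le k :
  true_mass g0 (outer_bin a b L k r) <= G k + 2 * M0 * r.
Proof. exact: (outer_bin_mass dg0 g0b m0_gt0 mM L k (ltW r0)). Qed.

Let inner_ge k :
  G k - 2 * M0 * r <= true_mass g0 (inner_bin a b L k r).
Proof. exact: (inner_bin_mass dg0 g0b m0_gt0 mM L k (ltW r0)). Qed.

Let atypical_term (J : set R) (s : R) : measurable J ->
  true_mass g0 J <= bin_mass * u -> s <= 2^-1 -> s ^+ 2 = delta ^+ 2 ->
  (\int[lebesgue_pow R n]_t (iid_pdf g0 t *
    expR (s * (hits J t - n%:R * true_mass g0 J) - delta * dev))%:E <=
   (n%:R ^+ 2)^-1%:E)%E.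
Proof.
move=> mJ qJ s1 s2.
under eq_integral do rewrite expRD mulrA EFinM.
rewrite ge0_integralZr//; last 2 first.
- apply/measurable_EFinP; apply: measurable_funM; first exact: (measurable_iid_pdf dg0).
  apply: measurableT_comp => //; apply: measurable_funM => //.
  by apply: measurable_funB => //; exact: measurable_hits.
- by move=> t _; rewrite lee_fin mulr_ge0 ?expR_ge0// (iid_pdf_ge0 dg0).
have := chernoff dg0 n mJ s1; move=> hc.
apply: le_trans (lee_wpmul2r _ hc) _; first by rewrite lee_fin expR_ge0.
rewrite -EFinM lee_fin -expRD s2.
have -> : (n%:R ^+ 2)^-1 = expR (- (2 * ln n%:R)) :> R.
  by rewrite expRN mulrC expRM_natr lnK// posrE.
rewrite ler_expR.
have nd : 0 <= n%:R * delta ^+ 2 by rewrite mulr_ge0 ?sqr_ge0// ltW.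
have h1 := ler_wpM2l nd qJ.
have e1 : delta * dev = 2 * (n%:R * delta ^+ 2 * (bin_mass * u)) +
    2 * (n%:R * u * delta ^+ 2) by rewrite /dev /r; ring.
rewrite e1.
have -> : 2 * delta ^+ 2 * (n%:R * true_mass g0 J) =
   2 * (n%:R * delta ^+ 2 * true_mass g0 J) by ring.
by move: h1 lnn; lra.
Qed.

Let outer_mass_le k : (k < 2 ^ L)%N -> true_mass g0 (outer_bin a b L k r) <= bin_mass * u.
Proof.
move=> kL; apply: (le_trans (outer_le k)).
have /andP[_ g2] := Gb kL.
have ru : r <= u.
  rewrite /r -[leRHS]mulr1 ler_wpM2l ?(ltW u0)//; apply: (le_trans small3).
  by rewrite invf_le1// ler1n.
have h := ler_wpM2l (ltW M00) ru.
have -> : bin_mass * u = M0 * w * u + 2 * (M0 * u) by rewrite /bin_mass /w; ring.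
by rewrite -[2 * M0 * r]mulrA; lra.
Qed.

Let inner_mass_le k : (k < 2 ^ L)%N -> true_mass g0 (inner_bin a b L k r) <= bin_mass * u.
Proof.
move=> kL; apply: (@le_trans _ _ (G k)).
  apply: (le_true_mass dg0) => x; rewrite /inner_bin /= in_itv /= => /andP[x1 x2].
  by apply: dyadic_of_lt => //; have := ltW r0; lra.
have /andP[_ g2] := Gb kL; apply: le_trans g2 _.
rewrite ler_wpM2r ?(ltW u0)// /bin_mass -/w ler_wpM2l ?(ltW M00)//; lra.
Qed.

Let measurable_atypical : measurable_fun setT atypical.
Proof.
apply: measurable_sum => k; apply: measurable_funD; apply: measurableT_comp => //;
  apply: measurable_funB => //; apply: measurable_funM => //;
  apply: measurable_funB => //; apply: measurable_hits; exact: measurable_itv.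
Qed.

Let atypical_ge0 t : 0 <= atypical t.
Proof. by apply: sumr_ge0 => k _; rewrite addr_ge0 ?expR_ge0. Qed.

Let integral_atypical :
  (\int[lebesgue_pow R n]_t (iid_pdf g0 t * atypical t)%:E <= (2 / n%:R)%:E)%E.
Proof.
pose f k (t : obsT) := iid_pdf g0 t * expR (delta * (hits (outer_bin a b L k r) t -
       n%:R * true_mass g0 (outer_bin a b L k r)) - delta * dev).
pose h k (t : obsT) := iid_pdf g0 t * expR (- delta * (hits (inner_bin a b L k r) t -
       n%:R * true_mass g0 (inner_bin a b L k r)) - delta * dev).
have p0 t : 0 <= iid_pdf g0 t by exact: (iid_pdf_ge0 dg0).
have mp : measurable_fun setT (fun t : obsT => iid_pdf g0 t).
  exact: (measurable_iid_pdf dg0).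
have mf k : measurable_fun setT (EFin \o f k).
  apply/measurable_EFinP; apply: measurable_funM => //; apply: measurableT_comp => //.
  apply: measurable_funB => //; apply: measurable_funM => //.
  by apply: measurable_funB => //; apply: measurable_hits; exact: measurable_itv.
have mh k : measurable_fun setT (EFin \o h k).
  apply/measurable_EFinP; apply: measurable_funM => //; apply: measurableT_comp => //.
  apply: measurable_funB => //; apply: measurable_funM => //.
  by apply: measurable_funB => //; apply: measurable_hits; exact: measurable_itv.
have f0 k t : (0 <= (f k t)%:E)%E by rewrite lee_fin mulr_ge0 ?expR_ge0.
have h0 k t : (0 <= (h k t)%:E)%E by rewrite lee_fin mulr_ge0 ?expR_ge0.
rewrite (eq_integral (fun t => \sum_(k < 2 ^ L) ((f k t)%:E + (h k t)%:E)))%E; last first.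
  move=> t _; rewrite /atypical mulr_sumr -sumEFin; apply: eq_bigr => k _.
  by rewrite -EFinD /f /h mulrDr.
rewrite ge0_integral_sum//; last 2 first.
- by move=> k; exact: (emeasurable_funD (mf k) (mh k)).
- by move=> k t _; rewrite adde_ge0.
apply: (@le_trans _ _ (\sum_(k < 2 ^ L) (2 * (n%:R ^+ 2)^-1 : R)%:E)%E).
  apply: lee_sum => k _; rewrite ge0_integralD//; last 2 first.
  - exact: (mf k).
  - exact: (mh k).
  have -> : 2 * (n%:R ^+ 2)^-1 = (n%:R ^+ 2)^-1 + (n%:R ^+ 2)^-1 :> R by ring.
  rewrite EFinD; apply: leeD.
    by apply: atypical_term => //; [exact: measurable_itv|exact: outer_mass_le].
  apply: atypical_term; [exact: measurable_itv|exact: inner_mass_le| |by rewrite sqrrN].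
  by have := delta0; lra.
rewrite sumEFin lee_fin sumr_const card_ord -[leLHS]mulr_natl.
rewrite mulrCA ler_wpM2l// ler_pdivrMr ?exprn_gt0// expr2 mulrA mulVf ?gt_eqF// mul1r ler_nat.
exact: L_le_n.
Qed.

Let typical_counts (t0 : obsT) : atypical t0 < 1 -> forall k, (k < 2 ^ L)%N ->
  hits (outer_bin a b L k r) t0 <= n%:R * true_mass g0 (outer_bin a b L k r) + dev /\
  n%:R * true_mass g0 (inner_bin a b L k r) - dev <= hits (inner_bin a b L k r) t0.
Proof.
move=> h1 k kL.
pose E (k : nat) := expR (delta * (hits (outer_bin a b L k r) t0 -
       n%:R * true_mass g0 (outer_bin a b L k r)) - delta * dev).
pose F (k : nat) := expR (- delta * (hits (inner_bin a b L k r) t0 -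
       n%:R * true_mass g0 (inner_bin a b L k r)) - delta * dev).
have le : E k + F k <= atypical t0.
  rewrite /atypical (bigD1 (Ordinal kL))//= lerDl.
  by apply: sumr_ge0 => i _; rewrite addr_ge0 ?expR_ge0.
have E0 : 0 < E k by exact: expR_gt0.
have F0 : 0 < F k by exact: expR_gt0.
have : E k < 1 by lra.
have : F k < 1 by lra.
rewrite /E /F -expR0 !ltr_expR mulNr -mulrN -!mulrBr !pmulr_rlt0//.
by move=> f1 e1; split; lra.
Qed.

Let close_counts (t0 t : obsT) : atypical t0 < 1 ->
  (forall j, tnth t j \in `[a, b]) ->
  \sum_(j < n) (tnth t j - tnth t0 j) ^+ 2 <= 3 * noise_radius * n%:R * r ^+ 3 ->
  forall k, (k < 2 ^ L)%N ->
  `|(node_count L (leaves a b L t) L k)%:R - n%:R * G k| <=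
    count_slack * (n%:R * u * delta).
Proof.
move=> h1 tab hd k kL.
have /andP[p1 p2] := node_count_perturbation ab kL r0 tab hd.
have [c1 c2] := typical_counts h1 kL.
have o1 := ler_wpM2l (ltW n0) (outer_le k).
have o2 := ler_wpM2l (ltW n0) (inner_ge k).
have e : count_slack * (n%:R * u * delta) =
    n%:R * (2 * M0 * r) + dev + 3 * noise_radius * n%:R * r.
  by rewrite /count_slack /dev /r; ring.
rewrite e ler_norml; apply/andP; split.
  by move: p1 c2 o2; rewrite mulrBr; lra.
by move: p2 c1 o1; rewrite mulrDr; lra.
Qed.

Lemma sqnormB_le k (x y : 'cV[R]_k) : sqnorm (x - y) <= 2 * sqnorm x + 2 * sqnorm y.
Proof.
rewrite !sqnormE !mulr_sumr -big_split /=; apply: ler_sum => i _; rewrite !mxE.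
by have := sqr_ge0 (x i 0 + y i 0); nra.
Qed.

Let fits (U : 'M[R]_(m, n)) := residual_weight sigma X U.

Let residual_weightE (U : 'M[R]_(m, n)) (t : obsT) (y : respT) :
  fits U t y = expR (sqnorm (U^T *m (\col_i tnth y i - X *m \col_j tnth t j)) /
    (4 * sigma ^+ 2)).
Proof.
rewrite /fits /residual_weight sqnormE mulr_suml; congr expR.
apply: eq_bigr => j _; congr (_ ^+ 2 / _); rewrite mxE; apply: eq_bigr => i _.
rewrite !mxE; congr (_ * (_ - _)); apply: eq_bigr => k _; by rewrite mxE.
Qed.

(** If a posterior draw predicts far from the truth, then one of the two has a
large residual in the column space of the design. *)
Let far_weight (U : 'M[R]_(m, n)) (t t0 : obsT) (y : respT) :
  U *m U^T *m X = X ->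
  noise_radius * sigma ^+ 2 * n%:R <
    sqnorm (X *m (\col_j (tnth t j - tnth t0 j))) ->
  1 <= expR (- (noise_rate * n%:R)) * (fits U t y + fits U t0 y).
Proof.
move=> UX far; rewrite !residual_weightE.
set x := U^T *m _; set x0 := U^T *m (_ - X *m \col_j tnth t0 j).
have hx : sqnorm (X *m (\col_j (tnth t j - tnth t0 j))) = sqnorm (x0 - x).
  have -> : x0 - x = U^T *m (X *m (\col_j (tnth t j - tnth t0 j))).
    rewrite /x0 /x -mulmxBr; congr (_ *m _).
    have -> : \col_j (tnth t j - tnth t0 j) = \col_j tnth t j - \col_j tnth t0 j.
      by apply/colP => j; rewrite !mxE.
    by rewrite mulmxBr opprB addrC addrA subrK.
  rewrite [RHS]/sqnorm [(U^T *m _)^T]trmx_mul trmxK -mulmxA (mulmxA U).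
  by rewrite (mulmxA (U *m U^T)) UX.
have s2 : 0 < sigma ^+ 2 by rewrite exprn_gt0.
rewrite expRN mulrC ler_pdivlMr ?expR_gt0// mul1r.
have hK : noise_radius * sigma ^+ 2 * n%:R = 4 * (noise_rate * n%:R * (4 * sigma ^+ 2)).
  by rewrite /noise_radius; ring.
have := sqnormB_le x0 x; rewrite -hx => hs.
have [h|h] := leP (noise_rate * n%:R * (4 * sigma ^+ 2)) (sqnorm x).
  apply: (@le_trans _ _ (expR (sqnorm x / (4 * sigma ^+ 2)))).
    by rewrite ler_expR ler_pdivlMr// mulr_gt0.
  by rewrite lerDl expR_ge0.
apply: (@le_trans _ _ (expR (sqnorm x0 / (4 * sigma ^+ 2)))).
  rewrite ler_expR ler_pdivlMr ?mulr_gt0//; lra.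
by rewrite lerDr expR_ge0.
Qed.

Let lam0 : 0 < lam.
Proof.
have : 0 < 3 * (u * delta) ^+ 3 * lam.
  by apply: lt_le_trans sigma_lam; rewrite exprn_gt0.
by rewrite pmulr_rgt0// mulr_gt0// exprn_gt0.
Qed.

(** Closeness of the predictions is closeness of the coefficients, up to the
smallest eigenvalue of the Gram matrix. *)
Let near_truth (t t0 : obsT) :
  sqnorm (X *m (\col_j (tnth t j - tnth t0 j))) <= noise_radius * sigma ^+ 2 * n%:R ->
  \sum_(j < n) (tnth t j - tnth t0 j) ^+ 2 <= 3 * noise_radius * n%:R * r ^+ 3.
Proof.
move=> hX; set d := \col_j _ in hX.
have -> : \sum_(j < n) (tnth t j - tnth t0 j) ^+ 2 = sqnorm d.
  by rewrite sqnormE; apply: eq_bigr => j _; rewrite mxE.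
rewrite -(ler_pM2l lam0); apply: le_trans (lamX d) _; apply: le_trans hX _.
have c0 : 0 <= noise_radius * n%:R by rewrite !mulr_ge0 ?ltW.
have := ler_wpM2l c0 sigma_lam; rewrite -/r; lra.
Qed.

(** The three contributions of order [1 / n] are the fluctuation of the splits
given the coefficients, the atypical true coefficients, and the residuals;
the last one is exponentially small, [noise_rate] being chosen to beat the
change of measure [Rn]. *)
Lemma contraction_fixed_design (C0 : R) : contraction_const <= C0 ->
  (data_expectation g0 sigma X (fun y => posterior a b sigma L X y
     [set g | ((C0 * rate a b alpha n L)%:E <
               sup_norm a b (fun x => g x - g0 x)%R)%E]) <= (6 / n%:R)%:E)%E.
Proof.
move=> hC; have [U [cU UX]] := gram_schmidt X.
have hU (z : 'I_n -> R) :
    \sum_(i < m) (\sum_(j < n) U i j * z j) ^+ 2 <= \sum_(j < n) z j ^+ 2.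
  have := cU (\col_j z j); rewrite !sqnormE.
  under eq_bigr => i _ do (rewrite mxE; under eq_bigr do rewrite mxE).
  by under [leRHS]eq_bigr do rewrite mxE.
set A := [set g | _].
pose A' := @mass_deviation R L (m0 * w) (M0 * w) count_slack delta G.
pose Rn : R := (M0 * w) ^+ n * n.+1%:R ^+ (2 ^ L).
pose e : R := expR (- (noise_rate * n%:R)).
have Mw0 : 0 < M0 * w by rewrite mulr_gt0.
have mw0 : 0 < m0 * w by rewrite mulr_gt0.
have Rn0 : 0 <= Rn by rewrite mulr_ge0 ?exprn_ge0// ltW.
have g0out x : x \notin `[a, b] -> g0 x = 0 by case: dg0 => _ _ h _; exact: h.
have p0_out (t : obsT) : ~ (forall j, tnth t j \in `[a, b]) -> iid_pdf g0 t = 0.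
  move=> /existsNP [j /negP hj].
  by rewrite /iid_pdf (bigD1 j)//= g0out ?mul0r.
have p0_le (t : obsT) : iid_pdf g0 t <= Rn * prior_pdf a b L t.
  have [tab|tab] := pselect (forall j, tnth t j \in `[a, b]); last first.
    by rewrite p0_out// mulr_ge0 ?prior_pdf_ge0.
  have := prior_pred_ge L ab tab; rewrite prior_predE// lee_fin => hp.
  apply: le_trans (ler_wpM2l Rn0 hp).
  have -> : Rn * (((b - a) ^+ n)^-1 / n.+1%:R ^+ (2 ^ L)) = M0 ^+ n.
    rewrite /Rn exprMn -/w; move: (w ^+ n) (M0 ^+ n) (expf_neq0 n (lt0r_neq0 w0)).
    move=> W M W0; have := expf_neq0 (2 ^ L) (lt0r_neq0 (ltr0Sn R n)).
    by move: (_ ^+ (2 ^ L)) => Q Q0; field; rewrite Q0 W0.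
  rewrite -[n in leRHS]card_ord -prodr_const; apply: ler_prod => j _.
  have [_ h _ _] := dg0; rewrite h /=.
  exact: (density_le dg0 g0b m0_gt0 mM).
have key (t0 t : obsT) (y : respT) : (forall j, tnth t0 j \in `[a, b]) -> atypical t0 < 1 ->
  (restricted_pred a b A' t <=
   ((2 / n%:R + e * (fits U t y + fits U t0 y)) * prior_pdf a b L t)%:E)%E.
  move=> t0ab h1; have pdf0 := prior_pdf_ge0 L ab t.
  have eW0 : 0 <= e * (fits U t y + fits U t0 y).
    by rewrite mulr_ge0 ?addr_ge0 ?expR_ge0.
  have tn0 : 0 <= 2 / n%:R :> R by rewrite divr_ge0.
  have [tab|tab] := pselect (forall j, tnth t j \in `[a, b]); last first.
    rewrite /restricted_pred integral0_eq; last first.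
      by move=> v _; rewrite prior_joint_out// mul0r.
    by rewrite lee_fin mulr_ge0// addr_ge0.
  have [hX|hX] := leP (sqnorm (X *m (\col_j (tnth t j - tnth t0 j))))
      (noise_radius * sigma ^+ 2 * n%:R).
    apply: (@le_trans _ _ (2 / n%:R * prior_pdf a b L t)%:E); last first.
      by rewrite lee_fin ler_wpM2r// lerDl.
    have hcnt := close_counts h1 tab (near_truth hX).
    have mMw : m0 * w <= M0 * w by rewrite ler_wpM2r// ltW.
    exact: (restricted_pred_le ab n2 mw0 mMw delta0 lnn L_le_n small1 small2
      tab Gb hcnt).
  apply: (@le_trans _ _ (prior_pred a b L t)).
    apply: ge0_le_integral_nm => v.
      by rewrite lee_fin mulr_ge0 ?prior_joint_ge0.
    by rewrite lee_fin -[leRHS]mulr1 ler_wpM2l ?prior_joint_ge0// indicE lern1; case: (_ \in _).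
  rewrite prior_predE// lee_fin -[leLHS]mul1r ler_wpM2r//.
  have := far_weight y UX hX; rewrite -/e; lra.
have := data_expectation_posterior_le ab sigma0 hU (@measurable_iid_pdf R a b g0 dg0 n)
  (iid_pdf_ge0 dg0 (n := n)) (integral_iid_pdf dg0 n) p0_out Rn0 p0_le
  (@measurable_mass_deviation R L (m0 * w) (M0 * w) count_slack delta G)
  (mass_deviation_cover hC : forall v, prior_cube v -> A _ -> A' v)
  (divr_ge0 (ler0n R 2) (ltW n0)) (expR_ge0 _)
  measurable_atypical atypical_ge0 key.
rewrite /data_expectation => /le_trans; apply.
apply: (le_trans (leeD2l _ integral_atypical)); rewrite -EFinD lee_fin.
have s2 : Num.sqrt 2 <= expR 1 :> R.
  apply: (@le_trans _ _ 2); last by have := expR_ge1Dx (1 : R); lra.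
  by rewrite -[leRHS]ger0_norm// -sqrtr_sqr ler_sqrt ?exprn_ge0// expr2; lra.
have hs : Num.sqrt 2 ^+ n <= expR n%:R :> R.
  have -> : expR n%:R = expR 1 ^+ n :> R by rewrite -expRM_natl mulr1.
  by rewrite lerXn2r ?nnegrE ?expR_ge0 ?sqrtr_ge0.
have hR1 : (M0 * w) ^+ n <= expR (M0 * w * n%:R).
  rewrite expRM_natr lerXn2r ?nnegrE ?expR_ge0 ?(ltW Mw0)//.
  by have := expR_ge1Dx (M0 * w); lra.
have pow2 : (2 ^ L)%:R * ln n%:R <= n%:R :> R.
  have P0 : 0 < 2 ^+ L :> R by rewrite exprn_gt0.
  rewrite natrX mulrC -ler_pdivlMr//; apply: (le_trans lnn).
  rewrite -[leRHS]mulr1 ler_wpM2l ?mulr_ge0 ?(ltW n0) ?(ltW u0)//.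
  by rewrite expr_le1 ?(ltW delta0)//; apply: (le_trans small3); rewrite invf_le1// ler1n.
have hR2 : n.+1%:R ^+ (2 ^ L) <= expR (2 * n%:R) :> R.
  apply: (@le_trans _ _ (expR (2 * ln n%:R) ^+ (2 ^ L))).
    rewrite lerXn2r ?nnegrE ?expR_ge0// expRM_natl lnK ?posrE// -natrX ler_nat.
    rewrite expnS expn1 (leq_trans _ (leq_mul n2 (leqnn n)))// mul2n -addnn -addn1.
    by rewrite leq_add2l ltnW.
  by rewrite -expRM_natl ler_expR mulrCA ler_wpM2l.
have hR : Rn <= expR ((M0 * w + 2) * n%:R).
  rewrite mulrDl expRD; apply: ler_pM => //; rewrite exprn_ge0//.
  exact: ltW.
have h1 : 1 <= expR ((M0 * w + 2) * n%:R).
  by rewrite -expR0 ler_expR mulr_ge0 ?addr_ge0 ?(ltW Mw0) ?(ltW n0).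
suff : e * Num.sqrt 2 ^+ n * (1 + Rn) <= 2 / n%:R.
  have -> : 6 / n%:R = 2 / n%:R + 2 / n%:R + 2 / n%:R :> R by field; rewrite gt_eqF.
  by rewrite -/e; lra.
apply: (@le_trans _ _ (e * expR n%:R * (2 * expR ((M0 * w + 2) * n%:R)))).
  apply: ler_pM => //; rewrite ?mulr_ge0 ?addr_ge0 ?expR_ge0 ?exprn_ge0 ?sqrtr_ge0//.
    by rewrite ler_wpM2l ?expR_ge0.
  by rewrite mulr2n mulrDl mul1r lerD.
have -> : e * expR n%:R * (2 * expR ((M0 * w + 2) * n%:R)) = 2 * expR (- n%:R).
  rewrite /e mulrCA -!expRD; congr (_ * expR _).
  by rewrite /noise_rate -/w; ring.
rewrite expRN ler_wpM2l// lef_pV2 ?posrE ?expR_gt0//.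
by have := expR_ge1Dx (n%:R : R); lra.
Qed.

End fixed_design.

(** * Truncation levels *)

Section truncation_levels.
Context {R : realType}.

Lemma powR2E (x : R) : 2 `^ x = expR (x * ln 2).
Proof. by rewrite /powR gt_eqF. Qed.

Lemma ln2_ge_half : 2^-1 <= ln 2 :> R.
Proof.
rewrite -ler_expR lnK ?posrE//.
by apply: le_trans (expR_le_lin _) _; [apply/andP; split; lra|lra].
Qed.

Lemma ln_ge1 (n : nat) : (3 < n)%N -> 1 <= ln n%:R :> R.
Proof.
move=> n3; apply: (@le_trans _ _ (ln (2 ^+ 2))).
  by rewrite lnXn// mulr2n; have := ln2_ge_half; lra.
by rewrite ler_ln ?posrE ?exprn_gt0 ?ltr0n ?(ltn_trans _ n3)// -natrX ler_nat.
Qed.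

Lemma exp2E (L : nat) : 2 ^+ L = expR (L%:R * ln 2) :> R.
Proof. by rewrite -powR_mulrn// powR2E. Qed.

Lemma L_Cast_ge (cCast alpha : R) (n K : nat) : (0 < K)%N ->
  0 < cCast * (n%:R / ln n%:R) `^ (2 * alpha + 1)^-1 ->
  (K <= L_Cast cCast alpha n)%N =
  (2 ^+ K <= cCast * (n%:R / ln n%:R) `^ (2 * alpha + 1)^-1).
Proof.
move=> K0; rewrite /L_Cast; set y := cCast * _ => y0.
have ln20 : 0 < ln 2 :> R by apply: lt_le_trans ln2_ge_half.
have -> : (2 ^+ K <= y) = (K%:R <= log2 y).
  by rewrite /log2 ler_pdivlMr// exp2E -[y in LHS]lnK ?posrE// ler_expR.
have [h|h] := leP 0 (log2 y); first by rewrite truncn_ge_nat.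
have -> : Num.truncn (log2 y) = 0%N.
  by apply/truncn0Pn; rewrite -ltNge (lt_trans h).
by rewrite leqNgt K0 leNgt (lt_trans h) ?ltr0n.
Qed.

(** Below the level that balances bias and variance, the bias dominates the
relative standard deviation of the bin masses, with a logarithm to spare. *)
Lemma bias_dominates (cCast alpha : R) (n L : nat) : 0 < alpha -> 0 < cCast <= 1 ->
  (3 < n)%N -> (0 < L)%N -> (L <= L_Cast cCast alpha n)%N ->
  ln n%:R <= n%:R * (2 ^+ L)^-1 * 2 `^ (- alpha * L%:R) ^+ 2.
Proof.
move=> al0 /andP[c0 c1] n3 L0.
have ln1 := ln_ge1 n3; have ln0 : 0 < ln n%:R :> R by lra.
have n0 : 0 < n%:R :> R by rewrite ltr0n (ltn_trans _ n3).
pose p := 2 * alpha + 1; have p0 : 0 < p by rewrite /p; lra.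
pose q : R := n%:R / ln n%:R; have q0 : 0 < q by rewrite divr_gt0.
rewrite L_Cast_ge ?mulr_gt0 ?powR_gt0// -/p -/q => h.
have {}h : 2 ^+ L <= q `^ p^-1.
  by apply: le_trans h _; rewrite ler_piMl// powR_ge0.
have : (2 ^+ L) `^ p <= q.
  have -> : q = (q `^ p^-1) `^ p.
    by rewrite -powRrM mulVf ?gt_eqF// powRr1// ltW.
  by apply: ge0_ler_powR; rewrite ?nnegrE ?powR_ge0 ?exprn_ge0 ?(ltW p0).
rewrite /q ler_pdivlMr// => hq.
have e : (2 ^+ L) `^ p * ((2 ^+ L)^-1 * 2 `^ (- alpha * L%:R) ^+ 2) = 1.
  rewrite -powR_mulrn// -powRrM !powR2E -expRN -expRM_natl -!expRD.
  by rewrite [X in expR X](_ : _ = 0) ?expR0 // /p; ring.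
have -> : ln n%:R = (2 ^+ L) `^ p * ln n%:R *
    ((2 ^+ L)^-1 * 2 `^ (- alpha * L%:R) ^+ 2) by rewrite mulrAC e mul1r.
by rewrite -[leRHS]mulrA ler_wpM2r.
Qed.

Lemma bins_le_sample (delta : R) (n L : nat) : (3 < n)%N -> 0 <= delta <= 1 ->
  ln n%:R <= n%:R * (2 ^+ L)^-1 * delta ^+ 2 -> (2 ^ L <= n)%N.
Proof.
move=> n3 /andP[d0 d1] h; rewrite -(ler_nat R) natrX.
have P0 : 0 < 2 ^+ L :> R by rewrite exprn_gt0.
have : 1 <= n%:R / 2 ^+ L :> R.
  apply: le_trans (ln_ge1 n3) _; apply: le_trans h _.
  by rewrite -[leRHS]mulr1 ler_wpM2l ?divr_ge0 ?(ltW P0)// expr_le1.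
by rewrite ler_pdivlMr// mul1r.
Qed.

Lemma noise_heightE (l : nat) : (0 < l)%N ->
  2 `^ (3 * l%:R / 2) / l%:R `^ (3 / 2) = Num.sqrt (2 ^+ l / l%:R) ^+ 3 :> R.
Proof.
move=> l0; have l0' : 0 < l%:R :> R by rewrite ltr0n.
have s3 (x : R) : 0 <= x -> Num.sqrt x ^+ 3 = x `^ (3 / 2).
  move=> x0; rewrite -powR12_sqrt// -powR_mulrn ?powR_ge0// -powRrM.
  by congr (_ `^ _); lra.
rewrite s3 ?divr_ge0 ?exprn_ge0//.
rewrite powRM ?exprn_ge0 ?invr_ge0//; congr (_ * _).
  by rewrite -powR_mulrn// -powRrM; congr (_ `^ _); field.
by rewrite -powRN -[l%:R^-1]powR_inv1// -powRrM; congr (_ `^ _); ring.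
Qed.

Lemma sq_le_exp2 (l : nat) : (l * l <= 4 * 2 ^ l)%N.
Proof.
suff : (l * l <= 4 * 2 ^ l)%N /\ (l.*2.+1 <= 4 * 2 ^ l)%N by case.
by elim: l => [|l [h1 h2]] //; rewrite expnS; lia.
Qed.


Lemma noise_height_unbounded (c : R) : exists B : nat, forall l : nat,
  (0 < l)%N -> 2 `^ (3 * l%:R / 2) / l%:R `^ (3 / 2) <= c -> (l <= B)%N.
Proof.
exists (Num.truncn (4 * (1 + `|c|))) => l l0; rewrite noise_heightE//.
have l0' : 0 < l%:R :> R by rewrite ltr0n.
rewrite truncn_ge_nat; last by rewrite mulr_ge0// addr_ge0.
have x0 : 0 <= 2 ^+ l / l%:R :> R by rewrite divr_ge0 ?exprn_ge0.
have sE := sqr_sqrtr x0; have s0 := sqrtr_ge0 (2 ^+ l / l%:R : R).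
have lx : l%:R <= 4 * (2 ^+ l / l%:R) :> R.
  by rewrite mulrA ler_pdivlMr// -natrX -!natrM ler_nat sq_le_exp2.
move: (Num.sqrt _) sE s0 => s sE s0 hs; rewrite -sE in lx.
apply: le_trans lx _; rewrite ler_wpM2l//.
have := ler_norm c; have [s1|s1] := leP s 1.
  by have : s ^+ 2 <= 1 by [rewrite expr_le1]; have := normr_ge0 c; lra.
have : s ^+ 2 <= s ^+ 3 by rewrite ler_eXn2l.
lra.
Qed.

Lemma ler_exp2_div (l l' : nat) : (0 < l <= l')%N ->
  2 ^+ l / l%:R <= 2 ^+ l' / l'%:R :> R.
Proof.
move=> /andP[l0]; elim: l' => [|k IH]; first by rewrite leqn0 => /eqP <-.
rewrite leq_eqVlt => /predU1P[->//|]; rewrite ltnS => lk.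
have k0 : 0 < k%:R :> R by rewrite ltr0n (leq_trans l0).
have k1 : 1 <= k%:R :> R by rewrite ler1n (leq_trans l0).
apply: le_trans (IH lk) _; rewrite exprS [2 * _]mulrC -[leRHS]mulrA.
rewrite ler_wpM2l ?exprn_ge0// ler_pdivlMr ?ltr0n// mulrC ler_pdivrMr//.
by rewrite -natr1; lra.
Qed.

Definition noise_level_ok {m n : nat} (c sigma : R) (X : 'M[R]_(m, n)) (l : nat) :=
  2 `^ (3 * l%:R / 2) / l%:R `^ (3 / 2) <=
  c * (lambda_min (X^T *m X) / (sigma ^+ 2 * n%:R `^ (3 / 2))).

(** The admissible levels form a finite set by [noise_height_unbounded], so the
maximum is at least [K] as soon as one of them is. *)
Lemma L_noise_ge m n (c sigma : R) (X : 'M[R]_(m, n)) (K : nat) : (0 < K)%N ->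
  (K <= L_noise c sigma X)%N <->
  (exists2 l : nat, (K <= l)%N & noise_level_ok c sigma X l).
Proof.
move=> K0; rewrite /L_noise; set adm := [set l | (0 < l)%N /\ _]; split.
  case: xgetP => [l _ [[l0 hl] _] Kl|_]; first by exists l.
  by rewrite leqNgt K0.
move=> [l Kl hl]; have l0 : (0 < l)%N by exact: leq_trans Kl.
have [B hB] := noise_height_unbounded (c * (lambda_min (X^T *m X) /
  (sigma ^+ 2 * n%:R `^ (3 / 2)))).
pose Q := [pred l : nat | (0 < l)%N && `[< noise_level_ok c sigma X l >]].
have exQ : exists l, Q l by exists l; rewrite /= l0; apply/asboolP.
have ubQ i : Q i -> (i <= B)%N by move=> /andP[i0 /asboolP hi]; exact: hB.
have [M /andP[M0 /asboolP hM] maxM] := ex_maxnP exQ ubQ.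
have [] := @xgetPex nat 0%N [set l | adm l /\ forall l', adm l' -> (l' <= l)%N].
  exists M; split; first by split.
  by move=> l' [l'0 hl']; apply: maxM; rewrite /= l'0; apply/asboolP.
by move=> _ hmax; apply: leq_trans Kl _; apply: hmax; split.
Qed.

(** At an admissible level the noise of a coordinate of the least squares
estimator is at most of the order of the perturbation that the bins tolerate:
in mean square [3 r^3] for [r] the bias times the width of a bin. *)
Lemma noise_dominated m n (c sigma delta : R) (X : 'M[R]_(m, n)) (L : nat) :
  (0 < n)%N -> 0 < sigma -> 0 < c <= 1 -> (0 < L)%N -> (L <= L_noise c sigma X)%N ->
  0 < delta -> ln n%:R <= n%:R * (2 ^+ L)^-1 * delta ^+ 2 -> (2 ^ L <= n)%N ->
  sigma ^+ 2 <= 3 * ((2 ^+ L)^-1 * delta) ^+ 3 * lambda_min (X^T *m X).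
Proof.
move=> n0 s0 /andP[c0 c1] L0 /(L_noise_ge _ _ _ L0) [l Ll hl] d0 hln Ln.
have n0' : 0 < n%:R :> R by rewrite ltr0n.
have L0' : 0 < L%:R :> R by rewrite ltr0n.
have l0 : (0 < l)%N by exact: leq_trans Ll.
have P0 : 0 < 2 ^+ L :> R by rewrite exprn_gt0.
rewrite /noise_level_ok in hl; set lam := lambda_min _ in hl *.
set D := sigma ^+ 2 * n%:R `^ (3 / 2) in hl.
have D0 : 0 < D by rewrite mulr_gt0 ?exprn_gt0 ?powR_gt0.
pose x : R := 2 ^+ L / L%:R.
have x0 : 0 < x by rewrite divr_gt0.
have h1 : Num.sqrt x ^+ 3 <= lam / D.
  have h : Num.sqrt x ^+ 3 <= c * (lam / D).
    move: hl; rewrite noise_heightE//; apply: le_trans.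
    rewrite lerXn2r ?nnegrE ?sqrtr_ge0//; apply: ler_wsqrtr; apply: ler_exp2_div.
    by rewrite L0.
  have : 0 < c * (lam / D).
    by apply: lt_le_trans h; rewrite exprn_gt0// sqrtr_gt0.
  rewrite pmulr_rgt0// => /ltW hp; apply: le_trans h _.
  by rewrite ler_piMl.
have n3 : n%:R `^ (3 / 2) = Num.sqrt n%:R ^+ 3 :> R.
  rewrite -powR12_sqrt ?(ltW n0')// -powR_mulrn ?powR_ge0// -powRrM.
  by congr (_ `^ _); lra.
pose s := Num.sqrt x * Num.sqrt n%:R.
have s_gt0 : 0 < s by rewrite mulr_gt0 ?sqrtr_gt0.
have h2 : sigma ^+ 2 * s ^+ 3 <= lam.
  move: h1; rewrite ler_pdivlMr// /D n3 /s exprMn => h; apply: le_trans h.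
  by rewrite le_eqVlt; apply/orP; left; apply/eqP; ring.
set r := (2 ^+ L)^-1 * delta.
have r0 : 0 < r by rewrite mulr_gt0 ?invr_gt0.
have lnL : L%:R * 2^-1 <= ln n%:R :> R.
  apply: (@le_trans _ _ (L%:R * ln 2)).
    by rewrite ler_wpM2l ?(ltW L0') ?ln2_ge_half.
  by rewrite mulr_natl -lnXn// ler_ln ?posrE// -natrX ler_nat.
have rs : 2^-1 <= (r * s) ^+ 2.
  have -> : (r * s) ^+ 2 = n%:R * (2 ^+ L)^-1 * delta ^+ 2 / L%:R.
    rewrite /s !exprMn !sqr_sqrtr ?(ltW x0) ?(ltW n0')// /x /r.
    by move: (2 ^+ L) P0 => P P0; field; rewrite !gt_eqF.
  by rewrite ler_pdivlMr// mulrC; apply: le_trans hln.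
have rs3 : 1 <= 3 * (r * s) ^+ 3.
  have rs0 : 0 < r * s by rewrite mulr_gt0.
  move: (r * s) rs rs0 => z hz z0.
  have z7 : 7 / 10 <= z by nra.
  rewrite exprSr; nra.
apply: (@le_trans _ _ (3 * r ^+ 3 * (sigma ^+ 2 * s ^+ 3))); last first.
  by rewrite ler_wpM2l// mulr_ge0// exprn_ge0// ltW.
have -> : 3 * r ^+ 3 * (sigma ^+ 2 * s ^+ 3) = sigma ^+ 2 * (3 * (r * s) ^+ 3).
  by ring.
by rewrite -[leLHS]mulr1 ler_wpM2l// sqr_ge0.
Qed.

End truncation_levels.

(** * Convergence in probability *)

Section null_sequences.
Context {R : realType}.

Lemma cvge0_of_near (u : nat -> \bar R) : (forall k, (0 <= u k)%E) ->
  (forall e : R, 0 < e -> \forall k \near \oo, (u k <= e%:E)%E) ->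
  u k @[k --> \oo] --> 0%E.
Proof.
move=> u0 hu; apply/fine_cvgP; split.
  near=> k; rewrite ge0_fin_numE//; apply: (@le_lt_trans _ _ 1%E); last exact: ltry.
  by near: k; exact: hu.
apply/cvgrPdist_le => e e0; near=> k; rewrite sub0r normrN ger0_norm ?fine_ge0//=.
have : (u k <= e%:E)%E by near: k; exact: hu.
have := u0 k; case: (u k) => //= r; by rewrite !lee_fin.
Unshelve. all: by end_near. Qed.

Lemma cvge1_of_compl (d : nat -> measure_display)
    (T : forall k, measurableType (d k)) (P : forall k, probability (T k) R)
    (A : forall k, set (T k)) : (forall k, measurable (A k)) ->
  (forall e : R, 0 < e -> \forall k \near \oo, (P k (~` A k) <= e%:E)%E) ->
  P k (A k) @[k --> \oo] --> 1%E.
Proof.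
move=> mA hA; apply/fine_cvgP; split.
  by apply: nearW => k; exact: fin_num_measure.
apply/cvgrPdist_le => e e0; near=> k.
have : (P k (~` A k) <= e%:E)%E by near: k; exact: hA.
rewrite probability_setC//=.
have := probability_le1 (P k) (mA k); have := fin_num_measure (P k) _ (mA k).
case: (P k (A k)) => //= p _; rewrite -EFinB !lee_fin => p1 pe.
by rewrite ger0_norm// subr_ge0.
Unshelve. all: by end_near. Qed.

End null_sequences.

(** * Random designs *)

Section random_design.
Context {R : realType} {d : measure_display} {T : measurableType d}.
Variables (P : probability T R) (m n : nat) (X : T -> 'M[R]_(m, n)).
Hypothesis n0 : (0 < n)%N.
Hypothesis mX : forall i j, measurable_fun setT (fun w => X w i j).

Lemma lambda_min_gramP (M : 'M[R]_(m, n)) (c : R) :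
  (c <= lambda_min (M^T *m M)) <->
  (forall h : 'cV_n, c * sqnorm h <= sqnorm (M *m h)).
Proof. by case: n n0 M => // n' _ M; exact: lambda_min_gram. Qed.

Lemma measurable_lambda_min (c : R) :
  measurable [set w | c <= lambda_min ((X w)^T *m X w)].
Proof. by case: n n0 X mX => // n' _ Y mY; exact: measurable_lambda_min_ge. Qed.

Lemma rank_of_lambda_min (M : 'M[R]_(m, n)) (c : R) : 0 < c ->
  c <= lambda_min (M^T *m M) -> \rank M = n.
Proof.
move=> c0 /lambda_min_gramP h; apply/eqP; rewrite -mxrank_tr -/(row_free M^T).
rewrite -kermx_eq0; apply/eqP/row_matrixP => i; rewrite row0.
have : sqnorm (M *m (row i (kermx M^T))^T) = 0.
  have -> : M *m (row i (kermx M^T))^T = 0.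
    apply: trmx_inj; rewrite trmx_mul trmxK trmx0.
    by apply: (sub_kermxP _); exact: row_sub.
  by rewrite /sqnorm mulmx0 mxE.
move=> e; have := h (row i (kermx M^T))^T; rewrite e => h0.
have : sqnorm (row i (kermx M^T))^T = 0.
  apply/eqP; rewrite eq_le sqnorm_ge0 andbT.
  by move: h0; rewrite pmulr_rle0.
by move=> /sqnorm_eq0 /(congr1 trmx); rewrite trmxK trmx0.
Qed.

Variables (cCast cnoise alpha sigma : R).
Hypotheses (c0 : 0 < cnoise) (s0 : 0 < sigma).

(** [K <= L_trunc] means that [K] is at most the sampling level and that some
level [l >= K] is admissible for the noise; for each [l], admissibility is a
lower bound on the smallest eigenvalue. *)
Lemma measurable_L_trunc_ge (K : nat) :
  measurable [set w | (K <= L_trunc cCast cnoise alpha sigma (X w))%N].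
Proof.
case: (posnP K) => [->|K0].
  by rewrite (_ : [set _ | _] = setT)//; apply/seteqP; split.
rewrite (_ : [set _ | _] = [set w | (K <= L_Cast cCast alpha n)%N] `&`
    \bigcup_(l in [set l | (K <= l)%N]) [set w | noise_level_ok cnoise sigma (X w) l]).
  apply: measurableI.
    case: (K <= _)%N.
      by rewrite (_ : [set _ | _] = setT)//; apply/seteqP; split.
    by rewrite (_ : [set _ | _] = set0)//; apply/seteqP; split.
  apply: bigcup_measurable => l _.
  set D := sigma ^+ 2 * n%:R `^ (3 / 2).
  have D0 : 0 < D by rewrite mulr_gt0 ?exprn_gt0 ?powR_gt0 ?ltr0n.
  rewrite (_ : [set _ | _] = [set w | 2 `^ (3 * l%:R / 2) / l%:R `^ (3 / 2) / cnoise * D <=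
      lambda_min ((X w)^T *m X w)]); first exact: measurable_lambda_min.
  apply/funext => w /=; rewrite /noise_level_ok -/D; congr is_true.
  by rewrite -[RHS]ler_pdivlMr// [RHS]ler_pdivrMr// [X in _ = (_ <= X)]mulrC.
apply/seteqP; split => w /=; rewrite /L_trunc leq_min.
  move=> /andP[h1 /(L_noise_ge _ _ _ K0)[l h2 h3]]; split => //.
  by exists l.
move=> [h1 [l h2 h3]]; rewrite h1; apply/(L_noise_ge _ _ _ K0).
by exists l.
Qed.

Lemma measurable_L_trunc_preimage (A : set nat) :
  measurable [set w | A (L_trunc cCast cnoise alpha sigma (X w))].
Proof.
rewrite (_ : [set _ | _] = \bigcup_(l in A)
  ([set w | (l <= L_trunc cCast cnoise alpha sigma (X w))%N] `\`
   [set w | (l.+1 <= L_trunc cCast cnoise alpha sigma (X w))%N])).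
  by apply: bigcup_measurable => l _; apply: measurableD; exact: measurable_L_trunc_ge.
apply/seteqP; split => w /=.
  by move=> Aw; exists (L_trunc cCast cnoise alpha sigma (X w)) => //=; rewrite leqnn ltnn.
move=> [l Al [/= h1 h2]]; suff <- : l = L_trunc cCast cnoise alpha sigma (X w) by [].
by apply/eqP; rewrite eqn_leq h1 leqNgt; apply/negP.
Qed.

End random_design.

(** * Divergence of the truncation level *)

Section levels_grow.
Context {R : realType}.

Lemma L_Cast_unbounded (cCast alpha : R) (K : nat) : 0 < cCast -> 0 < alpha ->
  exists n1 : nat, forall n, (n1 <= n)%N -> (K <= L_Cast cCast alpha n)%N.
Proof.
move=> c0 al0; case: (posnP K) => [->|K0]; first by exists 0%N.
pose p := 2 * alpha + 1; have p0 : 0 < p by rewrite /p; lra.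
pose t : R := (2 ^+ K / cCast) `^ p.
have t0 : 0 < t by rewrite powR_gt0// divr_gt0// exprn_gt0.
exists (maxn 4 (Num.truncn (4 * t ^+ 2)).+1) => n; rewrite geq_max => /andP[n4 nt].
have ln0 : 0 < ln n%:R :> R by apply: lt_le_trans (ln_ge1 n4).
have n0 : 0 < n%:R :> R by rewrite ltr0n (leq_trans _ n4).
have q0 : 0 < n%:R / ln n%:R :> R by rewrite divr_gt0.
rewrite L_Cast_ge ?mulr_gt0 ?powR_gt0// -/p.
have tq : t <= n%:R / ln n%:R.
  have sn0 : 0 < Num.sqrt n%:R :> R by rewrite sqrtr_gt0.
  have sn : Num.sqrt n%:R ^+ 2 = n%:R :> R by rewrite sqr_sqrtr// ltW.
  have lnle : ln n%:R <= 2 * Num.sqrt n%:R :> R.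
    rewrite -{1}sn lnXn// mulr2n.
    have := @ln_sublinear R _ sn0; lra.
  have tn : 2 * t <= Num.sqrt n%:R.
    rewrite -[leLHS]ger0_norm ?mulr_ge0 ?(ltW t0)// -sqrtr_sqr ler_sqrt ?(ltW n0)//.
    have : 4 * t ^+ 2 < n%:R.
      rewrite -truncn_lt_nat// mulr_ge0// sqr_ge0//.
    by move=> /ltW h; apply: le_trans h; rewrite exprMn; lra.
  rewrite ler_pdivlMr//; apply: le_trans (ler_wpM2l (ltW t0) lnle) _.
  have := ler_wpM2r (ltW sn0) tn; rewrite -expr2 sn; lra.
rewrite mulrC -ler_pdivrMr//.
have -> : 2 ^+ K / cCast = t `^ p^-1.
  rewrite /t -powRrM mulfV ?gt_eqF// powRr1// divr_ge0 ?exprn_ge0//; exact: ltW.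
by apply: ge0_ler_powR; rewrite ?nnegrE ?(ltW t0) ?(ltW q0) ?invr_ge0 ?(ltW p0).
Qed.

Lemma delta_small (alpha e : R) : 0 < alpha -> 0 < e ->
  exists K : nat, forall L, (K <= L)%N -> 2 `^ (- alpha * L%:R) <= e.
Proof.
move=> al0 e0.
have ln20 : 0 < ln 2 :> R by apply: lt_le_trans ln2_ge_half.
pose c : R := (e * (alpha * ln 2))^-1.
have al20 : 0 < alpha * ln 2 by rewrite mulr_gt0.
have c0 : 0 < c by rewrite invr_gt0 mulr_gt0.
exists (Num.truncn c).+1 => L KL.
have cL : c <= L%:R by rewrite ltW// -truncn_lt_nat ?(ltW c0).
rewrite powR2E mulNr mulNr expRN.
have h : 1 + alpha * L%:R * ln 2 <= expR (alpha * L%:R * ln 2) by exact: expR_ge1Dx.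
rewrite -[leRHS]invrK lef_pV2 ?posrE ?expR_gt0 ?invr_gt0//.
apply: le_trans h; have := ler_wpM2l (ltW al20) cL.
rewrite {1}/c invfM mulrCA mulfV ?gt_eqF// mulr1; lra.
Qed.

(** Both terms of the rate are of the order of the bias at admissible levels. *)
Lemma rate_le (a b alpha : R) (n L : nat) : a < b -> (3 < n)%N -> (0 < L)%N ->
  ln n%:R <= n%:R * (2 ^+ L)^-1 * 2 `^ (- alpha * L%:R) ^+ 2 -> (2 ^ L <= n)%N ->
  0 <= rate a b alpha n L <=
    ((b - a) `^ alpha + (b - a)^-1 * 2) * 2 `^ (- alpha * L%:R).
Proof.
move=> ab n3 L0 hln Ln; rewrite /rate; set delta := 2 `^ _ in hln *.
have w0 : 0 < b - a by rewrite subr_gt0.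
have d0 : 0 < delta by rewrite powR_gt0.
have n0 : 0 < n%:R :> R by rewrite ltr0n (leq_trans _ n3).
have P0 : 0 < 2 ^+ L :> R by rewrite exprn_gt0.
apply/andP; split.
  by rewrite addr_ge0 ?mulr_ge0 ?powR_ge0 ?invr_ge0 ?sqrtr_ge0 ?(ltW w0) ?(ltW d0).
rewrite mulrDl lerD2l -[leRHS]mulrA ler_wpM2l ?invr_ge0 ?(ltW w0)//.
rewrite -[leRHS]ger0_norm ?mulr_ge0 ?(ltW d0)// -sqrtr_sqr ler_wsqrtr//.
have hL : L%:R * 2^-1 <= ln n%:R :> R.
  apply: (@le_trans _ _ (L%:R * ln 2)); first by rewrite ler_wpM2l// ln2_ge_half.
  by rewrite mulr_natl -lnXn// ler_ln ?posrE// -natrX ler_nat.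
have h : L%:R * 2^-1 <= n%:R / 2 ^+ L * delta ^+ 2 := le_trans hL hln.
rewrite ler_pdivrMr// -ler_pdivlMr//.
have -> : (2 * delta) ^+ 2 * n%:R / 2 ^+ L = 4 * (n%:R / 2 ^+ L * delta ^+ 2) by ring.
have : 0 <= n%:R / 2 ^+ L * delta ^+ 2 by rewrite !mulr_ge0 ?invr_ge0 ?sqr_ge0 ?ltW.
by lra.
Qed.

End levels_grow.

Section data_expectation_bounds.
Local Open Scope ereal_scope.
Context {R : realType}.
Variables (a b : R) (g0 : R -> R) (n m : nat) (sigma : R) (X : 'M[R]_(m, n)).
Hypotheses (dg0 : density_on a b g0) (sigma0 : (0 < sigma)%R).
Variable F : m.-tuple R -> R.
Hypothesis F01 : forall y, (0 <= F y <= 1)%R.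
Let F0 y : (0 <= F y)%R. Proof. by have /andP[] := F01 y. Qed.

Let inner_ge0 t : 0 <= \int[lebesgue_pow R m]_y (response_pdf sigma X t y * F y)%:E.
Proof. by apply: integral_ge0 => y _; rewrite lee_fin mulr_ge0 ?response_pdf_ge0. Qed.

Lemma data_expectation_ge0 : 0 <= data_expectation g0 sigma X F.
Proof.
apply: integral_ge0 => t _; rewrite mule_ge0 ?inner_ge0// lee_fin.
exact: (iid_pdf_ge0 dg0).
Qed.

Lemma data_expectation_le1 : data_expectation g0 sigma X F <= 1.
Proof.
rewrite -(integral_iid_pdf dg0 n); apply: ge0_le_integral_nm => t.
  by rewrite mule_ge0 ?inner_ge0// lee_fin; exact: (iid_pdf_ge0 dg0).
rewrite -[leRHS]mule1; apply: lee_wpmul2l; first by rewrite lee_fin; exact: (iid_pdf_ge0 dg0).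
rewrite -(integral_noise_pdf (lin_pred X t) sigma0); apply: ge0_le_integral_nm => y.
  by rewrite lee_fin mulr_ge0 ?response_pdf_ge0.
by rewrite lee_fin ler_piMr ?response_pdf_ge0//; have /andP[] := F01 y.
Qed.

End data_expectation_bounds.

Section admissible_levels.
Context {R : realType}.
Variables (a b alpha L0 m0 M0 : R).
Hypotheses (ab : a < b) (alpha0 : 0 < alpha) (m0_gt0 : 0 < m0) (mM : m0 <= M0).
Variables (g0 : R -> R) (cCast cnoise : R).
Hypotheses (dg0 : density_on a b g0) (hg0 : holder_bounded a b alpha L0 m0 M0 g0).
Hypotheses (hCast : 0 < cCast <= 1) (hnoise : 0 < cnoise <= 1).

(** The bounds on the truncation level give the balance conditions of
[contraction_fixed_design]; the smallness conditions on [2 `^ (- alpha * L)]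
hold at all large levels. *)
Lemma contraction_at_level (C0 : R) : contraction_const a b alpha L0 m0 M0 <= C0 ->
  exists K : nat, forall (n m : nat) (sigma : R) (X : 'M[R]_(m, n)),
    let L := L_trunc cCast cnoise alpha sigma X in
    (3 < n)%N -> 0 < sigma -> (K <= L)%N ->
    (data_expectation g0 sigma X (fun y => posterior a b sigma L X y
       [set g | ((C0 * rate a b alpha n L)%:E <
                 sup_norm a b (fun x => g x - g0 x)%R)%E]) <= (6 / n%:R)%:E)%E.
Proof.
move=> hC.
have absorb (c s x : R) : 0 <= x -> x <= s / (`|c| + 1) -> c * x <= s.
  move=> x0; rewrite ler_pdivlMr ?ltr_wpDl// => h; apply: le_trans h.
  by have := ler_norm c; nra.
have half1 : 2^-1 <= 1 :> R by lra.
pose s1 := m0 * (b - a) / 2 / (`|count_slack a b M0| + 1).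
pose s2 : R := 2^-1 / (`|mass_slack (m0 * (b - a)) (M0 * (b - a))| + 1).
have s10 : 0 < s1 by rewrite divr_gt0 ?divr_gt0 ?mulr_gt0 ?subr_gt0// ltr_wpDl.
have s20 : 0 < s2 by rewrite divr_gt0 ?invr_gt0// ltr_wpDl.
have [K1 hK1] := delta_small alpha0 s10.
have [K2 hK2] := delta_small alpha0 s20.
have [K3 hK3] := @delta_small R alpha 2^-1 alpha0 ltac:(by rewrite invr_gt0).
exists (maxn 1 (maxn K1 (maxn K2 K3))) => n m sigma X L n3 sigma0.
rewrite !geq_max => /and4P[L_gt0 /hK1 d1 /hK2 d2 /hK3 d3].
have n0 : (0 < n)%N by exact: leq_trans n3.
have := leqnn L; rewrite {2}/L /L_trunc leq_min => /andP[LC LN].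
have d0 : 0 < 2 `^ (- alpha * L%:R) :> R by rewrite powR_gt0.
have lnn := bias_dominates alpha0 hCast n3 L_gt0 LC.
have Ln : (2 ^ L <= n)%N.
  by apply: (bins_le_sample n3 _ lnn); rewrite (ltW d0) (le_trans d3).
apply: (contraction_fixed_design ab alpha0 m0_gt0 mM dg0 hg0 _ sigma0
  (lam := lambda_min (X^T *m X)) _ lnn Ln) => //.
- exact: leq_trans n3.
- by apply/(lambda_min_gramP n0).
- exact: (noise_dominated n0 sigma0 hnoise L_gt0 LN d0 lnn Ln).
- by apply: absorb => //; exact: ltW.
- by apply: absorb => //; exact: ltW.
Qed.

Lemma rate_at_level (e : R) : 0 < e ->
  exists K : nat, forall (n m : nat) (sigma : R) (X : 'M[R]_(m, n)),
    let L := L_trunc cCast cnoise alpha sigma X in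
    (3 < n)%N -> (K <= L)%N -> `|rate a b alpha n L| <= e.
Proof.
move=> e0; have w0 : 0 < b - a by rewrite subr_gt0.
pose c := (b - a) `^ alpha + (b - a)^-1 * 2.
have c0 : 0 < c by rewrite addr_gt0 ?powR_gt0 ?mulr_gt0 ?invr_gt0.
have [K1 hK1] := delta_small alpha0 (divr_gt0 e0 c0).
have [K2 hK2] := delta_small alpha0 (@ltr01 R).
exists (maxn 1 (maxn K1 K2)) => n m sigma X L n3.
rewrite !geq_max => /and3P[L_gt0 /hK1 d1 /hK2 d2].
have := leqnn L; rewrite {2}/L /L_trunc leq_min => /andP[LC _].
have lnn := bias_dominates alpha0 hCast n3 L_gt0 LC.
have Ln : (2 ^ L <= n)%N by apply: (bins_le_sample n3 _ lnn); rewrite powR_ge0.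
have /andP[r0 r1] := rate_le ab n3 L_gt0 lnn Ln.
rewrite ger0_norm//; apply: le_trans r1 _.
by rewrite -/c mulrC -ler_pdivlMr.
Qed.

End admissible_levels.

Section gaussian_designs.
Context {R : realType}.

Lemma measurable_design d (T : measurableType d) (P : probability T R) (m n : nat)
    (X : T -> 'M[R]_(m, n)) (mu : 'cV[R]_n) (Sigma : 'M[R]_n) :
  gaussian_design P X mu Sigma ->
  forall i j, measurable_fun setT (fun w => X w i j).
Proof.
move=> [_ h] i j; have [_ _ + _] := h i => /(_ j).
by under eq_fun do rewrite !mxE.
Qed.

(** The exponential tail is weakened to [2 / (xi m)], using
[exp (- x) <= 1 / x], as any null sequence will do. *)
Lemma gaussian_gram_tail (Gamma : R) : universal_Gamma Gamma ->
  exists2 xi : R, 0 < xi & forall (kappa : R), 0 < kappa ->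
    forall d (T : measurableType d) (P : probability T R) (m n : nat)
      (X : T -> 'M[R]_(m, n)) (mu : 'cV[R]_n) (Sigma : 'M[R]_n),
    (0 < n <= m)%N -> gaussian_design P X mu Sigma ->
    kappa <= lambda_min (second_moment mu Sigma) -> Gamma * n%:R <= m%:R ->
    (P (~` [set w | (kappa * m%:R / 4 <= lambda_min ((X w)^T *m X w))%R]) <=
     (2 / (xi * m%:R))%:E)%E.
Proof.
move=> [_ [xi xi0 h]]; exists xi => // kappa k0 d T P m n X mu Sigma /andP[n0 nm] gX hk hG.
have m0 : 0 < m%:R :> R by rewrite ltr0n (leq_trans n0).
have mX := measurable_design gX.
have := h _ k0 _ _ P _ _ X _ _ gX hk hG.
rewrite (_ : [set w | \rank _ = n /\ _] =
  [set w | (kappa * m%:R / 4 <= lambda_min ((X w)^T *m X w))%R]); last first.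
  apply/seteqP; split => w /= => [[]//|hw]; split => //.
  by apply: (rank_of_lambda_min n0 _ hw); rewrite divr_gt0 ?mulr_gt0.
set E := [set w | _]; have mE : measurable E by exact: measurable_lambda_min.
rewrite probability_setC//.
rewrite -(fineK (fin_num_measure P _ mE)) -EFinB !lee_fin => hp.
have x0 : 0 < xi * m%:R by rewrite mulr_gt0.
suff : expR (- xi * m%:R) <= (xi * m%:R)^-1 by rewrite -div1r; lra.
rewrite mulNr expRN lef_pV2 ?posrE ?expR_gt0//.
by apply: le_trans (expR_ge1Dx _); lra.
Qed.

End gaussian_designs.

Lemma near_ge_of_cvg (u : nat -> nat) : u k @[k --> \oo] --> \oo ->
  forall K, \forall k \near \oo, (K <= u k)%N.
Proof. by move=> h K; exact: (h _ (nbhs_infty_ge K)). Qed.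

Section truncation_level_diverges.
Context {R : realType}.
Variables (alpha cCast cnoise Gamma kappa : R).
Hypotheses (alpha0 : 0 < alpha) (cCast0 : 0 < cCast) (cnoise0 : 0 < cnoise).
Hypotheses (hGamma : universal_Gamma Gamma) (kappa0 : 0 < kappa).
Variables (mu : forall n : nat, 'cV[R]_n) (Sigma : forall n : nat, 'M[R]_n).
Variables (sigma : nat -> R) (m n : nat -> nat).
Hypothesis hOmega : forall n, (0 < n)%N ->
  kappa <= lambda_min (second_moment (mu n) (Sigma n)).
Hypothesis sigma0 : forall k, 0 < sigma k.
Variables (d : nat -> measure_display) (T : forall k, measurableType (d k)).
Variables (P : forall k, probability (T k) R) (X : forall k, T k -> 'M[R]_(m k, n k)).
Hypothesis nm : forall k, (0 < n k <= m k)%N.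
Hypotheses (moo : m k @[k --> \oo] --> \oo) (noo : n k @[k --> \oo] --> \oo).
Hypothesis gX : forall k, gaussian_design (P k) (@X k) (mu (n k)) (Sigma (n k)).
Hypothesis mGamma : \forall k \near \oo, Gamma * (n k)%:R <= (m k)%:R.
Hypothesis snr : ((m k)%:R / (sigma k ^+ 2 * (n k)%:R `^ (3 / 2)) : R)
  @[k --> \oo] --> +oo.

(** When the Gram matrix has its typical size [kappa m / 4], any given level is
admissible for the noise once [m / (sigma^2 n^(3/2))] is large. *)
Lemma L_trunc_diverges (K : nat) (e : R) : 0 < e -> \forall k \near \oo,
  (P k (~` [set w | (K <= L_trunc cCast cnoise alpha (sigma k) (X w))%N]) <= e%:E)%E.
Proof.
move=> e0; have [xi xi0 tail] := gaussian_gram_tail hGamma.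
have [n1 hn1] := L_Cast_unbounded (maxn 1 K) cCast0 alpha0.
pose h : R := 2 `^ (3 * (maxn 1 K)%:R / 2) / (maxn 1 K)%:R `^ (3 / 2).
pose q : R := 4 * h / (cnoise * kappa).
near=> k.
have n0 : (0 < n k)%N by have /andP[] := nm k.
have mX := measurable_design (gX k).
have m0 : 0 < (m k)%:R :> R by rewrite ltr0n; have /andP[/leq_trans] := nm k; apply.
have kG : Gamma * (n k)%:R <= (m k)%:R by near: k.
have := tail _ kappa0 _ _ (P k) _ _ _ _ _ (nm k) (gX k) (hOmega n0) kG.
set E := [set w | _] => hE.
apply: (@le_trans _ _ (P k (~` E))); last apply: le_trans hE _.
  apply: le_measure; rewrite ?inE.
  - by apply: measurableC; exact: measurable_L_trunc_ge.
  - by apply: measurableC; exact: measurable_lambda_min.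
  - apply: subsetC => w /= hw; apply: (@leq_trans (maxn 1 K)); first exact: leq_maxr.
    rewrite leq_min hn1/=; last by near: k; exact: near_ge_of_cvg.
    apply/(@L_noise_ge R _ _ _ _ _ (maxn 1 K)); first by rewrite leq_maxl.
    exists (maxn 1 K) => //; rewrite /noise_level_ok -/h.
    have hq : q <= (m k)%:R / (sigma k ^+ 2 * (n k)%:R `^ (3 / 2)).
      by near: k; move: snr => /cvgryPge; apply.
    set D := sigma k ^+ 2 * _ in hq *.
    have D0 : 0 < D by rewrite mulr_gt0 ?exprn_gt0 ?powR_gt0 ?ltr0n.
    apply: (@le_trans _ _ (cnoise * (kappa * (m k)%:R / 4 / D))); last first.
      by rewrite ler_wpM2l ?(ltW cnoise0)// ler_wpM2r ?invr_ge0 ?(ltW D0).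
    move: hq; rewrite /q ler_pdivrMr ?mulr_gt0//.
    have -> : cnoise * (kappa * (m k)%:R / 4 / D) = (m k)%:R / D * (cnoise * kappa) / 4.
      by ring.
    by rewrite ler_pdivlMr// mulrC.
rewrite lee_fin ler_pdivrMr ?mulr_gt0//.
have : 2 / (e * xi) <= (m k)%:R.
  apply: (@le_trans _ _ (Num.truncn (2 / (e * xi))).+1%:R).
    by rewrite ltW// -truncn_lt_nat// divr_ge0// mulr_ge0 ?ltW.
  by rewrite ler_nat; near: k; exact: near_ge_of_cvg.
by rewrite ler_pdivrMr ?mulr_gt0//; lra.
Unshelve. all: by end_near. Qed.

End truncation_level_diverges.

Theorem corollary4p5 (R : realType) (a b alpha L0 m0 M0 : R)
    (hab : a < b) (halpha : 0 < alpha <= 1) (hm0 : 0 < m0) (hM0 : m0 <= M0) :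
  exists2 cbar : R, 0 < cbar &
  forall cCast cnoise : R, 0 < cCast <= cbar -> 0 < cnoise <= cbar ->
  forall g0 : R -> R, density_on a b g0 ->
    holder_bounded a b alpha L0 m0 M0 g0 ->
  forall Gamma kappa : R, universal_Gamma Gamma -> 0 < kappa ->
  forall (mu : forall n : nat, 'cV[R]_n) (Sigma : forall n : nat, 'M[R]_n)
    (sigma : nat -> nat -> R),
    (forall n, (0 < n)%N ->
       kappa <= lambda_min (second_moment (mu n) (Sigma n))) ->
    (forall m n, 0 < sigma m n) ->
  exists2 C0 : R, 0 < C0 &
  forall (m n : nat -> nat)
    (d : nat -> measure_display) (T : forall k, measurableType (d k))
    (P : forall k, probability (T k) R)
    (X : forall k, T k -> 'M[R]_(m k, n k)),
    (forall k, (0 < n k <= m k)%N) ->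
    m k @[k --> \oo] --> \oo ->
    n k @[k --> \oo] --> \oo ->
    (forall k, gaussian_design (P k) (X k) (mu (n k)) (Sigma (n k))) ->
    (\forall k \near \oo, Gamma * (n k)%:R <= (m k)%:R) ->
    ((m k)%:R / (sigma (m k) (n k) ^+ 2 * (n k)%:R `^ (3 / 2)) : R)
      @[k --> \oo] --> +oo ->
    let s := fun k => sigma (m k) (n k) in
    let L := fun k (w : T k) => L_trunc cCast cnoise alpha (s k) (X k w) in
    let eps := fun k (w : T k) => rate a b alpha (n k) (L k w) in
    [/\ forall K : nat,
          P k [set w | (K <= L k w)%N] @[k --> \oo] --> 1%E,
        forall delta : R, 0 < delta ->
          P k [set w | delta < `|eps k w|] @[k --> \oo] --> 0%E &
        (\int[P k]_w
           data_expectation g0 (s k) (X k w) (fun y =>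
             posterior a b (s k) (L k w) (X k w) y
               [set g | ((C0 * eps k w)%:E <
                         sup_norm a b (fun x => g x - g0 x)%R)%E]))%E
          @[k --> \oo] --> 0%E].
Proof.
have /andP[alpha0 _] := halpha.
exists 1 => // cCast cnoise hCast hnoise g0 dg0 hg0 Gamma kappa hGamma kappa0 mu Sigma sigma.
move=> hOmega sigma_gt0.
have /andP[cCast0 _] := hCast; have /andP[cnoise0 _] := hnoise.
set C0 := Num.max 1 (contraction_const a b alpha L0 m0 M0).
exists C0; first by rewrite lt_max ltr01.
move=> m n d T P X nm moo noo gX mGamma snr s L eps.
have s0 k : 0 < s k by exact: sigma_gt0.
have n0 k : (0 < n k)%N by have /andP[] := nm k.
have mX k := measurable_design (gX k).
have mL K k : measurable [set w | (K <= L k w)%N].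
  by apply: measurable_L_trunc_ge.
have diverges K e : 0 < e -> \forall k \near \oo,
    (P k (~` [set w | (K <= L k w)%N]) <= e%:E)%E.
  exact: (L_trunc_diverges alpha0 cCast0 cnoise0 hGamma kappa0 hOmega s0).
split.
- by move=> K; apply: cvge1_of_compl => // e; exact: diverges.
- move=> delta delta0; apply: cvge0_of_near => // e e0.
  have [K hK] := rate_at_level hab alpha0 cnoise hCast delta0.
  near=> k; apply: (@le_trans _ _ (P k (~` [set w | (K <= L k w)%N]))).
    apply: le_measure; rewrite ?inE.
    + exact: (measurable_L_trunc_preimage (n0 k) (mX k) _ _ cnoise0 (s0 k)
        [set l | delta < `|rate a b alpha (n k) l|]).
    + by apply: measurableC.
    + move=> w /= hw /hK h; move: hw; rewrite ltNge h//.
      by near: k; exact: near_ge_of_cvg.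
  by near: k; exact: diverges.
- have hC : contraction_const a b alpha L0 m0 M0 <= C0 by rewrite le_max lexx orbT.
  have [K hK] := contraction_at_level hab alpha0 hm0 hM0 dg0 hg0 hCast hnoise hC.
  apply: cvge0_of_near => [k|e e0].
    apply: integral_ge0 => w _; apply: (data_expectation_ge0 _ _ dg0) => y.
    by rewrite posterior_ge0 ?posterior_le1.
  near=> k; set F := fun w : T k => data_expectation _ _ _ _.
  have F0 w : (0 <= F w)%E.
    by apply: (data_expectation_ge0 _ _ dg0) => y; rewrite posterior_ge0 ?posterior_le1.
  pose B := ~` [set w | (K <= L k w)%N].
  have mB : measurable B by exact: measurableC.
  (* On the rare event [B] of a low level, the integrand is at most 1. *)
  apply: (@le_trans _ _ (\int[P k]_w ((6 / (n k)%:R)%:E + (\1_B w)%:E))%E).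
    apply: ge0_le_integral_nm => // w.
    have [KL|KL] := boolP (K <= L k w)%N.
      rewrite -[leLHS]adde0 leeD ?lee_fin//.
      by apply: hK => //; near: k; exact: near_ge_of_cvg.
    rewrite indicE mem_set; last exact/negP.
    rewrite -[leLHS]add0e leeD ?lee_fin ?divr_ge0//.
    by apply: (data_expectation_le1 _ dg0) => // y; rewrite posterior_ge0 ?posterior_le1.
  rewrite ge0_integralD//; first last.
  + by apply/measurable_EFinP; exact: measurable_indic.
  rewrite integral_indic// setIT integral_cst//.
  rewrite [X in (_ * X)%E](_ : _ = 1%E); last exact: probability_setT.
  rewrite mule1.
  rewrite (_ : e%:E = ((e / 2)%:E + (e / 2)%:E)%E); last by rewrite -EFinD -splitr.
  apply: leeD; last by rewrite /B; near: k; apply: diverges; rewrite divr_gt0.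
  rewrite lee_fin ler_pdivrMr ?ltr0n//.
  have : 12 / e <= (n k)%:R.
    apply: (@le_trans _ _ (Num.truncn (12 / e)).+1%:R).
      by rewrite ltW// -truncn_lt_nat// divr_ge0 ?ltW.
    by rewrite ler_nat; near: k; exact: near_ge_of_cvg.
  by rewrite ler_pdivrMr//; lra.
Unshelve. all: by end_near. Qed.
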